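(* Let $y=X\beta+\varepsilon$ with $X\in\mathbb{R}^{n\times p}$ deterministic, $\beta\in\mathbb{R}^p$, $\varepsilon\sim N(0,\sigma^2I_n)$. Let $\lambda>0$ be fixed and $\widehat\beta=\widehat\beta(\lambda)=\arg\min_bL(b;\lambda)$, where $L(b;\lambda)=(2n)^{-1}\|y-Xb\|^2+\sum_{j=1}^p\rho(|b_j|;\lambda)$. Suppose $\kappa(\rho;\lambda)<c_{\min}(\Sigma)$, where $\Sigma=X'X/n$ and $c_{\min}(\Sigma)$ is its smallest eigenvalue. Let $\widehat P$ be the $d(\widehat\beta)\times p$ matrix giving the projection $\widehat Pb=(b_j:\widehat\beta_j\ne0)'$, where $d(\widehat\beta)=\#\{j:\widehat\beta_j\neq0\}$, and let $\widetilde\beta=\Sigma^{-1}X'y/n$ be the ordinary least squares estimator. Then $$E(\widehat\beta-\beta)(\widehat\beta-\beta)'=E\Big\{(\widehat\beta-\widetilde\beta)(\widehat\beta-\widetilde\beta)'+\frac{2\sigma^2}{n}\widehat P'Q^{-1}(\widehat\beta;\lambda)\widehat P\Big\}-\frac{\sigma^2}{n}\Sigma^{-1}.$$ In particular, for all $a\in\mathbb{R}^p$, $$|a'(\widehat\beta-\widetilde\beta)|^2+\frac{2\widehat\sigma^2}{n}(\widehat Pa)'Q^{-1}(\widehat\beta;\lambda)(\widehat Pa)-\frac{\widehat\sigma^2}{n}a'\Sigma^{-1}a$$ is an unbiased estimator of the mean squared error $E|a'(\widehat\beta-\beta)|^2$, provided $\widehat\sigma^2=\sigma^2$ in the case of known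 $\sigma^2$, or $\widehat\sigma^2=\|y-X\widetilde\beta\|^2/(n-p)$ in the case of $p<n$. Consequently, with such $\widehat\sigma^2$, $$E\Big\{\|\widehat\beta-\widetilde\beta\|^2+\frac{2\widehat\sigma^2}{n}\mathrm{trace}(Q^{-1}(\widehat\beta;\lambda))-\frac{\widehat\sigma^2}{n}\mathrm{trace}(\Sigma^{-1})\Big\}=E\|\widehat\beta-\beta\|^2.$$
   Context: Penalty: $\rho(\cdot;\lambda)$ is nondecreasing on $[0,\infty)$ with continuous derivative $\dot\rho(t;\lambda)=\partial\rho(t;\lambda)/\partial t$ on $(0,\infty)$, $\dot\rho(0+;\lambda)>0$, normalized so that $\dot\rho(0+;\lambda)=\lambda$ whenever finite, and is almost twice differentiable: there is a function $\ddot\rho(\cdot;\lambda)$ with $\dot\rho(t;\lambda)=\dot\rho(1;\lambda)+\int_1^t\ddot\rho(x;\lambda)\,dx$ for all $t>0$. Maximum concavity: $\kappa(\rho;\lambda)=\sup_{0<t_1<t_2}\{\dot\rho(t_1;\lambda)-\dot\rho(t_2;\lambda)\}/(t_2-t_1)$. $Q(\beta;\lambda)=\Sigma_{\{j:\beta_j\ne0\}}+\mathrm{diag}(\ddot\rho(|\beta_j|;\lambda),\beta_j\ne0)$, where $\Sigma_A$ is the $A\times A$ submatrix of $\Sigma$; terms involving an empty index set are zero.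
   Formalization: The penalty is additionally assumed right-continuous at 0; with a jump there (e.g. ρ(0)=0, ρ(t)=c+λt for t>0, n=p=1) the estimator is discontinuous in y and the stated risk identity fails. *)

(* Defs.v *)
From HB Require Import structures.
From mathcomp Require Import all_boot all_order all_algebra.
From mathcomp Require Import all_classical all_reals all_analysis.

Set Implicit Arguments.
Unset Strict Implicit.
Unset Printing Implicit Defensive.

Import Order.TTheory GRing.Theory Num.Theory.
Import numFieldNormedType.Exports.

Local Open Scope classical_set_scope.
Local Open Scope ring_scope.

(* A penalty is a family rho t lam = rho(t; lambda); only its values at t >= 0
   matter. *)

Definition drho (R : realType) (rho : R -> R -> R) (lam : R) : R -> R :=
  derive1 (fun t => rho t lam).

(* The oriented integral of f from a to b, also for b < a. *)
Definition oriented_int (R : realType) (f : R -> R) (a b : R) : R :=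
  if a <= b then \int[lebesgue_measure]_(x in `[a, b]) f x
  else - (\int[lebesgue_measure]_(x in `[b, a]) f x).

(* ddrho is one fixed version of the second derivative, which the integral
   identity determines only almost everywhere. *)
Record penalty (R : realType) (rho ddrho : R -> R -> R) (lam : R) : Prop := {
  penalty_nondecreasing :
    forall s t : R, 0 <= s -> s <= t -> rho s lam <= rho t lam ;
  (* The remaining conditions only see rho on ]0, +oo[ ; this one excludes a
     jump of the penalty at the origin. *)
  penalty_continuous0 : (rho t lam) @[t --> 0^'+] --> rho 0 lam ;
  penalty_derivable :
    forall t : R, 0 < t -> derivable (fun s => rho s lam) t 1 ;
  penalty_continuous_derive :
    forall t : R, 0 < t -> {for t, continuous (drho rho lam)} ;
  (* The limit at 0+ is taken in the extended reals, as it may be infinite. *)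
  penalty_slope0 :
    exists l : \bar R,
      [/\ (drho rho lam t)%:E @[t --> 0^'+] --> l, (0 < l)%E
        & forall r : R, l = r%:E -> r = lam] ;
  penalty_ddrho_integrable :
    forall s t : R, 0 < s -> s <= t ->
      (@lebesgue_measure R).-integrable `[s, t]
        (fun x => (ddrho x lam)%:E) ;
  penalty_almost_twice_derivable :
    forall t : R, 0 < t ->
      drho rho lam t = drho rho lam 1 + oriented_int (ddrho ^~ lam) 1 t }.

Definition max_concavity (R : realType) (rho : R -> R -> R) (lam : R) : \bar R :=
  ereal_sup [set k | exists t1 t2 : R, [/\ 0 < t1, t1 < t2
    & k = ((drho rho lam t1 - drho rho lam t2) / (t2 - t1))%:E]].

(* For p > 0 and A symmetric the set is finite and nonempty, so the infimum is
   the smallest eigenvalue. *)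
Definition cmin (R : realType) (p : nat) (A : 'M[R]_p) : R :=
  inf [set c : R | eigenvalue A c].

(* The norm that the library puts on matrices is the sup norm, hence this
   squared Euclidean norm. *)
Definition sqnorm (R : realType) (m : nat) (v : 'cV[R]_m) : R :=
  \sum_i v i 0 ^+ 2.

Definition gram (R : realType) (n p : nat) (X : 'M[R]_(n, p)) : 'M[R]_p :=
  n%:R^-1 *: (X^T *m X).

Definition ols (R : realType) (n p : nat) (X : 'M[R]_(n, p)) (y : 'cV[R]_n) :
    'cV[R]_p :=
  n%:R^-1 *: (invmx (gram X) *m X^T *m y).

Definition ploss (R : realType) (n p : nat) (X : 'M[R]_(n, p)) (y : 'cV[R]_n)
    (rho : R -> R -> R) (lam : R) (b : 'cV[R]_p) : R :=
  (2 * n%:R)^-1 * sqnorm (y - X *m b) + \sum_j rho `|b j 0| lam.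

Definition is_argmin (R : realType) (T : Type) (f : T -> R) (x : T) : Prop :=
  forall z, f x <= f z.

Definition supp (R : realType) (p : nat) (b : 'cV[R]_p) : {set 'I_p} :=
  [set j | b j 0 != 0]%SET.

(* enum_val lists the support in increasing order; #|supp b| is d(b). *)
Definition Pmx (R : realType) (p : nat) (b : 'cV[R]_p) :
    'M[R]_(#|supp b|, p) :=
  rowsub (fun i => enum_val i) 1%:M.

Definition Qmx (R : realType) (n p : nat) (X : 'M[R]_(n, p))
    (ddrho : R -> R -> R) (b : 'cV[R]_p) (lam : R) : 'M[R]_#|supp b| :=
  mxsub (fun i => enum_val i) (fun i => enum_val i) (gram X) +
  diag_mx (\row_i ddrho `|b (enum_val i) 0| lam).

(* normal_prob is not the degenerate law when the standard deviation is 0. *)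
Definition centered_normal (R : realType) (sigma : R) (B : set R) : \bar R :=
  if sigma == 0 then \d_(0 : R) B else normal_prob 0 sigma B.

(* The law of the vector eps is N(0, sigma^2 I_n): its coordinates are
   independent with law N(0, sigma^2).  Taking some of the B i to be the whole
   line gives the product rule for every subfamily. *)
Definition gaussian_noise (R : realType) (d : measure_display)
    (Omega : measurableType d) (P : probability Omega R) (n : nat) (sigma : R)
    (eps : 'I_n -> {RV P >-> R}) : Prop :=
  forall B : 'I_n -> set R, (forall i, measurable (B i)) ->
    P [set w | forall i, B i (eps i w)] =
    (\prod_(i < n) centered_normal sigma (B i))%E.

Definition mx_integrable (R : realType) (d : measure_display)
    (Omega : measurableType d) (P : probability Omega R) (m k : nat)
    (M : Omega -> 'M[R]_(m, k)) : Prop :=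
  forall i j, P.-integrable setT (fun w => (M w i j)%:E).

(* Entrywise expectation, meaningful under mx_integrable. *)
Definition mx_expectation (R : realType) (d : measure_display)
    (Omega : measurableType d) (P : probability Omega R) (m k : nat)
    (M : Omega -> 'M[R]_(m, k)) : 'M[R]_(m, k) :=
  \matrix_(i, j) fine ('E_P[fun w => M w i j])%E.

Definition unbiased (R : realType) (d : measure_display)
    (Omega : measurableType d) (P : probability Omega R) (T : Omega -> R)
    (theta : \bar R) : Prop :=
  P.-integrable setT (fun w => (T w)%:E) /\ ('E_P[T])%E = theta.

(* Main.v *)
Require Import Defs.
From HB Require Import structures.
From mathcomp Require Import all_boot all_order all_algebra.
From mathcomp Require Import all_classical all_reals all_analysis.
From mathcomp Require Import measurable_realfun ring lra.

Set Implicit Arguments.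
Unset Strict Implicit.
Unset Printing Implicit Defensive.

Import Order.TTheory GRing.Theory Num.Theory.
Import numFieldNormedType.Exports.

Local Open Scope classical_set_scope.
Local Open Scope ring_scope.

(** Write the noise as eps and z = X'y/n.  Since kappa < c_min, the optimality
    condition S b + rho'(|b|) sgn b = z is strongly monotone in b, so that the
    solution b(z) is unique and Lipschitz.  At a point where no coordinate with
    b_j = 0 is on the boundary |(z - S b)_j| = lambda and where rho' is
    differentiable at |b_j| for the other coordinates, b(z) is differentiable with
    derivative P' Q^-1 P.  The exceptional points are negligible on every line along
    which z moves in one coordinate: the boundary is met at most once, and the
    inverse of the monotone function b_j is absolutely continuous because rho' is.
    By Fubini and the quasi-invariance of the Gaussian law (Cameron-Martin) they
    have probability zero.

    The Cameron-Martin formula also gives Stein's identity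
    E f(eps) <v, eps> = sigma^2 E D_v f(eps) for Lipschitz f.  With f = <a, b - beta>
    it evaluates the cross term of
      b - beta = (b - btilde) + (btilde - beta),
    which is the stated identity.  The residual directions h of the least squares fit
    satisfy X'h = 0, so b and Q are constant along them; Stein's identity along h
    then shows that the residual variance estimator is uncorrelated with
    P' Q^-1 P, and it may replace sigma^2. *)

(** * Inner products and the smallest eigenvalue *)

(** The obstacle is that [ddrho] is pinned down only almost everywhere, so Q is meaningful at b only
    if each nonzero |b_j| avoids a Lebesgue-null set. Lipschitz continuity of b_j cannot ensure
    this, since a function may be constant on an interval with its value in the null set. What is
    needed is a bound in the other direction: how far z can have moved when b_j grows by a given
    amount ([kkt_line]). Coordinates resting at 0 escape that bound, and for them the strict
    inequality at the boundary takes over.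

    Working with shifts of the noise instead of a joint density allows every direction, in
    particular the columns of [U], which X'/n maps to basis vectors. It also reduces Stein's
    identity to dominated convergence of difference quotients, and the Lipschitz bound on these
    quotients yields the integrability of P' Q^-1 P as a by-product.

    When sigma = 0 the noise is almost surely 0, a point where regularity may fail. Both sides of
    Stein's identity are then 0, so the risk identities hold whatever [invmx] returns. *)

Section inner_product.
Context {R : realType}.

Definition dot m (u v : 'cV[R]_m) : R := \sum_i u i 0 * v i 0.

Definition l1norm m (v : 'cV[R]_m) : R := \sum_i `|v i 0|.

Lemma dotC m (u v : 'cV[R]_m) : dot u v = dot v u.
Proof. by apply: eq_bigr => i _; rewrite mulrC. Qed.

Lemma dotDl m (u v w : 'cV[R]_m) : dot (u + v) w = dot u w + dot v w.
Proof. by rewrite -big_split/=; apply: eq_bigr => i _; rewrite mxE mulrDl. Qed.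

Lemma dotDr m (u v w : 'cV[R]_m) : dot u (v + w) = dot u v + dot u w.
Proof. by rewrite !(dotC u) dotDl. Qed.

Lemma dotZl m a (u v : 'cV[R]_m) : dot (a *: u) v = a * dot u v.
Proof. by rewrite mulr_sumr; apply: eq_bigr => i _; rewrite mxE mulrA. Qed.

Lemma dotZr m a (u v : 'cV[R]_m) : dot u (a *: v) = a * dot u v.
Proof. by rewrite dotC dotZl dotC. Qed.

Lemma dotNl m (u v : 'cV[R]_m) : dot (- u) v = - dot u v.
Proof. by rewrite -scaleN1r dotZl mulN1r. Qed.

Lemma dotNr m (u v : 'cV[R]_m) : dot u (- v) = - dot u v.
Proof. by rewrite dotC dotNl dotC. Qed.

Lemma dotBl m (u v w : 'cV[R]_m) : dot (u - v) w = dot u w - dot v w.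
Proof. by rewrite dotDl dotNl. Qed.

Lemma dotBr m (u v w : 'cV[R]_m) : dot u (v - w) = dot u v - dot u w.
Proof. by rewrite dotDr dotNr. Qed.

Lemma dot_mx m (u v : 'cV[R]_m) : (u^T *m v) 0 0 = dot u v.
Proof. by rewrite mxE; apply: eq_bigr => i _; rewrite mxE. Qed.

Lemma dot_mulmx m k (A : 'M[R]_(m, k)) u v : dot u (A *m v) = dot (A^T *m u) v.
Proof. by rewrite -!dot_mx trmx_mul trmxK mulmxA. Qed.

Lemma dot_sqnorm m (u : 'cV[R]_m) : dot u u = sqnorm u.
Proof. by apply: eq_bigr => i _; rewrite expr2. Qed.

Lemma dot_delta m (u : 'cV[R]_m) j : dot (delta_mx j 0) u = u j 0.
Proof.
rewrite /dot (bigD1 j)//= mxE !eqxx mul1r big1 ?addr0// => i ij.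
by rewrite mxE (negPf ij) mul0r.
Qed.

Lemma sqnorm_ge0 m (u : 'cV[R]_m) : 0 <= sqnorm u.
Proof. by apply: sumr_ge0 => i _; exact: sqr_ge0. Qed.

Lemma sqnorm_eq0 m (u : 'cV[R]_m) : sqnorm u = 0 -> u = 0.
Proof.
move/eqP; rewrite psumr_eq0 => [/allP h|i _]; last exact: sqr_ge0.
apply/matrixP => i j; rewrite ord1 mxE; apply/eqP.
by have := h i; rewrite mem_index_enum sqrf_eq0; apply.
Qed.

Lemma sqnorm0 m : sqnorm (0 : 'cV[R]_m) = 0.
Proof. by apply: big1 => i _; rewrite mxE expr0n. Qed.

Lemma coord_le_sqnorm m (u : 'cV[R]_m) j : u j 0 ^+ 2 <= sqnorm u.
Proof. by rewrite /sqnorm (bigD1 j)//= lerDl; apply: sumr_ge0 => i _; exact: sqr_ge0. Qed.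

Lemma cauchy_schwarz m (u v : 'cV[R]_m) : dot u v ^+ 2 <= sqnorm u * sqnorm v.
Proof.
have [/sqnorm_eq0 ->|v0] := eqVneq (sqnorm v) 0.
  by rewrite sqnorm0 mulr0 -(scale0r 0) dotZr mul0r expr0n.
have vp : 0 < sqnorm v by rewrite lt_neqAle eq_sym v0 sqnorm_ge0.
have := sqnorm_ge0 (sqnorm v *: u - dot u v *: v).
rewrite -dot_sqnorm !(dotBl, dotBr, dotZl, dotZr) !dot_sqnorm (dotC v u).
rewrite [X in 0 <= X](_ : _ = sqnorm v * (sqnorm u * sqnorm v - dot u v ^+ 2)).
  by rewrite pmulr_rge0// subr_ge0.
by ring.
Qed.

Lemma sqnormBZ m t (u v : 'cV[R]_m) :
  sqnorm (u - t *: v) = sqnorm u - 2 * t * dot u v + t ^+ 2 * sqnorm v.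
Proof.
by rewrite -dot_sqnorm !(dotBl, dotBr, dotZl, dotZr) !dot_sqnorm (dotC v u); ring.
Qed.

Lemma sqnorm_mulmx m k (A : 'M[R]_(m, k)) (v : 'cV[R]_k) :
  sqnorm (A *m v) <= (\sum_i sqnorm (row i A)^T) * sqnorm v.
Proof.
rewrite mulr_suml; apply: ler_sum => i _.
suff -> : (A *m v) i 0 = dot (row i A)^T v by exact: cauchy_schwarz.
by rewrite mxE; apply: eq_bigr => j _; rewrite !mxE.
Qed.

Lemma sqnorm_le_l1norm m (v : 'cV[R]_m) : sqnorm v <= l1norm v ^+ 2.
Proof.
rewrite /l1norm expr2 mulr_sumr; apply: ler_sum => i _.
rewrite -real_normK ?num_real// expr2 ler_wpM2r//.
by rewrite (bigD1 i)//= lerDl; apply: sumr_ge0.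
Qed.

Lemma l1norm_ge0 m (v : 'cV[R]_m) : 0 <= l1norm v.
Proof. exact: sumr_ge0. Qed.

Lemma l1normZ m a (v : 'cV[R]_m) : l1norm (a *: v) = `|a| * l1norm v.
Proof. by rewrite mulr_sumr; apply: eq_bigr => i _; rewrite mxE normrM. Qed.

Lemma coord_le_l1norm m (u : 'cV[R]_m) j : `|u j 0| <= l1norm u.
Proof. by rewrite /l1norm (bigD1 j)//= lerDl; apply: sumr_ge0. Qed.

Lemma l1norm_mulmx m k (A : 'M[R]_(m, k)) :
  exists2 L, 0 <= L & forall v, l1norm (A *m v) <= L * l1norm v.
Proof.
exists (\sum_i \sum_j `|A i j|).
  by apply: sumr_ge0 => i _; exact: sumr_ge0.
move=> v; rewrite mulr_suml; apply: ler_sum => i _.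
rewrite mxE (le_trans (ler_norm_sum _ _ _))// mulr_suml ler_sum// => j _.
by rewrite normrM ler_wpM2l// coord_le_l1norm.
Qed.

End inner_product.

Section smallest_eigenvalue.
Context {R : realType}.

(** With [w = B v], positivity of the form at [K v - w] gives [|B v|^2 <= K <v, B v>], and
    invertibility gives [|v|^2 <= F |B v|^2]. This replaces diagonalization and compactness of the
    sphere. *)
Lemma sym_psd_coercive p (B : 'M[R]_p) : B^T = B ->
  (forall v, 0 <= dot v (B *m v)) -> B \in unitmx ->
  exists2 d, 0 < d & forall v, d * sqnorm v <= dot v (B *m v).
Proof.
move=> Bsym Bpsd Bu.
pose K := 1 + \sum_i sqnorm (row i B)^T.
pose F := 1 + \sum_i sqnorm (row i (invmx B))^T.
have S0 (C : 'M[R]_p) : 0 <= \sum_i sqnorm (row i C)^T.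
  by apply: sumr_ge0 => i _; exact: sqnorm_ge0.
have K0 : 0 < K by rewrite ltr_pwDl.
have F0 : 0 < F by rewrite ltr_pwDl.
have qK w : dot w (B *m w) <= K * sqnorm w.
  have h : 0 <= sqnorm w + sqnorm (B *m w) - 2 * dot w (B *m w).
    by have := sqnorm_ge0 (w - 1 *: (B *m w)); rewrite sqnormBZ; lra.
  have := sqnorm_mulmx B w; have := sqnorm_ge0 w.
  by have := Bpsd w; rewrite /K mulrDl mul1r; lra.
exists (K * F)^-1 => [|v]; first by rewrite invr_gt0 mulr_gt0.
rewrite mulrC ler_pdivrMr ?mulr_gt0//.
have wv : sqnorm v <= F * sqnorm (B *m v).
  have := sqnorm_mulmx (invmx B) (B *m v); rewrite mulKmx//.
  by have := sqnorm_ge0 (B *m v); rewrite /F mulrDl mul1r; lra.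
apply: (le_trans wv); rewrite mulrA [leRHS]mulrC ler_pM2l// (mulrC _ K).
set w := B *m v.
have := Bpsd (K *: v - w).
rewrite mulmxBr -scalemxAr -/w !(dotBl, dotBr, dotZl, dotZr).
rewrite [dot v (B *m w)]dot_mulmx Bsym -/w !dot_sqnorm => h.
rewrite -subr_ge0 -(pmulr_rge0 _ K0).
by have := qK w; lra.
Qed.

(* If the infimum r of the Rayleigh quotient were not an eigenvalue, A - r would
   be invertible, hence coercive, and r + d would still be a lower bound. *)
Lemma quad_ge_cmin p (A : 'M[R]_p) : A^T = A ->
  (forall v, 0 <= dot v (A *m v)) ->
  forall v, cmin A * sqnorm v <= dot v (A *m v).
Proof.
move=> Asym Apsd v.
have [/sqnorm_eq0 ->|v0] := eqVneq (sqnorm v) 0.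
  by rewrite sqnorm0 mulr0.
have sqp (w : 'cV[R]_p) : sqnorm w != 0 -> 0 < sqnorm w.
  by rewrite lt_neqAle sqnorm_ge0 eq_sym andbT.
pose Ray := [set dot w (A *m w) / sqnorm w | w in [set w | sqnorm w != 0]].
have lbR : lbound Ray 0.
  by move=> _ [w w0 <-]; rewrite divr_ge0// sqnorm_ge0.
have infR w : inf Ray * sqnorm w <= dot w (A *m w).
  have [/sqnorm_eq0 ->|w0] := eqVneq (sqnorm w) 0.
    by rewrite sqnorm0 mulr0.
  by rewrite -ler_pdivlMr ?sqp//; apply: ge_inf; [exists 0|exists w].
apply: le_trans (infR v); rewrite ler_wpM2r ?sqnorm_ge0//.
(* This bounds the set of eigenvalues from below, as [ge_inf] requires. Eigenvectors are rows in the
   library; symmetry of [A] turns them into columns. *)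
have eig0 a : eigenvalue A a -> 0 <= a.
  move=> /eigenvalueP[w wA w0].
  have wT : A *m w^T = a *: w^T by rewrite -{1}Asym -trmx_mul wA linearZ.
  have w1 : 0 < sqnorm w^T.
    rewrite sqp//; apply: contra w0 => /eqP/sqnorm_eq0 h.
    by rewrite -(trmxK w) h trmx0.
  by have := Apsd w^T; rewrite wT dotZr dot_sqnorm pmulr_lge0.
apply: ge_inf; first by exists 0 => a; exact: eig0.
rewrite /= /eigenvalue /eigenspace kermx_eq0 row_free_unit.
apply/negP => Bu; set B := A - _ in Bu.
have Bq w : dot w (B *m w) = dot w (A *m w) - inf Ray * sqnorm w.
  by rewrite mulmxBl mul_scalar_mx dotBr dotZr dot_sqnorm.
have [| |d d0 dB] := @sym_psd_coercive p B _ _ Bu.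
- by rewrite linearB/= Asym tr_scalar_mx.
- by move=> w; rewrite Bq subr_ge0.
suff : inf Ray + d <= inf Ray by rewrite gerDl leNgt d0.
apply: lb_le_inf; first by exists (dot v (A *m v) / sqnorm v), v.
move=> _ [w /= w0 <-]; rewrite ler_pdivlMr ?sqp//.
by have := dB w; rewrite Bq mulrDl lerBrDl addrC [leLHS]addrC.
Qed.

End smallest_eigenvalue.

(** * Penalty slopes and stationarity *)

Section penalty_slope.
Context {R : realType}.
Variables (rho ddrho : R -> R -> R) (lam : R).
Hypothesis pen : penalty rho ddrho lam.
Let phi := drho rho lam.

(** The supremum is finite: [c] bounds it from above and the quotient at 1 and 2 from below. It is
    negative when the slope increases at a uniform rate, so later constants involve [|k|]. *)
Lemma max_concavity_bound (c : R) : (max_concavity rho lam < c%:E)%E ->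
  exists2 k, k < c & forall s t, 0 < s -> s <= t -> phi s - phi t <= k * (t - s).
Proof.
move=> kc; set K := max_concavity rho lam in kc.
have lbK s t : 0 < s -> s < t -> (((phi s - phi t) / (t - s))%:E <= K)%E.
  by move=> s0 st; apply: ereal_sup_ubound; exists s, t.
have Kfin : K \is a fin_num.
  have h := lbK 1 2 ltr01 ltac:(lra).
  by rewrite fin_numE -ltey -ltNye (lt_trans kc (ltry _)) (lt_le_trans (ltNyr _) h).
exists (fine K) => [|s t s0]; first by rewrite -lte_fin fineK.
rewrite le_eqVlt => /predU1P[->|st]; first by rewrite !subrr mulr0.
by rewrite -ler_pdivrMr ?subr_gt0// -lee_fin fineK// lbK.
Qed.

(** An infinite slope at 0 is impossible, because comparison with the point 1 keeps [phi] below
    [phi 1 + |k|] near 0; the limit being finite, the normalization makes it [lam]. *)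
Lemma slope0_cvg (k : R) :
  (forall s t, 0 < s -> s <= t -> phi s - phi t <= k * (t - s)) ->
  phi t @[t --> 0^'+] --> lam.
Proof.
move=> hk; have [l [phil l0 lE]] := penalty_slope0 pen.
have lub : (l <= (phi 1 + `|k|)%:E)%E.
  apply: (cvge_to_le phil); near=> t.
  have t0 : 0 < t by near: t; exact: nbhs_right_gt.
  have t1 : t <= 1 by near: t; exact: nbhs_right_le.
  rewrite lee_fin -lerBlDl; apply: le_trans (hk _ _ t0 t1) _.
  have : k * (1 - t) <= `|k|.
    rewrite (le_trans (ler_norm _))// normrM ler_piMr// ger0_norm; lra.
  by [].
have lfin : l \is a fin_num.
  by rewrite fin_numE -ltey -ltNye (le_lt_trans lub (ltry _)) (lt_trans (ltNyr 0) l0).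
move: phil; rewrite -(fineK lfin) (lE (fine l)) ?fineK// => phil.
exact: (fine_cvg phil).
Unshelve. all: by end_near. Qed.

Lemma penalty_is_derive (t : R) : 0 < t -> is_derive t (1 : R) (fun s => rho s lam) (phi t).
Proof.
by move=> t0; apply: DeriveDef; [exact: (penalty_derivable pen)|rewrite /phi /drho derive1E].
Qed.

(** Fermat's rule at an interior minimum. The quadratic is the exact change of the least squares
    term along one coordinate, with slope [- g] at [c]. *)
Lemma stationary_pos (a g c : R) : 0 < c ->
  (forall s, 0 < s -> 0 <= - (s - c) * g + a * (s - c) ^+ 2 + (rho s lam - rho c lam)) ->
  g = phi c.
Proof.
move=> c0 cmin.
pose F := fun s => - (s - c) * g + a * (s - c) ^+ 2 + (rho s lam - rho c lam).
have dF (s : R) : 0 < s -> is_derive s (1 : R) F (- g + 2 * a * (s - c) + phi s).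
  move=> s0; have H := penalty_is_derive s0.
  rewrite /F; apply: is_derive_eq.
  by rewrite /GRing.scale/=; ring.
have : is_derive c (1 : R) F 0.
  apply: (@derive1_at_min _ _ 0 (c + 1)).
  - by lra.
  - by move=> s; rewrite in_itv/= => /andP[s0 _]; have [] := dF _ s0.
  - by rewrite in_itv/= c0; lra.
  - move=> s; rewrite in_itv/= => /andP[s0 _].
    by rewrite /F !subrr oppr0 mul0r expr0n mulr0 !addr0 cmin.
move=> [_ F0]; have [_] := dF _ c0; rewrite F0 subrr mulr0 addr0; lra.
Qed.

(** Only a one-sided argument is available at 0: the mean value theorem turns [rho s - rho 0] into
    [s phi x] with [0 < x < s], and [phi x] is close to [lam]. *)
Lemma stationary_zero (k a g : R) :
  (forall s t, 0 < s -> s <= t -> phi s - phi t <= k * (t - s)) ->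
  (forall s, 0 < s -> 0 <= - s * g + a * s ^+ 2 + (rho s lam - rho 0 lam)) ->
  g <= lam.
Proof.
move=> hk cmin; apply/ler_addgt0Pr => e e0.
have /cvgrPdist_lt/(_ (e / 2) ltac:(lra)) := slope0_cvg hk.
move=> [d /= d0 hd].
(* The first bound puts [x] where [phi] is within [e / 2] of [lam]; the second makes the quadratic
   term, once divided by [s], cost at most [e / 2]. *)
pose s := Num.min (d / 2) (e / (2 * (1 + `|a|))).
have a1 : 0 < 1 + `|a| by rewrite ltr_pwDl.
have s0 : 0 < s by rewrite lt_min divr_gt0//= divr_gt0// mulr_gt0.
have sd : s < d by rewrite /s gt_min; apply/orP; left; lra.
have sa : a * s <= e / 2.
  rewrite (le_trans (ler_norm _))// normrM (gtr0_norm s0).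
  apply: (@le_trans _ _ ((1 + `|a|) * s)); first by apply: ler_wpM2r; [exact: ltW|rewrite lerDr].
  rewrite (@le_trans _ _ ((1 + `|a|) * (e / (2 * (1 + `|a|)))))//.
    by rewrite ler_wpM2l ?(ltW a1)// /s ge_min lexx orbT.
  by rewrite le_eqVlt; apply/orP; left; apply/eqP; field; apply: lt0r_neq0.
have [x||x xs xE] := @MVT _ (fun s => rho s lam) phi 0 s s0.
- by rewrite in_itv/= => /andP[x0 _]; exact: penalty_is_derive.
- apply/continuous_within_itvP => //; split.
  + move=> x; rewrite in_itv/= => /andP[x0 _].
    apply: differentiable_continuous; apply/derivable1_diffP.
    exact: (penalty_derivable pen).
  + exact: (penalty_continuous0 pen).
  + apply: cvg_at_left_filter; apply: differentiable_continuous.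
    by apply/derivable1_diffP; exact: (penalty_derivable pen).
- have := cmin _ s0; rewrite xE subr0.
  rewrite [X in 0 <= X](_ : _ = s * (- g + a * s + phi x)); last by ring.
  rewrite pmulr_rge0// => h.
  move: xs; rewrite in_itv/= => /andP[x0 xs].
  have := hd x; rewrite /= sub0r normrN gtr0_norm// (lt_trans xs sd) => /(_ erefl x0).
  by rewrite ltr_distlC => /andP[_]; lra.
Qed.

End penalty_slope.

Section stationarity.
Context {R : realType}.

(** The generalized subdifferential of the penalty as a function on the line; at 0 it fills the jump
    of sgn(x) phi(|x|) from [- lam] to [lam]. *)
Definition subgrad (phi : R -> R) (lam x g : R) : Prop :=
  if x == 0 then is_true (`|g| <= lam) else g = Num.sg x * phi `|x|.

Definition kkt p (S : 'M[R]_p) (phi : R -> R) (lam : R) (z b : 'cV[R]_p) : Prop :=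
  forall j, subgrad phi lam (b j 0) ((z - S *m b) j 0).

(** Along a coordinate the loss is a quadratic plus one penalty term, so minimality gives the
    inequality that [stationary_pos] and [stationary_zero] take as hypothesis. The latter is used
    twice at 0, once for each sign. *)
Lemma argmin_kkt n p (X : 'M[R]_(n, p)) (y : 'cV[R]_n) (b : 'cV[R]_p)
    (rho ddrho : R -> R -> R) (lam k : R) :
  penalty rho ddrho lam ->
  (forall s t, 0 < s -> s <= t -> drho rho lam s - drho rho lam t <= k * (t - s)) ->
  is_argmin (ploss X y rho lam) b ->
  kkt (gram X) (drho rho lam) lam (n%:R^-1 *: (X^T *m y)) b.
Proof.
move=> pen hk bmin j.
set g := (_ - gram X *m b) j 0.
pose r := y - X *m b; pose c := X *m delta_mx j (0 : 'I_1).
pose a := (2 * n%:R)^-1 * sqnorm c.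
have gE : g = n%:R^-1 * dot r c.
  rewrite /g /gram -scalemxAl -scalerBr mxE; congr (_ * _).
  by rewrite -mulmxA -mulmxBr -/r /c dot_mulmx dotC dot_delta.
have coord t : 0 <= - t * g + a * t ^+ 2 + (rho `|b j 0 + t| lam - rho `|b j 0| lam).
  have := bmin (b + t *: delta_mx j 0).
  rewrite /ploss mulmxDr opprD addrA -/r -scalemxAr -/c.
  rewrite (bigD1 j)//= [in X in _ <= X](bigD1 j)//= !mxE !eqxx mulr1.
  rewrite [in X in _ <= X](eq_bigr (fun i => rho `|b i 0| lam)); last first.
    by move=> i ij; rewrite !mxE (negPf ij) mulr0 addr0.
  rewrite sqnormBZ.
  rewrite gE /a invfM; set N := n%:R^-1; set q := \sum_(_ | _) _.
  set s := sqnorm r; set u := dot r c; set v := sqnorm c.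
  have h2 : 2 * 2^-1 = 1 :> R by rewrite divff.
  set i2 := 2^-1 in h2 *; nra.
rewrite /subgrad; case: ifPn => [/eqP b0|b0].
  rewrite ler_norml; apply/andP; split; last first.
    apply: (stationary_zero pen hk (a := a)) => s s0.
    by have := coord s; rewrite b0 normr0 add0r gtr0_norm.
  rewrite lerNl; apply: (stationary_zero pen hk (a := a)) => s s0.
  by have := coord (- s); rewrite b0 normr0 add0r normrN gtr0_norm// sqrrN opprK mulrNN.
suff <- : Num.sg (b j 0) * g = drho rho lam `|b j 0|.
  by rewrite mulrA -expr2 sqr_sg b0 mul1r.
apply: (stationary_pos pen (a := a)); first by rewrite normr_gt0.
move=> s s0; have := coord (Num.sg (b j 0) * (s - `|b j 0|)).
rewrite [b j 0 + _](_ : _ = Num.sg (b j 0) * s); last first.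
  by rewrite {1}(numEsg (b j 0)) -mulrDr addrC subrK.
rewrite normrM normr_sg b0 mul1r (gtr0_norm s0).
rewrite exprMn sqr_sg b0 mul1r.
by rewrite [- (Num.sg _ * _) * g](_ : _ = - (s - `|b j 0|) * (Num.sg (b j 0) * g)); last by ring.
Qed.

Variables (phi : R -> R) (lam k : R).
Hypothesis lam_gt0 : 0 < lam.
Hypothesis hk : forall s t, 0 < s -> s <= t -> phi s - phi t <= k * (t - s).
Hypothesis phi0 : phi t @[t --> 0^'+] --> lam.

Lemma slope_lower_bound t : 0 < t -> lam - k * t <= phi t.
Proof.
move=> t0; apply/ler_addgt0Pr => e e0; pose d := e / (2 * (1 + `|k|)).
have k1 : 0 < 1 + `|k| by rewrite ltr_pwDl.
near (0 : R)^'+ => s.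
have s0 : 0 < s by near: s; exact: nbhs_right_gt.
have st : s <= t by near: s; exact: nbhs_right_le.
have se : `|k| * s <= e / 2.
  have : s <= d by near: s; apply: nbhs_right_le; rewrite divr_gt0// mulr_gt0.
  by rewrite /d ler_pdivlMr ?mulr_gt0//; lra.
have : `|lam - phi s| < e / 2.
  near: s; move/cvgrPdist_lt: phi0; apply; lra.
rewrite ltr_distlC => /andP[h _]; have := hk s0 st.
have : - k * s <= `|k| * s by rewrite -(normrN k) ler_wpM2r ?ler_norm// ltW.
by rewrite mulrBr; lra.
Unshelve. all: by end_near. Qed.

(** Adding [k x] makes the subdifferential nondecreasing. For equal signs this is the concavity
    bound; for opposite signs two slope bounds add up with a surplus [2 lam]; at 0 one slope bound
    meets the end of the interval. *)
Lemma subgrad_mono x x' g g' : subgrad phi lam x g -> subgrad phi lam x' g' ->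
  - k * (x - x') ^+ 2 <= (g - g') * (x - x').
Proof.
have strict u u' h h' : subgrad phi lam u h -> subgrad phi lam u' h' -> u' < u ->
    - k * (u - u') <= h - h'.
  rewrite /subgrad; have [u0|u0|->] := ltrgt0P u; have [v0|v0|->] := ltrgt0P u'.
  - rewrite (gtr0_sg u0) (gtr0_sg v0) !mul1r => -> -> lt_uv.
    by have := hk v0 (ltW lt_uv); lra.
  - rewrite (gtr0_sg u0) (ltr0_sg v0) => -> -> _.
    have := slope_lower_bound u0; have := @slope_lower_bound (- u').
    by rewrite oppr_gt0 => /(_ v0); have := lam_gt0; lra.
  - rewrite (gtr0_sg u0) ler_norml => -> hE' _.
    by have := slope_lower_bound u0; lra.
  - by lra.
  - rewrite (ltr0_sg u0) (ltr0_sg v0) => -> -> lt_uv.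
    have := @hk (- u) (- u'); rewrite oppr_gt0 => /(_ u0); rewrite lerN2.
    by move=> /(_ (ltW lt_uv)); lra.
  - by lra.
  - by lra.
  - rewrite (ltr0_sg v0) ler_norml => hE -> _; have := @slope_lower_bound (- u').
    by rewrite oppr_gt0 => /(_ v0); lra.
  - by lra.
move=> sx sx'; have [lt_xx|lt_xx|->] := ltrgtP x' x; last by rewrite !subrr expr0n !mulr0.
- have := strict _ _ _ _ sx sx' lt_xx; nra.
- have := strict _ _ _ _ sx' sx lt_xx; nra.
Qed.

End stationarity.

(** * Stability and differentiability of the solution *)

Section kkt_stability.
Context {R : realType}.
Variables (p : nat) (S : 'M[R]_p) (phi : R -> R) (lam k mu : R).
Hypothesis lam_gt0 : 0 < lam.
Hypothesis hk : forall s t, 0 < s -> s <= t -> phi s - phi t <= k * (t - s).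
Hypothesis phi0 : phi t @[t --> 0^'+] --> lam.
Hypothesis k_lt_mu : k < mu.
Hypothesis S_coercive : forall v, mu * sqnorm v <= dot v (S *m v).

Let KKT := kkt S phi lam.
Let c := mu - k.

Let c_gt0 : 0 < c. Proof. by rewrite subr_gt0. Qed.

Lemma kktN z b : KKT z b -> KKT (- z) (- b).
Proof.
move=> h j; have oppE (v : 'cV[R]_p) : (- v) j 0 = - v j 0 by rewrite mxE.
have := h j; rewrite mulmxN -opprD !oppE /subgrad oppr_eq0.
case: ifPn => _; first by rewrite normrN.
by rewrite sgrN normrN mulNr => ->.
Qed.

(** [S] contributes at least [mu |b - b'|^2], and the subdifferential takes back at most
    [k |b - b'|^2]. *)
Lemma kkt_coercive z b z' b' : KKT z b -> KKT z' b' ->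
  c * sqnorm (b - b') <= dot (z - z') (b - b').
Proof.
move=> h h'; set w := b - b'.
have -> : z - z' = S *m w + ((z - S *m b) - (z' - S *m b')).
  rewrite /w mulmxBr; move: (S *m b) (S *m b') => u u'.
  by apply/matrixP => i l; rewrite !mxE; ring.
rewrite dotDl mulrBl dotC lerD// /sqnorm mulr_sumr -sumrN; apply: ler_sum => i _.
have := subgrad_mono lam_gt0 hk phi0 (h i) (h' i).
by rewrite !mxE -mulNr.
Qed.

Lemma kkt_lipschitz z b z' b' : KKT z b -> KKT z' b' ->
  c ^+ 2 * sqnorm (b - b') <= sqnorm (z - z').
Proof.
move=> h h'; have hc := kkt_coercive h h'.
have cs := cauchy_schwarz (z - z') (b - b').
have [n0|n0] := eqVneq (sqnorm (b - b')) 0; first by rewrite n0 mulr0 sqnorm_ge0.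
have n_gt0 : 0 < sqnorm (b - b') by rewrite lt_neqAle eq_sym n0 sqnorm_ge0.
rewrite -(ler_pM2r n_gt0); apply: le_trans cs.
rewrite -mulrA -expr2 -exprMn ler_sqr ?nnegrE//; first by rewrite mulr_ge0// ltW.
by apply: le_trans hc; rewrite mulr_ge0// ltW.
Qed.

Lemma kkt_unique z b b' : KKT z b -> KKT z b' -> b = b'.
Proof.
move=> h h'; have := kkt_lipschitz h h'; rewrite subrr sqnorm0 => hle.
apply/eqP; rewrite -subr_eq0; apply/eqP/sqnorm_eq0/eqP; rewrite eq_le sqnorm_ge0 andbT.
by rewrite -(pmulr_rle0 _ (exprn_gt0 2 c_gt0)).
Qed.

Lemma kkt_coord_lipschitz z b z' b' j : KKT z b -> KKT z' b' ->
  `|b j 0 - b' j 0| <= c^-1 * l1norm (z - z').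
Proof.
move=> h h'; rewrite ler_pdivlMl// -(gtr0_norm c_gt0) -normrM.
rewrite -[leRHS]ger0_norm ?l1norm_ge0// -ler_sqr ?nnegrE// !real_normK ?num_real//.
apply: le_trans (sqnorm_le_l1norm _); apply: le_trans (kkt_lipschitz h h').
rewrite exprMn ler_pM2l ?exprn_gt0//.
by have := coord_le_sqnorm (b - b') j; rewrite !mxE.
Qed.

(* Moving z only in its j-th coordinate, the other coordinates of the solution
   solve a problem parametrized by the j-th one. *)
Lemma kkt_line j : exists2 K, 0 <= K & forall z b b' s,
  KKT z b -> KKT (z + s *: delta_mx j 0) b' ->
  0 < b j 0 -> b j 0 <= b' j 0 ->
  s <= K * (b' j 0 - b j 0) + (phi (b' j 0) - phi (b j 0)).
Proof.
pose F := 1 + \sum_i sqnorm (row i S)^T.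
have F0 : 0 < F.
  by rewrite ltr_pwDl//; apply: sumr_ge0 => i _; exact: sqnorm_ge0.
(* The constant comes from the estimate [c^2 |w|^2 <= (F + 2 c |k|) a^2] established in [nK]. *)
pose K := (F + 2 * c * `|k|) / c ^+ 2.
have K0 : 0 <= K.
  by rewrite divr_ge0 ?sqr_ge0// addr_ge0 ?(ltW F0)// !mulr_ge0// ltW.
have FK0 : 0 <= F * K by rewrite mulr_ge0// ltW.
exists (1 + F * K) => [|z b b' s h h' bj bb']; first by rewrite addr_ge0.
set w := b' - b; set X := (S *m w) j 0; pose a := b' j 0 - b j 0.
have wj : w j 0 = a by rewrite !mxE.
have XF : X ^+ 2 <= F * sqnorm w.
  apply: le_trans (coord_le_sqnorm _ _) _; apply: le_trans (sqnorm_mulmx _ _) _.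
  by rewrite ler_wpM2r ?sqnorm_ge0// lerDr.
pose dg i := (z + s *: delta_mx j 0 - S *m b') i 0 - (z - S *m b) i 0.
have dgE i : dg i = s * (i == j)%:R - (S *m w) i 0.
  rewrite /dg /w mulmxBr !mxE eqxx andbT; ring.
have mono i : - k * w i 0 ^+ 2 <= dg i * w i 0.
  by have := subgrad_mono lam_gt0 hk phi0 (h' i) (h i); rewrite /w [(b' - b) i 0]mxE [(- b) i 0]mxE.
(* Off [j] the vector z does not move, so there monotonicity of the subdifferential bounds
   [- (S w)_i w_i] from below; removing these coordinates from [<w, S w>] leaves [X a] at [j]. *)
have main : c * sqnorm w <= X * a - k * a ^+ 2.
  have := S_coercive w.
  have -> : dot w (S *m w) = X * a - \sum_(i | i != j) dg i * w i 0.
    rewrite /dot (bigD1 j)//= wj mulrC -/X; congr (_ + _); rewrite -sumrN.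
    by apply: eq_bigr => i ij; rewrite dgE (negPf ij) mulr0 sub0r mulNr opprK mulrC.
  have : - k * (sqnorm w - a ^+ 2) <= \sum_(i | i != j) dg i * w i 0.
    rewrite /sqnorm (bigD1 j)//= wj [X in _ * X]addrAC subrr add0r mulr_sumr.
    exact: ler_sum.
  by rewrite /c; lra.
have nK : sqnorm w <= K * a ^+ 2.
  rewrite /K mulrAC ler_pdivlMr ?exprn_gt0//.
  (* Young's inequality for [X a], weighted so that it uses up half of the left-hand side of
     [main]. *)
  have h1 : 2 * c * (X * a) <= c ^+ 2 * sqnorm w + F * a ^+ 2.
    rewrite -(ler_pM2l F0).
    have := sqr_ge0 (c * X - F * a).
    have : c ^+ 2 * X ^+ 2 <= c ^+ 2 * (F * sqnorm w) by rewrite ler_wpM2l ?sqr_ge0.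
    by lra.
  have h2 : 2 * c * (c * sqnorm w) <= 2 * c * (X * a - k * a ^+ 2).
    by rewrite ler_wpM2l// mulr_ge0// ltW.
  have h3 : c * (- k * a ^+ 2) <= c * (`|k| * a ^+ 2).
    by rewrite ler_wpM2l ?(ltW c_gt0)// ler_wpM2r ?sqr_ge0// -normrN ler_norm.
  lra.
have Xa : X <= (1 + F * K) * a.
  have a0 : 0 <= a by rewrite subr_ge0.
  rewrite (le_trans (ler_norm _))// -[leRHS]ger0_norm; last by rewrite mulr_ge0// addr_ge0.
  rewrite -ler_sqr ?nnegrE// !real_normK ?num_real//.
  apply: le_trans XF _; apply: (@le_trans _ _ (F * (K * a ^+ 2))).
    by rewrite ler_wpM2l// ltW.
  by rewrite exprMn mulrA ler_wpM2r ?sqr_ge0//; nra.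
(* The shift is the change of [(S b)_j] plus that of the subgradient, which for positive coordinates
   is the increment of [phi]. *)
have sE : s = X + dg j by rewrite dgE eqxx mulr1 addrC subrK.
rewrite [leLHS]sE.
rewrite lerD// /dg.
have := h j; have := h' j; rewrite /subgrad.
have b'j : 0 < b' j 0 by exact: lt_le_trans bb'.
by rewrite !gt_eqF// !gtr0_norm// !gtr0_sg// !mul1r => -> ->.
Qed.

(** A nonzero [b'_j] would need a residual with value phi(|b'_j|) up to sign, which is near [lam]
    for small [b'_j], whereas the residual stays close to one strictly below [lam] in absolute
    value. *)
Lemma kkt_zero_open z b j : KKT z b -> b j 0 = 0 -> `|(z - S *m b) j 0| < lam ->
  exists2 d, 0 < d & forall z' b', KKT z' b' -> l1norm (z' - z) < d -> b' j 0 = 0.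
Proof.
move=> h bj gj; pose e := lam - `|(z - S *m b) j 0|.
have e0 : 0 < e by rewrite subr_gt0.
move/cvgrPdist_lt : phi0 => /(_ (e / 2) ltac:(lra))[r /= r0 hr].
have [LS LS0 hLS] := l1norm_mulmx S.
(* [A] controls the variation of the residual [z - S b]: 1 accounts for z, the rest for [S b], each
   of the p coordinates of b having Lipschitz constant [c^-1]. *)
pose A := 1 + LS * (p%:R * c^-1).
have A0 : 0 < A by rewrite ltr_pwDl// !mulr_ge0// invr_ge0 ltW.
exists (Num.min (r * c) (e / (2 * A))) => [|z' b' h'].
  by rewrite lt_min mulr_gt0//= divr_gt0// mulr_gt0.
rewrite lt_min => /andP[dr de]; apply: contrapT => /eqP b'0.
have b'r : `|b' j 0| < r.
  have := kkt_coord_lipschitz j h' h; rewrite bj subr0 => /le_lt_trans; apply.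
  by rewrite ltr_pdivrMl// mulrC.
have := hr `|b' j 0|; rewrite /= sub0r normrN normr_id => /(_ b'r).
rewrite normr_gt0 => /(_ b'0); rewrite ltr_distlC => /andP[hphi _].
have := h' j; rewrite /subgrad (negPf b'0) => gE.
have : `|(z' - S *m b') j 0| < lam - e / 2.
  have -> : (z' - S *m b') j 0 = (z - S *m b) j 0 + ((z' - z) j 0 - (S *m (b' - b)) j 0).
    rewrite mulmxBr; move: (S *m b) (S *m b') => u u'; rewrite !mxE; ring.
  apply: le_lt_trans (ler_normD _ _) _.
  rewrite [ltRHS](_ : _ = `|(z - S *m b) j 0| + e / 2); last by rewrite /e; lra.
  rewrite ltrD2l; apply: le_lt_trans (ler_normB _ _) _.
  apply: (@le_lt_trans _ _ (A * l1norm (z' - z))); last first.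
    move: de; rewrite !ltr_pdivlMr ?mulr_gt0//; lra.
  rewrite mulrDl mul1r lerD ?coord_le_l1norm//.
  apply: le_trans (coord_le_l1norm _ _) _; apply: le_trans (hLS _) _.
  rewrite -mulrA ler_wpM2l// -mulrA /l1norm.
  apply: (@le_trans _ _ (\sum_(i < p) c^-1 * l1norm (z' - z))).
    by apply: ler_sum => i _; have := kkt_coord_lipschitz i h' h; rewrite !mxE.
  by rewrite sumr_const card_ord -[leLHS]mulr_natl /l1norm lexx.
rewrite gE normrM normr_sg b'0 mul1r; have := ler_norm (phi `|b' j 0|); lra.
Qed.

End kkt_stability.

Section kkt_derivative.
Context {R : realType}.

Lemma is_derive_eps (f : R -> R) (t d : R) : is_derive t (1 : R) f d ->
  forall e, 0 < e -> exists2 r, 0 < r &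
    forall s, `|s - t| < r -> `|f s - f t - d * (s - t)| <= e * `|s - t|.
Proof.
move=> [df fE] e e0; move: df; rewrite /derivable => /cvg_ex[l hl].
have lE : l = d.
  by rewrite -fE; apply/esym/cvg_lim => //; exact: Rhausdorff.
move: hl; rewrite lE => /cvgrPdist_le/(_ e e0)[r /= r0 hr].
exists r => // s str; have [->|st] := eqVneq s t.
  by rewrite !subrr mulr0 subr0 normr0 mulr0.
have st0 : s - t != 0 by rewrite subr_eq0.
have := hr (s - t); rewrite /= sub0r normrN => /(_ str st0).
rewrite /GRing.scale/= mulr1 subrK => h.
rewrite -ler_pdivrMr ?normr_gt0// -normf_div; apply: le_trans h.
rewrite -normrN opprB le_eqVlt; apply/orP; left; apply/eqP; congr (`| _ |).
by field.
Qed.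

Lemma finite_delta (I : finType) (Q : I -> R -> Prop) :
  (forall i, exists2 d, 0 < d & forall h, `|h| < d -> Q i h) ->
  exists2 d, 0 < d & forall h, `|h| < d -> forall i, Q i h.
Proof.
move=> hQ; have [d hd] := choice (fun i => (exists2P _ _).1 (hQ i)).
exists (\big[Num.min/1]_i d i) => [|h].
  by apply/bigmin_gtP; split => // i _; have [] := hd i.
by move=> /bigmin_gtP[_ hb] i; have [_] := hd i; apply; exact: hb.
Qed.

Variables (p : nat) (S : 'M[R]_p) (phi dphi : R -> R) (lam k mu : R).
Hypothesis lam_gt0 : 0 < lam.
Hypothesis hk : forall s t, 0 < s -> s <= t -> phi s - phi t <= k * (t - s).
Hypothesis phi0 : phi t @[t --> 0^'+] --> lam.
Hypothesis k_lt_mu : k < mu.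
Hypothesis S_coercive : forall v, mu * sqnorm v <= dot v (S *m v).

Let KKT := kkt S phi lam.
Let c := mu - k.
Let c_gt0 : 0 < c. Proof. by rewrite subr_gt0. Qed.

(** The concavity bound passes to the derivative. With the coercivity of [S], this is what makes Q
    coercive with constant [mu - k]. *)
Lemma slope_derive_ge (t d : R) : 0 < t -> is_derive t (1 : R) phi d -> - k <= d.
Proof.
move=> t0 dphit; rewrite leNgt; apply/negP => dk.
have e0 : 0 < (- k - d) / 2 by lra.
have [r r0 /(_ (t + r / 2))] := is_derive_eps dphit e0.
have r2 : 0 < r / 2 by rewrite divr_gt0.
rewrite addrAC subrr add0r gtr0_norm// => /(_ ltac:(lra)).
rewrite ler_norml => /andP[_]; have := hk t0 (t := t + r / 2) ltac:(lra).
by rewrite addrAC subrr add0r; nra.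
Qed.

(** Strictness keeps a zero coordinate at 0 in a neighbourhood. For the others the derivative must
    equal the chosen version [dphi], because it is this version's value that enters Q. *)
Definition regular_pt (z b : 'cV[R]_p) : Prop := forall j,
  if b j 0 == 0 then is_true (`|(z - S *m b) j 0| < lam)
  else is_derive `|b j 0| (1 : R) phi (dphi `|b j 0|).

(** The two conditions on [w] describe P' Q^-1 P r without inverting Q. The difference between the
    quotient and [w] solves the linearized equation up to a small error and vanishes off the
    support, so coercivity bounds it. *)
Lemma kkt_derivative z b (r w : 'cV[R]_p) : KKT z b -> regular_pt z b ->
  (forall j, b j 0 = 0 -> w j 0 = 0) ->
  (forall j, b j 0 != 0 -> (S *m w) j 0 + dphi `|b j 0| * w j 0 = r j 0) ->
  forall e, 0 < e -> exists2 d, 0 < d & forall h, `|h| < d -> forall b',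
    h != 0 -> KKT (z + h *: r) b' ->
    forall j, `|h^-1 * (b' j 0 - b j 0) - w j 0| <= e.
Proof.
move=> hb reg w0 w1 e e_gt0.
pose V := c^-1 * l1norm r; pose W := l1norm w.
have V0 : 0 <= V by rewrite mulr_ge0 ?l1norm_ge0// invr_ge0 ltW.
have W0 : 0 <= W by exact: l1norm_ge0.
pose B := 1 + p%:R * (V * (V + W)).
have VW0 : 0 <= V * (V + W) by rewrite mulr_ge0// addr_ge0.
have B0 : 0 < B by rewrite ltr_pwDl// mulr_ge0.
(* Chosen so that the summed error [p e' V (V + W)] is at most [c e^2]; [V] bounds the quotients and
   [W] the entries of [w]. *)
pose e' := c * e ^+ 2 / B.
have e'0 : 0 < e' by rewrite divr_gt0// mulr_gt0// exprn_gt0.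
have close h b' j : KKT (z + h *: r) b' -> `|b' j 0 - b j 0| <= `|h| * V.
  move=> hb'.
  have := kkt_coord_lipschitz lam_gt0 hk phi0 k_lt_mu S_coercive j hb' hb.
  by rewrite addrAC subrr add0r l1normZ /V mulrCA.
pose Q j (h : R) := forall b', KKT (z + h *: r) b' ->
  if b j 0 == 0 then b' j 0 = 0 else
  `|(z + h *: r - S *m b') j 0 - (z - S *m b) j 0 - dphi `|b j 0| * (b' j 0 - b j 0)|
    <= e' * `|b' j 0 - b j 0|.
have hQ j : exists2 d, 0 < d & forall h, `|h| < d -> Q j h.
  rewrite /Q; have := reg j; case: ifPn => [/eqP bj gj|bj dj].
    have [d d0 hd] := kkt_zero_open lam_gt0 hk phi0 k_lt_mu S_coercive hb bj gj.
    have L1 : 0 < 1 + l1norm r by rewrite ltr_pwDl// l1norm_ge0.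
    exists (d / (1 + l1norm r)) => [|h]; first by rewrite divr_gt0.
    rewrite ltr_pdivlMr// => hd' b' hb'; apply: hd hb' _.
    rewrite addrAC subrr add0r l1normZ; apply: le_lt_trans hd'.
    by rewrite ler_wpM2l// lerDr.
  have [d d0 hd] := is_derive_eps dj e'0.
  have bj0 : 0 < `|b j 0| by rewrite normr_gt0.
  have V1 : 0 < 1 + V by rewrite ltr_pwDl.
  exists (Num.min (d / (1 + V)) (`|b j 0| / (1 + V))) => [|h].
    by rewrite lt_min !divr_gt0.
  rewrite lt_min !ltr_pdivlMr// => /andP[hd1 hd2] b' hb'.
  have cl := close _ _ j hb'.
  have hV : `|h| * V <= `|h| * (1 + V) by rewrite ler_wpM2l// lerDr.
  (* The move is too small to change the sign, so the expansion of [phi] at [|b_j|] applies. *)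
  have bb : `|b' j 0 - b j 0| < `|b j 0| by lra.
  have sgE : Num.sg (b' j 0) = Num.sg (b j 0).
    move: bb bj0; have [b0|b0|->] := ltrgt0P (b j 0); rewrite ?ltxx// => bb _.
      by rewrite (gtr0_sg b0) gtr0_sg//; move: bb; rewrite ltr_norml; lra.
    by rewrite (ltr0_sg b0) ltr0_sg//; move: bb; rewrite ltr_norml; lra.
  have b'j : b' j 0 != 0 by rewrite -sgr_eq0 sgE sgr_eq0.
  have := hb' j; have := hb j; rewrite /subgrad (negPf bj) (negPf b'j) => -> ->.
  have absE : `|b' j 0| - `|b j 0| = Num.sg (b j 0) * (b' j 0 - b j 0).
    by rewrite mulrBr -{1}sgE -!normrEsg.
  have sg1 : `|Num.sg (b j 0)| = 1 by rewrite normr_sg bj.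
  have := hd `|b' j 0|; rewrite absE normrM sg1 mul1r => /(_ ltac:(lra)).
  apply: le_trans; rewrite sgE -[leRHS]mul1r -sg1 -normrM.
  rewrite le_eqVlt; apply/orP; left; apply/eqP; congr (`| _ |).
  have sg2 : Num.sg (b j 0) * Num.sg (b j 0) = 1 by rewrite -expr2 sqr_sg bj.
  have : Num.sg (b j 0) * Num.sg (b j 0) * (dphi `|b j 0| * (b' j 0 - b j 0)) =
      dphi `|b j 0| * (b' j 0 - b j 0) by rewrite sg2 mul1r.
  lra.
have [d d0 hd] := finite_delta hQ.
exists d => // h /hd {}hd b' h0 hb'; pose v := h^-1 *: (b' - b); pose u := v - w.
have vV j : `|v j 0| <= V.
  rewrite !mxE normrM normfV ler_pdivrMl ?normr_gt0//; exact: close.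
have wW j : `|w j 0| <= W by exact: coord_le_l1norm.
have uVW j : `|u j 0| <= V + W.
  by rewrite !mxE (le_trans (ler_normB _ _))// lerD//; have := vV j; rewrite !mxE.
(* Energy estimate for one coordinate: the linearized equation is tested against [u_j], and the
   diagonal term is bounded through [dphi >= - k]. *)
have row_bound j : - k * u j 0 ^+ 2 + (S *m u) j 0 * u j 0 <= e' * (V * (V + W)).
  have [bj|bj] := eqVneq (b j 0) 0.
    have -> : u j 0 = 0.
      by have := hd j b' hb'; rewrite bj eqxx !mxE => ->; rewrite bj w0// subrr mulr0 subrr.
    by rewrite expr0n !mulr0 addr0 mulr_ge0// ltW.
  have := hd j b' hb'; rewrite (negPf bj) => hj.
  have dk : - k <= dphi `|b j 0|.
    by apply: (@slope_derive_ge `|b j 0|); [rewrite normr_gt0|have := reg j; rewrite (negPf bj)].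
  have {}hj : `|(S *m u) j 0 + dphi `|b j 0| * u j 0| <= e' * V.
    apply: le_trans (_ : e' * `|v j 0| <= _); last by rewrite ler_wpM2l// ltW.
    rewrite -(ler_pM2l (_ : 0 < `|h|)) ?normr_gt0//.
    have -> : `|h| * (e' * `|v j 0|) = e' * `|b' j 0 - b j 0|.
      by rewrite mulrCA -normrM !mxE mulVKf.
    apply: le_trans hj; rewrite -normrM -[leRHS]normrN.
    rewrite le_eqVlt; apply/orP; left; apply/eqP; congr (`| _ |).
    have hu : h *: u = b' - b - h *: w by rewrite scalerBr scalerA divff// scale1r.
    have hSu : h * (S *m u) j 0 = (S *m b') j 0 - (S *m b) j 0 - h * (S *m w) j 0.
      have -> : h * (S *m u) j 0 = (S *m (h *: u)) j 0 by rewrite -scalemxAr [RHS]mxE.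
      rewrite hu !mulmxBr -scalemxAr; move: (S *m b') (S *m b) (S *m w) => x y q.
      by rewrite !mxE.
    have hu' : h * u j 0 = b' j 0 - b j 0 - h * w j 0.
      by have := congr1 (fun M : 'cV[R]_p => M j 0) hu; rewrite !mxE.
    rewrite mulrDr hSu mulrCA hu'.
    have := w1 j bj; move: (S *m b') (S *m b) (S *m w) => x y q hq.
    by rewrite !mxE -hq; ring.
  have : ((S *m u) j 0 + dphi `|b j 0| * u j 0) * u j 0 <= e' * V * (V + W).
    by rewrite (le_trans (ler_norm _))// normrM ler_pM.
  have : - k * u j 0 ^+ 2 <= dphi `|b j 0| * u j 0 ^+ 2 by rewrite ler_wpM2r ?sqr_ge0.
  by lra.
have total : c * sqnorm u <= p%:R * (e' * (V * (V + W))).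
  have := S_coercive u.
  have : \sum_j (- k * u j 0 ^+ 2 + (S *m u) j 0 * u j 0) <= \sum_(j < p) (e' * (V * (V + W))).
    exact: ler_sum.
  rewrite sumr_const card_ord -[_ *+ p]mulr_natl big_split/= -mulr_sumr -/(sqnorm u).
  rewrite (eq_bigr (fun i => u i 0 * (S *m u) i 0)) -/(dot u (S *m u)); last by move=> i _; rewrite mulrC.
  by rewrite /c; lra.
move=> j; rewrite [X in `|X|](_ : _ = u j 0); last by rewrite !mxE.
rewrite -[leRHS]gtr0_norm// -ler_sqr ?nnegrE// !real_normK ?num_real//.
rewrite -(ler_pM2l c_gt0).
apply: le_trans (_ : c * sqnorm u <= _); first by rewrite ler_pM2l// coord_le_sqnorm.
apply: le_trans total _; rewrite mulrCA /e' mulrAC ler_pdivrMr//.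
by rewrite ler_pM2l ?mulr_gt0 ?exprn_gt0// /B lerDr.
Qed.

End kkt_derivative.

(** * Absolute continuity of the penalty slope *)

Section slope_absolutely_continuous.
Context {R : realType}.
Variables (rho ddrho : R -> R -> R) (lam : R).
Hypothesis pen : penalty rho ddrho lam.
Let phi := drho rho lam.
Let f : R -> R := ddrho ^~ lam.
Notation mu := (@lebesgue_measure R).

(** The integral identity of [penalty] only compares with the point 1, from either side; the four
    cases place [s] and [t] with respect to it. *)
Lemma slope_increment (s t : R) : 0 < s -> s <= t ->
  phi t - phi s = \int[mu]_(x in `[s, t]) f x.
Proof.
have half (u v w : R) : 0 < u -> u <= v -> v <= w ->
    \int[mu]_(x in `[u, w]) f x - \int[mu]_(x in `[u, v]) f x = \int[mu]_(x in `[v, w]) f x.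
  move=> u0 uv vw.
  rewrite Rintegral_itvB ?bnd_simp//; last by apply: (penalty_ddrho_integrable pen); lra.
  rewrite Rintegral_itv_obnd_cbnd//.
  apply: integrableS (penalty_ddrho_integrable pen (lt_le_trans u0 uv) vw) => //.
  by apply: subset_itvr; rewrite bnd_simp.
move=> s0 st; rewrite /phi (penalty_almost_twice_derivable pen s0).
rewrite (penalty_almost_twice_derivable pen (lt_le_trans s0 st)) /oriented_int -/f.
case: ifPn => [t1|]; case: ifPn => [s1|]; rewrite -?ltNge => *.
- by have := half 1 s t ltr01 s1 st; lra.
- by have := half s 1 t s0; rewrite t1 => /(_ (ltW _) isT) h; rewrite -h; lra.
- lra.
- by have := half s t 1 s0 st (ltW _); move=> h; rewrite -h//; lra.
Qed.

(** Lebesgue differentiation needs integrability, which is given only away from 0 and infinity; the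
    half-line is exhausted by the intervals from [1/(n+1)] to [n+1]. *)
Lemma ae_slope_derive :
  {ae mu, forall t : R, 0 < t -> is_derive t (1 : R) phi (f t)}.
Proof.
pose a (n : nat) : R := n.+1%:R^-1; pose b (n : nat) : R := n.+1%:R.
have a0 n : 0 < a n by rewrite invr_gt0.
suff H n : {ae mu, forall t : R, a n < t -> t < b n -> is_derive t (1 : R) phi (f t)}.
  have : {ae mu, forall t : R, forall n, a n < t -> t < b n -> is_derive t (1 : R) phi (f t)}.
    exact: ae_foralln.
  apply: filterS; first exact: (ae_filter_ringOfSetsType mu).
  move=> t ht t0.
  pose n := maxn (Num.truncn t) (Num.truncn t^-1).
  have tn x : x = t \/ x = t^-1 -> x < b n.
    move=> xE; apply: lt_le_trans (truncnS_gt x) _.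
    by rewrite ler_nat ltnS leq_max; case: xE => ->; rewrite leqnn ?orbT.
  apply: (ht n); last by apply: tn; left.
  by rewrite /a invf_plt ?posrE//; apply: tn; right.
have [ba|ab] := leP (b n) (a n).
  by apply: aeW => t at_ tb; move: (lt_trans at_ tb); rewrite ltNge ba.
have intf : mu.-integrable `[a n, b n] (EFin \o f).
  exact: (penalty_ddrho_integrable pen (a0 n) (ltW ab)).
have /lebesgue_differentiation := integrable_locally (measurable_itv _) intf.
apply: filterS; first exact: (ae_filter_ringOfSetsType mu).
move=> t ft at_ tb.
pose g := f \_ `[a n, b n].
have intg : mu.-integrable [set` Interval (BLeft (a n)) (BRight (b n))] (EFin \o g).
  apply: eq_integrable intf => // x xab.
  by rewrite /g /= patchE xab.
have [dF FE] := FTC1_lebesgue_pt tb intg (ltac:(by rewrite lte_fin) : (BLeft (a n) < BRight t)%E) ft.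
have gE : g t = f t by rewrite /g patchE mem_set//= in_itv/= !ltW.
have near_eq : \forall y \near t, (\int[mu]_(x in `[a n, y]) g x + phi (a n)) = phi y.
  near=> y.
  have /[!in_itv]/andP[/ltW ay /ltW yb] : y \in `]a n, b n[.
    by near: y; apply: near_in_itvoo; rewrite in_itv/= at_ tb.
  rewrite -[RHS](subrK (phi (a n))) (slope_increment (a0 n) ay); congr (_ + _).
  apply: eq_Rintegral => x; rewrite inE/= in_itv/= => /andP[ax xy].
  by rewrite /g patchE mem_set//= in_itv/= ax (le_trans xy yb).
apply: (@near_eq_is_derive _ _ _ (fun y => \int[mu]_(x in `[a n, y]) g x + phi (a n))).
  exact: near_eq.
rewrite -gE -FE -[X in is_derive _ _ _ X]addr0.
by apply: is_deriveD; apply: DeriveDef => //; rewrite derive1E.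
Unshelve. all: by end_near. Qed.

Lemma lebesgue_diam (A : set R) (D : R) : measurable A -> 0 <= D ->
  (forall s t, A s -> A t -> s <= t -> t - s <= D) -> (mu A <= D%:E)%E.
Proof.
move=> mA D0 hA; have [->|/set0P[x0 Ax0]] := eqVneq A set0.
  by rewrite measure0 lee_fin.
have le2 s t : A s -> A t -> t - D <= s.
  by move=> As At; have [ts|/ltW st] := leP t s; [lra|have := hA s t As At st; lra].
have lb : has_lbound A by exists (x0 - D) => s As; exact: le2.
apply: (@le_trans _ _ (mu `[inf A, inf A + D])).
  apply: le_measure; rewrite ?inE// => s As /=; rewrite in_itv/=; apply/andP; split.
    exact: ge_inf.
  by rewrite -lerBlDr; apply: lb_le_inf; [exists x0|move=> t At; exact: le2].
rewrite lebesgue_measure_itv/= lte_fin; case: ifPn => _; last by rewrite lee_fin.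
by rewrite -EFinB lee_fin addrAC subrr add0r.
Qed.

Lemma integrable_itv_cst (a b K : R) : mu.-integrable `[a, b] (EFin \o cst K).
Proof.
apply: measurable_bounded_integrable => //.
  by rewrite /= lebesgue_measure_itv/= lte_fin; case: ifPn => _; rewrite ?ltry.
by exists `|K|; split; [exact: num_real|move=> x /= Kx y _; exact: ltW].
Qed.

(* Where beta is positive, its inverse has increments bounded by those of
   K t + phi t, an absolutely continuous function. *)
Lemma preimage_null (beta : R -> R) (K : R) (N : set R) : 0 <= K ->
  nondecreasing_fun beta ->
  (forall s t, s <= t -> 0 < beta s ->
    t - s <= K * (beta t - beta s) + (phi (beta t) - phi (beta s))) ->
  measurable N -> N `<=` `]0, +oo[ -> mu N = 0 -> mu (beta @^-1` N) = 0.
Proof.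
move=> K0 nd hinc mN N0 muN.
have mbeta : measurable_fun setT beta by exact: nondecreasing_measurable.
have mpre (A : set R) : measurable A -> measurable (beta @^-1` A).
  by move=> mA; rewrite -[X in measurable X]setTI; exact: mbeta.
suff H (a b : R) : 0 < a -> a < b -> mu (beta @^-1` (N `&` `]a, b[)) = 0%E.
  (* Localization to where [ddrho] is integrable. With [n.+2] the left end is strictly below the
     right one even for [n = 0]. *)
  pose A n := N `&` `](n.+2%:R : R)^-1, (n.+2%:R : R)[%classic.
  have NE : N = \bigcup_n A n.
    apply/seteqP; split => [t Nt|t [n _ [//]]].
    have t0 : 0 < t by have := N0 _ Nt; rewrite /= in_itv/= andbT.
    pose n := maxn (Num.truncn t) (Num.truncn t^-1).
    have tn x : x = t \/ x = t^-1 -> x < n.+2%:R.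
      move=> xE; apply: lt_le_trans (truncnS_gt x) _.
      by rewrite ler_nat ltnS (@leq_trans n)// leq_max; case: xE => ->; rewrite leqnn ?orbT.
    exists n => //; split => //=; rewrite in_itv/=; apply/andP; split.
      by rewrite invf_plt ?posrE//; apply: tn; right.
    by apply: tn; left.
  have mA n : measurable (A n) by apply: measurableI => //; exact: measurable_itv.
  apply/eqP; rewrite eq_le measure_ge0 andbT NE preimage_bigcup.
  apply: (le_trans (generalized_Boole_inequality mu _ _)).
  - by move=> n; exact: mpre.
  - by apply: bigcup_measurable => n _; exact: mpre.
  - rewrite eseries0// => n _ _; apply: H; first by rewrite invr_gt0.
    by apply: (@lt_trans _ _ 1); rewrite ?invf_lt1 ?ltr1n.
move=> a0 ab; set M := N `&` _.
have mM : measurable M by apply: measurableI => //; exact: measurable_itv.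
have muM : mu M = 0%E.
  apply/eqP; rewrite eq_le measure_ge0 andbT -muN.
  by apply: le_measure; rewrite ?inE// => x [].
have intf : mu.-integrable `[a, b] (EFin \o f).
  exact: (penalty_ddrho_integrable pen a0 (ltW ab)).
(* The integral of [K + |f|] dominates the increments of [K t + phi t], hence the lengths of
   preimages. *)
pose h0 (x : R) := K + `|f x|.
have inth0 : mu.-integrable `[a, b] (EFin \o h0).
  rewrite (_ : _ \o _ = (fun x => K%:E + `|(f x)%:E|)%E)//.
  apply: integrableD => //; last exact: integrable_abse.
  exact: integrable_itv_cst.
pose h := h0 \_ `[a, b].
have inth : mu.-integrable setT (EFin \o h).
  by rewrite /h -restrict_EFin; apply/integrable_restrict => //; rewrite setTI.
have h_ge0 x : 0 <= h x.
  by rewrite /h patchE; case: ifPn => // _; rewrite addr_ge0.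
have mh (D : set (measurableTypeR R)) : measurable_fun D (EFin \o h).
  by apply: measurable_funTS; exact: measurable_int inth.
apply/eqP; rewrite eq_le measure_ge0 andbT; apply/lee_addgt0Pr => e e0; rewrite add0e.
(* Absolute continuity of the integral provides [d]; outer regularity then covers the null set by an
   open set of measure below [d]. *)
have [d [d0 hd]] := integral_normr_continuous inth e0.
have [|U [oU MU muU]] := lebesgue_regularity_outer mM _ d0.
  by rewrite [X in (X < _)%E]muM ltry.
pose V := U `&` `]a, b[%classic.
have oV : open V by apply: openI => //; exact: interval_open.
have mV : measurable V by exact: open_measurable.
have MV : M `<=` V by move=> x Mx; split; [exact: MU|case: Mx].
have muV : (mu V < d%:E)%E.
  apply: le_lt_trans muU; apply: (@le_trans _ _ (mu U)).
    by apply: le_measure; rewrite ?inE//; [exact: open_measurable|exact: subIsetl].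
  by rewrite (measureDI mu (open_measurable oU) mM) (setIidr MU) [X in (_ + X)%E]muM adde0.
have intV : (\int[mu]_(x in V) (h x)%:E <= e%:E)%E.
  have := hd V mV muV; rewrite -lte_fin /Rintegral fineK; last first.
    apply: integrable_fin_num => //.
    by apply: (integrableS measurableT) => //; apply: integrable_abse inth.
  move=> /ltW; apply: le_trans; rewrite le_eqVlt; apply/orP; left; apply/eqP.
  by apply: eq_integral => x _; rewrite ger0_norm.
apply: le_trans intV.
(* The open set is a disjoint union of open intervals. The preimage of each has diameter at most the
   integral of [h] over it, and these integrals sum to at most [e]. *)
pose I := open_disjoint_itv oV.
have VE : V = \bigcup_n I n by exact: open_disjoint_itv_bigcup.
have mI n : measurable (I n).
  by apply: open_measurable; exact: open_disjoint_itv_open.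
have step n : (mu (beta @^-1` I n) <= \int[mu]_(x in I n) (h x)%:E)%E.
  have fin : (\int[mu]_(x in I n) (h x)%:E)%E \is a fin_num.
    apply: integrable_fin_num => //; first exact: mI.
    exact: (integrableS (@measurableT _ (measurableTypeR R)) (mI n) (@subsetT _ _) inth).
  rewrite -(fineK fin); apply: lebesgue_diam; first exact: mpre.
    by rewrite fine_ge0// integral_ge0// => x _; rewrite lee_fin.
  move=> s t /= Is It st.
  have IV x : I n x -> a < x < b.
    by move=> Ix; have : V x by [rewrite VE; exists n]; move=> [_]/=; rewrite in_itv.
  have /andP[as_ sb] := IV _ Is; have /andP[at_ tb] := IV _ It.
  have bs0 : 0 < beta s by lra.
  have bst : beta s <= beta t by exact: nd.
  apply: le_trans (hinc _ _ st bs0) _.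
  rewrite slope_increment// -lee_fin fineK//.
  have ints : mu.-integrable `[beta s, beta t] (EFin \o f).
    apply: integrableS intf => // x; rewrite /= !in_itv/= => /andP[sx xt].
    by apply/andP; split; lra.
  have intKs : mu.-integrable `[beta s, beta t] (fun x => (K + f x)%:E).
    by apply: (integrableD _ (integrable_itv_cst _ _ K) ints).
  have -> : ((K * (beta t - beta s) + \int[mu]_(x in `[beta s, beta t]) f x)%:E =
      \int[mu]_(x in `[beta s, beta t]) (K + f x)%:E)%E.
    rewrite -[RHS]fineK; last by apply: integrable_fin_num.
    congr EFin; rewrite -/(Rintegral mu _ _) RintegralD//; last exact: integrable_itv_cst.
    rewrite Rintegral_cst//= lebesgue_measure_itv/= lte_fin.
    case: ifPn; first by rewrite -EFinB.
    by rewrite -leNgt => h'; rewrite (_ : beta t = beta s) ?subrr//; apply/eqP; rewrite eq_le h' bst.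
  apply: (@le_trans _ _ (\int[mu]_(x in `[beta s, beta t]) (h x)%:E)%E).
    apply: le_integral => //.
    - by apply: (integrableS _ _ _ inth).
    - move=> x; rewrite inE/= in_itv/= => /andP[sx xt].
      rewrite lee_fin /h patchE mem_set/=; last by rewrite in_itv/=; apply/andP; split; lra.
      by rewrite lerD2l ler_norm.
  apply: ge0_subset_integral => //.
  - exact: mI.
  - by move=> x _; rewrite lee_fin.
  - move=> x; rewrite /= in_itv/= => xst.
    exact: (@open_disjoint_itv_is_interval _ _ oV n _ _ Is It _ xst).
apply: (@le_trans _ _ (\sum_(n <oo) mu (beta @^-1` I n))%E).
  apply: measure_sigma_subadditive; [by move=> n; exact: mpre|exact: mpre|].
  by rewrite -preimage_bigcup -VE; exact: preimage_subset.
rewrite VE ge0_integral_bigcup//.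
- by apply: lee_nneseries => // n _.
- by move=> x _; rewrite lee_fin.
- exact: open_disjoint_itv_trivIset.
Qed.

End slope_absolutely_continuous.

(** * Gaussian shifts and integration by parts *)

Section weighted_law.
Context {R : realType} {d d' : measure_display}.
Context {T : measurableType d} {T' : measurableType d'}.
Variables (mu : {measure set T -> \bar R}) (X : T -> T') (w : T -> R).

(** The image under [X] of the measure with density [w]: for [w = 1] the law of [X], for [X] the
    identity a measure given by its density. The proofs are parameters so that the measure structure
    can be attached to this name. *)
Definition weighted_law (mX : measurable_fun setT X) (mw : measurable_fun setT w)
    (w0 : forall x, 0 <= w x) : set T' -> \bar R :=
  fun A => (\int[mu]_(x in X @^-1` A) (w x)%:E)%E.

Hypotheses (mX : measurable_fun setT X) (mw : measurable_fun setT w).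
Hypothesis w0 : forall x, 0 <= w x.

Let mpre (A : set T') : measurable A -> measurable (X @^-1` A).
Proof. by move=> mA; rewrite -[X in measurable X]setTI; exact: mX. Qed.

Let mEw (D : set T) : measurable_fun D (EFin \o w).
Proof. by apply: measurable_funTS; exact/measurable_EFinP. Qed.

Local Notation nu := (weighted_law mX mw w0).

Let weighted_law0 : nu set0 = 0%E.
Proof. by rewrite /weighted_law preimage_set0 integral_set0. Qed.

Let weighted_law_ge0 A : (0 <= nu A)%E.
Proof. by apply: integral_ge0 => x _; rewrite lee_fin. Qed.

Let weighted_law_sigma_additive : semi_sigma_additive nu.
Proof.
move=> /= A mA tA mUA; rewrite /weighted_law preimage_bigcup ge0_integral_bigcup//=.
- by apply: is_cvg_ereal_nneg_natsum_cond => n _ _; exact: weighted_law_ge0.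
- by move=> k; exact: mpre.
- by move=> x _; rewrite lee_fin.
- apply/trivIsetP => i j _ _ ij; rewrite -preimage_setI.
  by move/trivIsetP: tA => -> //; rewrite preimage_set0.
Qed.

HB.instance Definition _ := isMeasure.Build _ _ _
  nu weighted_law0 weighted_law_ge0 weighted_law_sigma_additive.

Import HBNNSimple.

(** For indicators this is the definition; increasing simple approximations and monotone convergence
    on both sides do the rest. *)
Lemma ge0_integral_weighted_law (f : T' -> \bar R) :
  (forall y, 0 <= f y)%E -> measurable_fun setT f ->
  (\int[nu]_y f y = \int[mu]_x (f (X x) * (w x)%:E))%E.
Proof.
move=> f0 mf; pose h := nnsfun_approx measurableT mf.
have mEwT : measurable_fun setT (EFin \o w) by exact: mEw.
have mhX n : measurable_fun setT (fun x => (h n (X x))%:E).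
  by apply/measurable_EFinP; apply: measurableT_comp.
have -> : (\int[nu]_y f y = lim ((\int[nu]_y (h n y)%:E) @[n --> \oo]))%E.
  rewrite -monotone_convergence//; last 3 first.
  - by move=> n; apply/measurable_EFinP.
  - by move=> n x _; rewrite lee_fin.
  - by move=> x _ a b ab; rewrite lee_fin; exact/lefP/nd_nnsfun_approx.
  by apply: eq_integral => y _; apply/esym/cvg_lim => //; exact: cvg_nnsfun_approx.
have -> : (\int[mu]_x (f (X x) * (w x)%:E) =
    lim ((\int[mu]_x ((h n (X x))%:E * (w x)%:E)) @[n --> \oo]))%E.
  rewrite -monotone_convergence//; last 3 first.
  - by move=> n; apply: emeasurable_funM.
  - by move=> n x _; rewrite mule_ge0 ?lee_fin.
  - move=> x _ a b ab; rewrite lee_wpmul2r ?lee_fin//.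
    exact/lefP/nd_nnsfun_approx.
  apply: eq_integral => x _; apply/esym/cvg_lim => //; apply: cvgeZr => //.
  exact: cvg_nnsfun_approx.
suff suf n : (\int[mu]_x ((h n (X x))%:E * (w x)%:E) = \int[nu]_y (h n y)%:E)%E.
  by under [in RHS]eq_fun do rewrite suf.
have -> : (\int[nu]_y (h n y)%:E =
    \int[nu]_y (\sum_(r \in range (h n)) (r * \1_(h n @^-1` [set r]) y)%:E))%E.
  by apply: eq_integral => t _; rewrite /= fimfunE -fsumEFin.
rewrite ge0_integral_fsum//; last 2 first.
- move=> r; apply/measurable_EFinP; apply: measurable_funM => //.
- by move=> r y _; exact: nnfun_muleindic_ge0.
transitivity (\int[mu]_x (\sum_(r \in range (h n))
    (r * \1_(h n @^-1` [set r]) (X x))%:E * (w x)%:E))%E.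
  apply: eq_integral => x _.
  rewrite -ge0_mule_fsuml => [|y]; last exact: nnfun_muleindic_ge0.
  by rewrite fsumEFin // -(fimfunE _ (X x)).
have mr (r : R) : measurable_fun setT (fun x => (r * \1_(h n @^-1` [set r]) (X x))%:E).
  apply/measurable_EFinP; apply: measurable_funM => //.
  have mA : measurable (h n @^-1` [set r]) by [].
  by apply: (measurableT_comp _ mX); exact: measurable_indic.
rewrite ge0_integral_fsum//; last 2 first.
- by move=> r; apply: emeasurable_funM.
- by move=> r x _; apply: mule_ge0; [exact: nnfun_muleindic_ge0|rewrite lee_fin].
apply: eq_fsbigr => r rhn.
under [RHS]eq_integral do rewrite EFinM.
rewrite integralZl_indic_nnsfun// integral_indic// setIT.
under eq_integral do rewrite EFinM -muleA.
rewrite ge0_integralZl//.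
- congr (_ * _)%E; rewrite /weighted_law [RHS]integral_mkcond.
  apply: eq_integral => x _; rewrite patchE indicE.
  case: ifPn => [/set_mem hx|hx].
    by rewrite mem_set// mul1e.
  rewrite memNset ?mul0e// => hx'.
  by move/negP: hx; apply; exact/mem_set.
- apply: emeasurable_funM => //; apply/measurable_EFinP.
  have mA : measurable (h n @^-1` [set r]) by [].
  by apply: (measurableT_comp _ mX); exact: measurable_indic.
- by move=> t _; rewrite mule_ge0 ?lee_fin.
- by move: rhn; rewrite inE => -[t _ <-]; rewrite lee_fin.
Qed.

End weighted_law.

(** * Measurability and uniqueness of measures on column vectors *)

Section vector_sigma_algebra.
Context {R : realType}.

(* The library puts no sigma-algebra on matrices; vec n is the type of columns with
   the product one. *)
Definition cylinder n : set (set 'cV[R]_n) :=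
  [set A : set 'cV[R]_n | exists B : 'I_n -> set R,
    (forall i, measurable (B i)) /\ A = [set x : 'cV[R]_n | forall i, B i (x i 0)]].

Definition vec n := g_sigma_algebraType (@cylinder n).

Lemma measurable_coord n (i : 'I_n) :
  measurable_fun setT (fun x : vec n => (x : 'cV[R]_n) i 0).
Proof.
move=> _ B mB; rewrite setTI; apply: sub_sigma_algebra.
exists (fun j => if j == i then B else setT); split.
  by move=> j; case: ifP.
apply/seteqP; split => [x Bx j|x /(_ i)]; last by rewrite eqxx.
by case: ifPn => [/eqP ->|].
Qed.

Lemma measurable_to_vec n d (T : measurableType d) (g : T -> 'cV[R]_n) :
  (forall i, measurable_fun setT (fun t => g t i 0)) ->
  measurable_fun setT (g : T -> vec n).
Proof.
move=> mg; apply: (@measurability _ _ T (vec n) setT g (@cylinder n)) => // _ [_ [B [mB ->]] <-].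
rewrite setTI.
have -> : g @^-1` [set x : 'cV[R]_n | forall i, B i (x i 0)] =
    \big[setI/setT]_(i < n) ((fun t => g t i 0) @^-1` B i).
  apply/seteqP; split => [t gt|t].
    by apply: (big_ind (fun P : set T => P t)) => [|P Q Pt Qt|i _].
  by move=> h i; move: h; rewrite (bigD1 i)//= => -[].
apply: bigsetI_measurable => i _.
by rewrite -[X in measurable X]setTI; exact: mg.
Qed.

Lemma measurable_translate n (a : 'cV[R]_n) :
  measurable_fun setT ((fun x : vec n => (x : 'cV[R]_n) + a) : vec n -> vec n).
Proof.
apply: measurable_to_vec => i.
rewrite (_ : (fun t => _) = (fun t : vec n => (t : 'cV[R]_n) i 0 + a i 0)).
  by apply: measurable_funD => //; exact: measurable_coord.
by apply/funext => t; rewrite !mxE.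
Qed.

(** Boxes form a generating family that is closed under intersection and contains the whole space,
    so Dynkin's uniqueness theorem applies. *)
Lemma vec_measure_unique n (m1 m2 : {measure set (vec n) -> \bar R}) :
  (m1 setT < +oo)%E -> (forall A, cylinder A -> m1 A = m2 A) ->
  forall A, measurable A -> m1 A = m2 A.
Proof.
move=> m1oo m12 A mA.
have Gm : @cylinder n `<=` @measurable _ (vec n).
  by move=> B cB; exact: sub_sigma_algebra.
apply: (@g_sigma_algebra_measure_unique _ _ (vec n) (@cylinder n) Gm (fun _ => setT)) => //.
- by move=> _; exists (fun _ => setT); split => //; apply/seteqP; split.
- by rewrite bigcup_const//; exists 0%N.
- move=> _ _ [B [mB ->]] [B' [mB' ->]]; exists (fun i => B i `&` B' i); split.
    by move=> i; exact: measurableI.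
  by apply/seteqP; split => [x [h h'] i|x h]; [split|split => i; case: (h i)].
Qed.

Lemma rat_dense_l1norm n (x : 'cV[R]_n) (e : R) : 0 < e ->
  exists q : 'cV[rat]_n, l1norm (x - map_mx ratr q) < e.
Proof.
move=> e0; have d0 : 0 < e / n.+1%:R by rewrite divr_gt0.
have hq i : exists r : rat, `|x i 0 - ratr r| < e / n.+1%:R.
  have [|r] := @rat_in_itvoo _ (x i 0 - e / n.+1%:R) (x i 0 + e / n.+1%:R).
    by rewrite ltrD2l gtrN.
  by rewrite in_itv/= => h; exists r; rewrite distrC ltr_distl.
have [q hq'] := choice hq.
exists (\col_i q i); apply: (@le_lt_trans _ _ (\sum_(i < n) e / n.+1%:R)).
  by apply: ler_sum => i _; rewrite !mxE ltW.
rewrite sumr_const card_ord -[_ *+ n]mulr_natr -mulrA.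
by rewrite gtr_pMr// mulrC ltr_pdivrMr// mul1r ltr_nat.
Qed.

(** The sigma-algebra is generated by boxes, not by open sets. A superlevel set is therefore written
    as a countable union, over rational centres [q], of the sets where the Lipschitz lower bound
    [f q - L1 |x - q|] already exceeds the level. *)
Lemma lipschitz_measurable n (f : 'cV[R]_n -> R) (L : R) :
  (forall x y, `|f x - f y| <= L * l1norm (x - y)) ->
  measurable_fun setT (f : vec n -> R).
Proof.
move=> fL; pose L1 := 1 + `|L|.
have L10 : 0 < L1 by rewrite ltr_pwDl.
have {}fL x y : `|f x - f y| <= L1 * l1norm (x - y).
  apply: le_trans (fL x y) _; rewrite ler_wpM2r ?l1norm_ge0//.
  by rewrite (le_trans (ler_norm _))// lerDr.
pose q (k : nat) : 'cV[R]_n :=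
  if @unpickle 'cV[rat]_n k is Some q then map_mx ratr q else 0.
apply: (measurability (@RGenOInfty.G R)) => [|/= _ [_] [r] -> <-].
  exact: RGenOInfty.measurableE.
rewrite setTI.
have -> : f @^-1` `]r, +oo[ =
    \bigcup_k [set x : 'cV[R]_n | r < f (q k) - L1 * l1norm (x - q k)].
  apply/seteqP; split => x /=; rewrite in_itv/= andbT.
    move=> rf; pose e := (f x - r) / (2 * L1).
    have e0 : 0 < e by rewrite divr_gt0 ?mulr_gt0// subr_gt0.
    have [s hs] := rat_dense_l1norm x e0.
    exists (pickle s) => //=; rewrite /q pickleK.
    have := fL x (map_mx ratr s); rewrite ler_norml => /andP[_].
    by move: hs; rewrite /e ltr_pdivlMr ?mulr_gt0//; lra.
  move=> [k _ /=]; have := fL x (q k); rewrite ler_norml => /andP[h _]; lra.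
apply: bigcupT_measurable => k.
have mg : measurable_fun setT (fun x : vec n => f (q k) - L1 * l1norm ((x : 'cV[R]_n) - q k)).
  apply: measurable_funB => //; apply: measurable_funM => //.
  apply: measurable_sum => i.
  rewrite (_ : (fun x => _) = (fun x : vec n => `|(x : 'cV[R]_n) i 0 - q k i 0|)); last first.
    by apply/funext => x; rewrite !mxE.
  by apply: measurableT_comp => //; apply: measurable_funB => //; exact: measurable_coord.
rewrite (_ : [set x | _] = (fun x : vec n => f (q k) - L1 * l1norm ((x : 'cV[R]_n) - q k)) @^-1` `]r, +oo[).
  by rewrite -[X in measurable X]setTI; apply: mg.
by apply/seteqP; split => x /=; rewrite in_itv/= andbT.
Qed.

End vector_sigma_algebra.

Section gaussian_shift.
Context {R : realType}.
Variable sigma : R.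
Hypothesis sigma0 : sigma != 0.
Notation mu := (@lebesgue_measure R).

Let s2 := sigma ^+ 2.
Let s2_gt0 : 0 < s2. Proof. by rewrite /s2 exprn_even_gt0. Qed.

Lemma lebesgue_translate (t : R) (A : set (measurableTypeR R)) : measurable A ->
  mu A = mu ((fun x => x + t) @^-1` A).
Proof.
move=> mA; pose f (x : measurableTypeR R) : measurableTypeR R := x + t.
have mt : measurable_fun setT f by apply: measurable_funD.
pose fM : {mfun measurableTypeR R >-> measurableTypeR R} :=
  HB.pack f (isMeasurableFun.Build _ _ _ _ _ mt).
rewrite (_ : _ @^-1` A = fM @^-1` A)// -/(pushforward mu fM A).
apply: lebesgue_measure_unique => // _ [[a b]] _ <- /=.
rewrite /pushforward.
have -> : f @^-1` `]a, b] = `]a - t, b - t]%classic.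
  by apply/seteqP; split => x /=; rewrite !in_itv/= ltrBlDr lerBrDr.
rewrite !lebesgue_measure_itv/= !lte_fin ltrD2r; case: ifPn => // _.
by rewrite -!EFinB; congr EFin; ring.
Qed.

Lemma ge0_integral_translate (t : R) (f : measurableTypeR R -> \bar R) :
  measurable_fun setT f -> (forall x, 0 <= f x)%E ->
  (\int[mu]_x f x = \int[mu]_x f (x + t)%R)%E.
Proof.
move=> mf f0; pose g (x : measurableTypeR R) : measurableTypeR R := x + t.
have mt : measurable_fun setT g by apply: measurable_funD.
have m1 : measurable_fun setT (cst 1 : measurableTypeR R -> R) by [].
have h1 (x : measurableTypeR R) : 0 <= cst 1 x :> R by [].
rewrite (eq_measure_integral (weighted_law mu mt m1 h1)) => [|A mA _].
  rewrite ge0_integral_weighted_law//; apply: eq_integral => x _.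
  by rewrite mule1.
rewrite [LHS](lebesgue_translate t mA).
rewrite /= /weighted_law (eq_integral (cst 1%E))// integral_cst ?mul1e//.
by rewrite -[X in measurable X]setTI; exact: mt.
Qed.

(** The density of N(t, sigma^2) with respect to N(0, sigma^2). *)
Definition tilt (t x : R) := expR (t * x / s2 - t ^+ 2 / (2 * s2)).

Lemma normal_pdf_shift (t x : R) :
  normal_pdf 0 sigma x * tilt t x = normal_pdf 0 sigma (x - t).
Proof.
rewrite /normal_pdf (negPf sigma0) /normal_fun -mulrA -expRD; congr (_ * expR _).
by rewrite /s2 !subr0 -mulr_natr; field.
Qed.

Lemma measurable_tilt t : measurable_fun setT (tilt t : measurableTypeR R -> R).
Proof.
apply: measurableT_comp => //; apply: measurable_funB => //.
by apply: measurable_funM => //; apply: measurable_funM.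
Qed.

(** Completing the square turns the tilted density into the translated one; translation invariance
    of Lebesgue measure then moves the shift to the set. *)
Lemma normal_tilt (t : R) (B : set (measurableTypeR R)) : measurable B ->
  (\int[normal_prob 0 sigma]_(x in B) (tilt t x)%:E =
   normal_prob 0 sigma [set x | B (x + t)%R])%E.
Proof.
move=> mB.
have mid : measurable_fun setT (@idfun (measurableTypeR R)) by exact: measurable_id.
have mpdf : measurable_fun setT (normal_pdf 0 sigma : measurableTypeR R -> R).
  exact: measurable_normal_pdf.
have mtilt := measurable_tilt t.
have pdf0 := normal_pdf_ge0 0 sigma.
pose N := weighted_law mu mid mpdf pdf0.
have NE A : normal_prob 0 sigma A = N A by [].
rewrite (eq_measure_integral N) => [|A mA _]; last exact: NE.
rewrite integral_mkcond ge0_integral_weighted_law; last 2 first.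
- by move=> y; rewrite patchE; case: ifP => // _; rewrite lee_fin expR_ge0.
- by apply/(measurable_restrictT _ _).1 => //; apply/measurable_EFinP; exact: measurable_funTS.
pose F (x : measurableTypeR R) := ((fun x => (normal_pdf 0 sigma (x - t))%:E) \_ B) x.
transitivity (\int[mu]_x F x)%E.
  apply: eq_integral => x _; rewrite /F !patchE; case: ifP => _; last by rewrite mul0e.
  by rewrite -EFinM mulrC normal_pdf_shift.
rewrite (ge0_integral_translate t); last 2 first.
- apply/(measurable_restrictT _ _).1 => //; apply/measurable_EFinP.
  apply: measurable_funTS; apply: (measurableT_comp mpdf).
  by apply: measurable_funB.
- by move=> x; rewrite /F patchE; case: ifP => // _; rewrite lee_fin.
rewrite NE /N /weighted_law [RHS]integral_mkcond; apply: eq_integral => x _.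
by rewrite /F !patchE addrK; congr (if _ then _ else _).
Qed.

End gaussian_shift.

(** * Cameron-Martin formula for independent normal coordinates *)

Section cameron_martin.
Context {R : realType} {d : measure_display} {Omega : measurableType d}.
Variables (P : probability Omega R) (n : nat) (sigma : R).
Variable eps : 'I_n -> {RV P >-> R}.
Hypothesis sigma0 : sigma != 0.
Hypothesis heps : gaussian_noise sigma eps.

Definition noise (w : Omega) : 'cV[R]_n := \col_i eps i w.

Lemma measurable_noise : measurable_fun setT (noise : Omega -> vec n).
Proof.
apply: measurable_to_vec => i.
rewrite (_ : (fun t => _) = eps i)//.
by apply/funext => t; rewrite mxE.
Qed.

Lemma measurable_noiseD v : measurable_fun setT ((fun w => noise w + v) : Omega -> vec n).
Proof.
apply: measurable_to_vec => i.
rewrite (_ : (fun t => _) = (fun t => eps i t + v i 0)); first exact: measurable_funD.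
by apply/funext => t; rewrite !mxE.
Qed.

(* The density of the law of noise + v with respect to that of noise. *)
Definition cm_weight (v x : 'cV[R]_n) : R :=
  expR (dot v x / sigma ^+ 2 - sqnorm v / (2 * sigma ^+ 2)).

Lemma measurable_dot (v : 'cV[R]_n) : measurable_fun setT (dot v : vec n -> R).
Proof.
apply: measurable_sum => i; apply: measurable_funM => //; exact: measurable_coord.
Qed.

Lemma measurable_cm_weight v : measurable_fun setT (cm_weight v : vec n -> R).
Proof.
apply: measurableT_comp => //; apply: measurable_funB => //.
by apply: measurable_funM => //; exact: measurable_dot.
Qed.

(** A property of the single vector [v], so that it can be proved for multiples of basis vectors and
    carried over to sums. *)
Definition shift_formula (v : 'cV[R]_n) : Prop := forall f : vec n -> \bar R,
  measurable_fun setT f -> (forall x, 0 <= f x)%E ->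
  (\int[P]_w f (noise w + v)%R = \int[P]_w (f (noise w) * (cm_weight v (noise w))%:E))%E.

(** The weights satisfy the cocycle identity [cm_weight u (x - v) * cm_weight v x = cm_weight (u +
    v) x]; the shift by [v] is applied to [f] times the first factor. *)
Lemma shift_formulaD u v : shift_formula u -> shift_formula v -> shift_formula (u + v).
Proof.
move=> hu hv f mf f0.
pose g (x : vec n) := f ((x : 'cV[R]_n) + v).
have mg : measurable_fun setT g.
  exact: (measurableT_comp mf (measurable_translate v)).
transitivity (\int[P]_w g (noise w + u)%R)%E.
  by apply: eq_integral => w _; rewrite /g addrA.
rewrite (hu g)//; last by move=> x; exact: f0.
rewrite /g.
pose h (x : vec n) := (f x * (cm_weight u ((x : 'cV[R]_n) - v))%:E)%E.
have mh : measurable_fun setT h.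
  apply: emeasurable_funM => //; apply/measurable_EFinP.
  exact: (measurableT_comp (measurable_cm_weight u) (measurable_translate (- v))).
transitivity (\int[P]_w h (noise w + v)%R)%E.
  by apply: eq_integral => w _; rewrite /h addrK.
rewrite (hv h)//; last by move=> x; rewrite mule_ge0// lee_fin expR_ge0.
apply: eq_integral => w _; rewrite /h -muleA -EFinM; congr (_ * EFin _)%E.
rewrite /cm_weight -expRD; congr expR.
rewrite dotBr dotDl -(dot_sqnorm (u + v)) !(dotDl, dotDr) !dot_sqnorm (dotC v u).
by field.
Qed.

(** Both sides integrate [f] against a measure on columns, so comparing them on boxes suffices; on a
    box independence separates coordinate [i], where the one-dimensional tilt applies. *)
Lemma shift_formula_coord (t : R) (i : 'I_n) : shift_formula (t *: delta_mx i 0).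
Proof.
move=> f mf f0; set v := t *: delta_mx i 0.
have m1 : measurable_fun setT (cst 1 : Omega -> R) by [].
have h1 (w : Omega) : 0 <= cst 1 w :> R by [].
have mw : measurable_fun setT (fun w => cm_weight v (noise w)).
  exact: (measurableT_comp (measurable_cm_weight v) measurable_noise).
have w0 (w : Omega) : 0 <= cm_weight v (noise w) by exact: expR_ge0.
pose m1v := weighted_law P (measurable_noiseD v) m1 h1.
pose m2v := weighted_law P measurable_noise mw w0.
suff mE : forall A, measurable A -> m1v A = m2v A.
  transitivity (\int[m1v]_x f x)%E.
    by rewrite ge0_integral_weighted_law//; apply: eq_integral => w _; rewrite mule1.
  rewrite (eq_measure_integral m2v) => [|A mA _]; last exact: mE.
  by rewrite ge0_integral_weighted_law.
have m1E A : measurable A -> m1v A = P ((fun w => noise w + v) @^-1` A).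
  move=> mA; rewrite /m1v/= /weighted_law (eq_integral (cst 1%E))// integral_cst ?mul1e//.
  by rewrite -[X in measurable X]setTI; exact: measurable_noiseD.
apply: vec_measure_unique.
  rewrite -[X in (X < _)%E]/(m1v setT) m1E//= preimage_setT probability_setT.
  by rewrite ltry.
move=> _ [B [mB ->]]; have cB : cylinder [set x : 'cV[R]_n | forall i, B i (x i 0)].
  by exists B.
rewrite -[LHS]/(m1v _) m1E; last exact: sub_sigma_algebra.
pose N := normal_prob 0 sigma : set (measurableTypeR R) -> \bar R.
pose C (A : set R) k := if k == i then A else B k.
have mC A : measurable A -> forall k, measurable (C A k).
  by move=> mA k; rewrite /C; case: ifP.
pose c := (\prod_(k | k != i) N (B k))%E.
have PC A : measurable A -> P [set w | forall k, C A k (eps k w)] = (N A * c)%E.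
  move=> mA; rewrite heps; last exact: mC.
  rewrite /centered_normal (negPf sigma0) (bigD1 i)//= {1}/C eqxx; congr (_ * _)%E.
  by apply: eq_bigr => k ki; rewrite /C (negPf ki).
have cfin : c \is a fin_num.
  apply: prode_fin_num => k _.
  rewrite ge0_fin_numE; last exact: measure_ge0.
  apply: (@le_lt_trans _ _ 1%E); last exact: ltry.
  by apply: (probability_le1 (normal_prob 0 sigma)); exact: mB.
have -> : (fun w => noise w + v) @^-1` [set x : 'cV[R]_n | forall k, B k (x k 0)] =
    [set w | forall k, C ((fun x => x + t) @^-1` B i) k (eps k w)].
  apply/seteqP; split => w /= h k; have := h k; rewrite /C/v !mxE eqxx andbT;
    by case: eqP => [->|_]; rewrite ?mulr1 ?mulr0 ?addr0.
rewrite PC; last first.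
  by rewrite -[X in measurable X]setTI; apply: measurable_funD.
rewrite (_ : N (_ @^-1` B i) =
  (\int[normal_prob 0 sigma]_(x in B i) (tilt sigma t x)%:E)%E); last first.
  by rewrite (normal_tilt sigma0 t (mB i)).
pose E := [set w | forall k, k != i -> B k (eps k w)].
have mE : measurable E.
  have -> : E = \big[setI/setT]_(k | k != i) (eps k @^-1` B k).
    apply/seteqP; split => w.
      by move=> Ew; apply: (big_ind (fun Q : set Omega => Q w)) => // k; exact: Ew.
    by move=> h k ki; move: h; rewrite (bigD1 k)//= => -[].
  apply: bigsetI_measurable => k _.
  by rewrite -[X in measurable X]setTI; exact: (@measurable_funPT _ _ _ _ (eps k)).
pose X1 (w : Omega) : measurableTypeR R := eps i w.
have mX1 : measurable_fun setT X1 by exact: (@measurable_funPT _ _ _ _ (eps i)).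
have mIE : measurable_fun setT (\1_E : Omega -> R) by exact: measurable_indic.
have IE0 (w : Omega) : 0 <= \1_E w :> R by rewrite indicE.
have mid : measurable_fun setT (@idfun (measurableTypeR R)) by exact: measurable_id.
have mc : measurable_fun setT (cst (fine c) : measurableTypeR R -> R) by [].
have c0 (x : measurableTypeR R) : 0 <= cst (fine c) x :> R.
  by rewrite /= fine_ge0// prode_ge0.
(* Independence as an equality of measures: restricted to the event [E] on the other coordinates,
   the law of [eps i] is [c] times the normal law. *)
pose n1 := weighted_law P mX1 mIE IE0.
pose n2 := weighted_law (normal_prob 0 sigma) mid mc c0.
have n12 A : measurable A -> n1 A = n2 A.
  move=> mA; have mXA : measurable (X1 @^-1` A).
    by rewrite -[X in measurable X]setTI; exact: (@measurable_funPT _ _ _ _ (eps i)).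
  rewrite /n1 /n2 /= /weighted_law integral_indic//.
  rewrite (eq_integral (cst c)) => [|x _]; last by rewrite /= fineK.
  rewrite -(fineK cfin) integral_cst// fineK// muleC -PC//; congr (P _).
  apply/seteqP; split => w.
    by move=> [Ew Aw] k; rewrite /C; case: eqP => [->//|/eqP ki]; exact: Ew.
  move=> h; split; last by have := h i; rewrite /C eqxx.
  by move=> k ki; have := h k; rewrite /C (negPf ki).
pose h (x : measurableTypeR R) := ((fun x => (tilt sigma t x)%:E) \_ (B i)) x.
have mh : measurable_fun setT h.
  apply/(measurable_restrictT _ _).1 => //; first exact: mB.
  apply/measurable_EFinP.
  by apply: measurable_funTS; exact: measurable_tilt.
have h0 x : (0 <= h x)%E.
  by rewrite /h patchE; case: ifP => // _; rewrite lee_fin expR_ge0.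
transitivity (\int[n2]_x h x)%E.
  rewrite ge0_integral_weighted_law// [in LHS]integral_mkcond -(fineK cfin).
  by rewrite -ge0_integralZr// lee_fin fine_ge0// prode_ge0.
rewrite (eq_measure_integral n1) => [|A mA _]; last by rewrite -[LHS]/(n2 A) -n12.
rewrite ge0_integral_weighted_law// -[RHS]/(m2v _) /m2v/= /weighted_law [RHS]integral_mkcond.
have weightE w : cm_weight v (noise w) = tilt sigma t (eps i w).
  rewrite /cm_weight /tilt -(dot_sqnorm v) !dotZl !dotZr !dot_delta !mxE !eqxx mulr1 expr2.
  by [].
apply: eq_integral => w _; rewrite /h !patchE weightE.
case: ifPn => [/set_mem hw|hw]; last first.
  rewrite mul0e memNset// => hB; move/negP: hw; apply; apply/mem_set.
  by have := hB i; rewrite mxE.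
rewrite indicE; case: (boolP (w \in E)) => [/set_mem Ew|Ew].
  rewrite mule1 mem_set//= => k; rewrite mxE.
  by have [->|ki] := eqVneq k i; [exact: hw|exact: Ew].
rewrite mule0 memNset// => hB; move/negP: Ew; apply; apply/mem_set => k _.
by have := hB k; rewrite mxE.
Qed.

Lemma shift_formula0 : shift_formula 0.
Proof.
move=> f mf f0; apply: eq_integral => w _.
rewrite addr0 /cm_weight -(dot_sqnorm 0) -(scale0r 0) !dotZl !mul0r subrr expR0.
by rewrite mule1.
Qed.

Lemma cameron_martin v : shift_formula v.
Proof.
have -> : v = \sum_i (v i 0) *: delta_mx i 0.
  apply/matrixP => i j; rewrite ord1 summxE (bigD1 i)//= !mxE !eqxx mulr1 big1 ?addr0// => k ki.
  by rewrite !mxE eq_sym (negPf ki) mulr0.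
apply: big_ind; first exact: shift_formula0.
  exact: shift_formulaD.
by move=> i _; exact: shift_formula_coord.
Qed.

End cameron_martin.

(** * Exponential moments, and Stein's identity from the shift formula *)

Section gaussian_integration_by_parts.
Context {R : realType}.

Lemma normr_expR_sub1 (y : R) : `|expR y - 1| <= `|y| * expR `|y|.
Proof.
have [y0|/ltW y0] := leP 0 y.
  rewrite (ger0_norm y0) ger0_norm; last by rewrite subr_ge0 -expR0 ler_expR.
  have := ler_wpM2r (expR_ge0 y) (expR_ge1Dx (- y)).
  by rewrite -expRD addNr expR0; lra.
rewrite (ler0_norm y0) ler0_norm; last by rewrite subr_le0 expR_le1.
have := expR_ge1Dx y; have := expR_ge1Dx (- y); nra.
Qed.

Lemma le_expR2 (y : R) : y <= expR y.
Proof. by have := expR_ge1Dx y; lra. Qed.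

Lemma is_derive_expR_quad (a b : R) :
  is_derive (0 : R) (1 : R) (fun h => expR (h * a - h ^+ 2 * b)) a.
Proof.
apply: is_derive_eq.
rewrite /GRing.scale/= !mul0r expr0n/= mul0r subr0 expR0; ring.
Qed.

Lemma harmonic_quot_cvg (F : R -> R) (a : R) : is_derive (0 : R) (1 : R) F a ->
  (F m.+1%:R^-1 - F 0) / m.+1%:R^-1 @[m --> \oo] --> a.
Proof.
move=> dF; apply/cvgrPdist_le => e e0.
have [r r0 hr] := is_derive_eps dF e0.
near=> m; have m0 : (0 : R) < m.+1%:R^-1 by rewrite invr_gt0.
have mr : `|m.+1%:R^-1 - 0 : R| < r.
  rewrite subr0 gtr0_norm//; near: m; exact: near_infty_natSinv_lt (PosNum r0).
have := hr _ mr; rewrite subr0 => h.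
rewrite distrC -(ler_pM2r (_ : 0 < `|m.+1%:R^-1 : R|)); last by rewrite normr_gt0 gt_eqF.
by rewrite -normrM mulrBl divfK ?gt_eqF.
Unshelve. all: by end_near. Qed.

Context {d : measure_display} {Omega : measurableType d}.
Variables (P : probability Omega R) (n : nat) (sigma : R).
Variable eps : 'I_n -> {RV P >-> R}.
Hypothesis sigma0 : sigma != 0.
Hypothesis heps : gaussian_noise sigma eps.

Let s2_gt0 : 0 < sigma ^+ 2. Proof. by rewrite exprn_even_gt0. Qed.
Let mnoise := measurable_noise eps.

Let CM v := cameron_martin sigma0 heps v.

Lemma noise_quasi_invariant v (A : set (vec n)) : measurable A ->
  P (noise eps @^-1` A) = 0%E -> P ((fun w => noise eps w + v) @^-1` A) = 0%E.
Proof.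
move=> mA PA.
have mpre : measurable (noise eps @^-1` A).
  by rewrite -[X in measurable X]setTI; exact: mnoise.
have mprev : measurable ((fun w => noise eps w + v) @^-1` A).
  by rewrite -[X in measurable X]setTI; exact: measurable_noiseD.
pose f (x : vec n) := (\1_A x : R)%:E.
have mf : measurable_fun setT f by apply/measurable_EFinP; exact: measurable_indic.
have := CM v mf; rewrite /f => H.
transitivity (\int[P]_w (\1_A (noise eps w + v)%R)%:E)%E.
  by rewrite -[X in (\int[P]_w X w)%E]/(EFin \o \1_((fun w => noise eps w + v) @^-1` A)) integral_indic// setIT.
rewrite H; last by move=> x; rewrite lee_fin indicE.
transitivity (\int[P]_(w in noise eps @^-1` A) (cm_weight sigma v (noise eps w))%:E)%E.
  rewrite [RHS]integral_mkcond; apply: eq_integral => w _; rewrite patchE indicE.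
  case: ifPn => [/set_mem hw|hw]; first by rewrite mem_set// mul1e.
  by rewrite memNset ?mul0e// => h; move/negP: hw; apply; exact/mem_set.
apply: null_set_integral => //.
apply: measurable_funTS; apply/measurable_EFinP.
exact: (measurableT_comp (measurable_cm_weight sigma v) mnoise).
Qed.

(** Up to a constant factor the exponential is [cm_weight] in the direction [sigma^2 u], whose mean
    is 1 by the shift formula for the constant function 1. *)
Lemma integrable_exp_dot (u : 'cV[R]_n) :
  P.-integrable setT (fun w => (expR (dot u (noise eps w)))%:E).
Proof.
have mu : measurable_fun setT (fun w => expR (dot u (noise eps w))).
  by apply: measurableT_comp => //; exact: (measurableT_comp (measurable_dot u) mnoise).
apply/integrableP; split; first exact/measurable_EFinP.
pose v := sigma ^+ 2 *: u.
have cE x : expR (dot u x) = expR (sqnorm v / (2 * sigma ^+ 2)) * cm_weight sigma v x.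
  rewrite /cm_weight -expRD; congr expR; rewrite dotZl mulrAC divff ?gt_eqF// mul1r.
  by rewrite addrC subrK.
under eq_integral => w _.
  rewrite /= ger0_norm ?expR_ge0// cE EFinM.
  over.
have := CM v (f := cst 1%E) (measurable_cst _) => /(_ (fun _ => lee01)) H.
rewrite ge0_integralZl//; last 2 first.
- by apply/measurable_EFinP; exact: (measurableT_comp (measurable_cm_weight sigma v) mnoise).
- by move=> w _; rewrite lee_fin expR_ge0.
rewrite (_ : (\int[P]_w _ = 1)%E); first by rewrite mule1 ltry.
transitivity (\int[P]_w (cst 1 (noise eps w) * (cm_weight sigma v (noise eps w))%:E))%E.
  by apply: eq_integral => w _; rewrite mul1e.
rewrite -H (eq_integral (cst 1%E))// integral_cst// mul1e.
exact: probability_setT.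
Qed.

(** [C |x|_1] is the largest of the [<u_s, x>] over the sign patterns [s], so its exponential is
    below a finite sum of integrable ones. *)
Lemma integrable_exp_l1norm (C : R) : 0 <= C ->
  P.-integrable setT (fun w => (expR (C * l1norm (noise eps w)))%:E).
Proof.
move=> C0.
pose u (s : {ffun 'I_n -> bool}) : 'cV[R]_n := \col_i (C * (-1) ^+ s i).
apply: (@le_integrable _ _ _ _ _ _ _
    (fun w => \sum_s (expR (dot (u s) (noise eps w)))%:E)%E) => //.
- apply/measurable_EFinP; apply: measurableT_comp => //; apply: measurable_funM => //.
  apply: measurable_sum => i; apply: measurableT_comp => //.
  exact: (measurableT_comp (measurable_coord i) mnoise).
- move=> w _; rewrite gee0_abs ?lee_fin ?expR_ge0// gee0_abs; last first.
    by apply: sume_ge0 => s _; rewrite lee_fin expR_ge0.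
  pose s := [ffun i => noise eps w i 0 < 0].
  rewrite (bigD1 s)//= -[leLHS]adde0 leeD//; last first.
    by apply: sume_ge0 => t _; rewrite lee_fin expR_ge0.
  rewrite lee_fin ler_expR /l1norm mulr_sumr ler_sum// => i _.
  by rewrite {1}normrEsign [u s i 0]mxE ffunE mulrA.
- by apply: integrable_sum => // s _; exact: integrable_exp_dot.
Qed.

Lemma cameron_martin_signed v (f : vec n -> R) : measurable_fun setT f ->
  (\int[P]_w (f (noise eps w + v)%R)%:E =
   \int[P]_w (f (noise eps w) * cm_weight sigma v (noise eps w))%:E)%E.
Proof.
move=> mf; rewrite [LHS]integralE [RHS]integralE.
have mp : measurable_fun setT (fun x : vec n => (Num.max (f x) 0)%:E).
  by apply/measurable_EFinP; exact: measurable_maxr.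
have mn : measurable_fun setT (fun x : vec n => (Num.max (- f x) 0)%:E).
  by apply/measurable_EFinP; apply: measurable_maxr => //; exact: measurableT_comp.
have p0 (x : vec n) : (0 <= (Num.max (f x) 0)%:E)%E by rewrite lee_fin le_max lexx orbT.
have n0 (x : vec n) : (0 <= (Num.max (- f x) 0)%:E)%E by rewrite lee_fin le_max lexx orbT.
congr (_ - _)%E.
- transitivity (\int[P]_w (Num.max (f (noise eps w + v)%R) 0)%:E)%E.
    by apply: eq_integral => w _; rewrite funeposE -EFin_max.
  rewrite (CM v mp p0); apply: eq_integral => w _.
  rewrite funeposE -EFinM -EFin_max maxr_pMl ?expR_ge0// mul0r.
  by [].
- transitivity (\int[P]_w (Num.max (- f (noise eps w + v)%R) 0)%:E)%E.
    by apply: eq_integral => w _; rewrite funenegE -EFinN -EFin_max.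
  rewrite (CM v mn n0); apply: eq_integral => w _.
  by rewrite funenegE -EFinM -EFinN -EFin_max maxr_pMl ?expR_ge0// mul0r mulNr.
Qed.

Lemma integrable_exp_growth (K C : R) (f : vec n -> R) : 0 <= C ->
  measurable_fun setT f -> (forall x, `|f x| <= K * expR (C * l1norm (x : 'cV[R]_n))) ->
  P.-integrable setT (fun w => (f (noise eps w))%:E).
Proof.
move=> C0 mf fK.
apply: (@le_integrable _ _ _ _ _ _ _ (fun w => K%:E * (expR (C * l1norm (noise eps w)))%:E)%E) => //.
- by apply/measurable_EFinP; exact: (measurableT_comp mf mnoise).
- move=> w _; rewrite -EFinM lee_fin (le_trans (fK _))//.
  exact: ler_norm.
- by apply: integrableZl => //; exact: integrable_exp_l1norm.
Qed.

Lemma dot_le_l1norm (v : 'cV[R]_n) :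
  exists2 C, 0 <= C & forall x, `|dot v x| <= C * l1norm x.
Proof.
exists (l1norm v) => [|x]; first exact: l1norm_ge0.
rewrite (le_trans (ler_norm_sum _ _ _))// mulr_sumr ler_sum// => i _.
by rewrite normrM ler_wpM2r// coord_le_l1norm.
Qed.

(* Differentiate E f(noise + h v) = E f(noise) cm_weight (h v) at h = 0 along
   h = 1/(m+1), by dominated convergence on both sides. *)
Lemma stein_noise (v : 'cV[R]_n) (f : vec n -> R) (g : Omega -> R) (K C L : R) :
  0 <= K -> 0 <= C -> measurable_fun setT f ->
  (forall x, `|f x| <= K * expR (C * l1norm (x : 'cV[R]_n))) ->
  (forall x h, 0 < h -> `|f ((x : 'cV[R]_n) + h *: v) - f x| <= L * h) ->
  measurable_fun setT g ->
  {ae P, forall w, (f (noise eps w + m.+1%:R^-1 *: v) - f (noise eps w)) / m.+1%:R^-1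
     @[m --> \oo] --> g w} ->
  [/\ P.-integrable setT (fun w => (f (noise eps w) * dot v (noise eps w))%:E),
      P.-integrable setT (fun w => (g w)%:E)
    & (\int[P]_w (f (noise eps w) * dot v (noise eps w))%:E =
       (sigma ^+ 2)%:E * \int[P]_w (g w)%:E)%E].
Proof.
move=> K0 C0 mf fK fL mg fg.
have hpos (m : nat) : (0 : R) < m.+1%:R^-1 by rewrite invr_gt0.
pose h (m : nat) : R := m.+1%:R^-1.
pose D (m : nat) w := (f (noise eps w + h m *: v) - f (noise eps w)) / h m.
have mfn : measurable_fun setT (fun w => f (noise eps w)) by exact: (measurableT_comp mf mnoise).
have mdn : measurable_fun setT (fun w => dot v (noise eps w)).
  exact: (measurableT_comp (measurable_dot v) mnoise).
have mD m : measurable_fun setT (fun w => (D m w)%:E).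
  apply/measurable_EFinP; apply: measurable_funM => //; apply: measurable_funB => //.
  exact: (measurableT_comp mf (measurable_noiseD eps (h m *: v))).
have L0 : 0 <= L.
  by have := fL 0 1 ltr01; rewrite mulr1; apply: le_trans.
have DL m w : `|D m w| <= L.
  by rewrite /D normrM normfV (gtr0_norm (hpos m)) ler_pdivrMr ?hpos// fL ?hpos.
have [gint _ Dcvg] : [/\ P.-integrable setT (fun w => (g w)%:E),
    [sequence \int[P]_w (`|(D m w)%:E - (g w)%:E|)%E]_m @ \oo --> 0%E &
    [sequence \int[P]_w (D m w)%:E]_m @ \oo --> \int[P]_w (g w)%:E]%E.
  apply: (@dominated_convergence _ _ _ _ setT _ (fun m w => (D m w)%:E) _ (cst L%:E)) => //.
  - exact/measurable_EFinP.
  - apply: filterS fg => w hw _; apply: cvg_EFin; [exact: nearW|exact: hw].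
  - exact: (finite_measure_integrable_cst P L).
  - by apply: aeW => w m _; rewrite lee_fin.
(* The difference quotient of the weight at [h = 0]; its limit is [<v, x> / sigma^2]. *)
pose W (m : nat) x := (cm_weight sigma (h m *: v) x - 1) / h m.
pose G (m : nat) w := f (noise eps w) * W m (noise eps w).
pose b := sqnorm v / (2 * sigma ^+ 2).
pose a x := dot v x / sigma ^+ 2.
have b0 : 0 <= b by rewrite divr_ge0 ?sqnorm_ge0// mulr_ge0// ltW.
have wE m x : cm_weight sigma (h m *: v) x = expR (h m * a x - h m ^+ 2 * b).
  rewrite /cm_weight /a /b dotZl -!(dot_sqnorm) dotZl dotZr.
  by congr expR; field.
have [Cv Cv0 hCv] := dot_le_l1norm v.
pose A := Cv / sigma ^+ 2.
have A0 : 0 <= A by rewrite divr_ge0// ltW.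
have aA x : `|a x| <= A * l1norm x.
  by rewrite /a /A normrM (gtr0_norm (_ : 0 < _^-1)) ?invr_gt0// mulrAC ler_pM2r ?invr_gt0.
(* From [|e^y - 1| <= |y| e^|y|], [|y| <= h (b + A |x|_1)] and [t <= e^t]: dividing by [h] leaves a
   bound free of [m]. *)
have WB m x : `|W m x| <= expR (2 * b) * expR (2 * A * l1norm x).
  have h1 : h m <= 1 by rewrite invf_le1 ?ler1n.
  have h0 := hpos m; rewrite -/(h m) in h0.
  rewrite /W wE normrM normfV (gtr0_norm h0) ler_pdivrMr//.
  apply: le_trans (normr_expR_sub1 _) _; rewrite -expRD.
  have yle : `|h m * a x - h m ^+ 2 * b| <= h m * (b + A * l1norm x).
    apply: le_trans (ler_normB _ _) _; rewrite (normrM _ (a x)) (normrM _ b) (ger0_norm b0).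
    rewrite normrX (gtr0_norm h0) mulrDr addrC lerD//; last by rewrite ler_pM2l.
    by rewrite ler_wpM2r// expr2 ger_pMr.
  set y := _ - _ in yle *.
  have Al0 : 0 <= b + A * l1norm x by rewrite addr_ge0// mulr_ge0// l1norm_ge0.
  have yle' : `|y| <= b + A * l1norm x.
    by apply: le_trans yle _; rewrite -[leRHS]mul1r ler_wpM2r.
  rewrite [leRHS](_ : _ = (h m * expR (b + A * l1norm x)) * expR (b + A * l1norm x)); last first.
    rewrite -[RHS]mulrA -expRD mulrC; congr (_ * expR _); ring.
  apply: ler_pM; rewrite ?expR_ge0//.
    by apply: le_trans yle _; rewrite ler_pM2l// le_expR2.
  by rewrite ler_expR.
have mW m : measurable_fun setT (fun w => W m (noise eps w)).
  apply: measurable_funM => //; apply: measurable_funB => //.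
  exact: (measurableT_comp (measurable_cm_weight sigma _) mnoise).
have fint : P.-integrable setT (fun w => (f (noise eps w))%:E).
  exact: (integrable_exp_growth C0 mf fK).
pose bound w := (K * expR (2 * b) * expR ((C + 2 * A) * l1norm (noise eps w)))%:E.
have boundint : P.-integrable setT bound.
  rewrite (_ : bound = (fun w => (K * expR (2 * b))%:E *
    (expR ((C + 2 * A) * l1norm (noise eps w)))%:E)%E); last by apply/funext => w; rewrite -EFinM.
  by apply: integrableZl => //; apply: integrable_exp_l1norm; rewrite addr_ge0// mulr_ge0.
have Gbound m w :
    `|G m w| <= K * expR (2 * b) * expR ((C + 2 * A) * l1norm (noise eps w)).
  rewrite /G normrM [(C + 2 * A) * _]mulrDl [expR (C * _ + _)]expRD.
  rewrite [leRHS](_ : _ = (K * expR (C * l1norm (noise eps w))) *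
    (expR (2 * b) * expR (2 * A * l1norm (noise eps w)))); last by ring.
  by apply: ler_pM.
have [Fint _ Gcvg] : [/\ P.-integrable setT (fun w => (f (noise eps w) * a (noise eps w))%:E),
    [sequence \int[P]_w (`|(G m w)%:E - (f (noise eps w) * a (noise eps w))%:E|)%E]_m @ \oo --> 0%E &
    [sequence \int[P]_w (G m w)%:E]_m @ \oo --> \int[P]_w (f (noise eps w) * a (noise eps w))%:E]%E.
  apply: (@dominated_convergence _ _ _ _ setT _ (fun m w => (G m w)%:E) _ bound) => //.
  - by move=> m; apply/measurable_EFinP; exact: measurable_funM.
  - apply/measurable_EFinP; apply: measurable_funM => //.
    exact: measurable_funM.
  - apply: aeW => w _; apply: cvg_EFin; first exact: nearW.
    apply: cvgM; first exact: cvg_cst.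
    have := harmonic_quot_cvg (is_derive_expR_quad (a (noise eps w)) b).
    rewrite !mul0r expr0n mul0r subrr expR0.
    by under eq_fun do rewrite -/(h _) -wE.
  - by apply: aeW => w m _; rewrite lee_fin.
have DG m : (\int[P]_w (D m w)%:E = \int[P]_w (G m w)%:E)%E.
  have h0 : h m != 0 by rewrite gt_eqF// hpos.
  have Gint : P.-integrable setT (fun w => (G m w)%:E).
    apply: (le_integrable _ _ _ boundint) => //.
      by apply/measurable_EFinP; exact: measurable_funM.
    by move=> w _; rewrite lee_fin (le_trans (Gbound m w))// ler_norm.
  have Dint : P.-integrable setT (fun w => (D m w)%:E).
    apply: (le_integrable _ _ _ (finite_measure_integrable_cst P L measurableT)) => //.
    by move=> w _; rewrite lee_fin (le_trans (DL m w))// ler_norm.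
  (* The shift formula equates the integrals of [h D + f] and [h G + f]; the finite integral of [f]
     and the factor [h] are then cancelled. *)
  have addh (F : Omega -> R) : P.-integrable setT (fun w => (F w)%:E) ->
      (\int[P]_w (h m * F w + f (noise eps w))%:E =
       (h m)%:E * \int[P]_w (F w)%:E + \int[P]_w (f (noise eps w))%:E)%E.
    move=> intF; under eq_integral do rewrite EFinD EFinM.
    by rewrite integralD// ?integralZl//; exact: integrableZl.
  have fin F : P.-integrable setT F -> (\int[P]_w F w)%E \is a fin_num.
    by move=> intF; exact: integrable_fin_num.
  have E : ((h m)%:E * \int[P]_w (D m w)%:E + \int[P]_w (f (noise eps w))%:E =
      (h m)%:E * \int[P]_w (G m w)%:E + \int[P]_w (f (noise eps w))%:E)%E.
    rewrite -!addh//; transitivity (\int[P]_w (f (noise eps w + h m *: v)%R)%:E)%E.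
      by apply: eq_integral => w _; congr EFin; rewrite /D mulrC divfK// subrK.
    rewrite cameron_martin_signed//; apply: eq_integral => w _; congr EFin.
    by rewrite /G /W mulrCA [h m * _]mulrC divfK// mulrBr mulr1 subrK.
  move: E; rewrite -(fineK (fin _ Dint)) -(fineK (fin _ Gint)) -(fineK (fin _ fint)).
  by move=> [/addIr /(mulfI h0) ->].
have lim_eq : (\int[P]_w (g w)%:E = \int[P]_w (f (noise eps w) * a (noise eps w))%:E)%E.
  move: Gcvg; under eq_fun do rewrite -DG.
  by move=> Gcvg; apply: (cvg_unique _ Dcvg Gcvg).
have faE w : (f (noise eps w) * dot v (noise eps w))%:E =
    ((sigma ^+ 2)%:E * (f (noise eps w) * a (noise eps w))%:E)%E.
  by rewrite -EFinM /a; congr EFin; field.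
split => //.
  under eq_fun do rewrite faE.
  exact: integrableZl.
under eq_integral do rewrite faE.
by rewrite integralZl// lim_eq.
Qed.

End gaussian_integration_by_parts.

(** * Almost sure regularity *)

Section line_null.
Context {R : realType} {d : measure_display} {Omega : measurableType d}.
Variables (P : probability Omega R) (n : nat) (sigma : R).
Variable eps : 'I_n -> {RV P >-> R}.
Hypothesis sigma0 : sigma != 0.
Hypothesis heps : gaussian_noise sigma eps.
Notation mu := (@lebesgue_measure R).

(* Fubini on P x Lebesgue shows that the noise shifted along some multiple of u
   avoids A almost surely; quasi-invariance undoes the shift. *)
Lemma line_null (u : 'cV[R]_n) (A : set (vec n)) : measurable A ->
  (forall x : 'cV[R]_n, mu [set s : R | A (x + s *: u)] = 0) ->
  P (noise eps @^-1` A) = 0%E.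
Proof.
move=> mA hA.
pose T (ws : Omega * measurableTypeR R) : vec n := noise eps ws.1 + (ws.2 : R) *: u.
have mT : measurable_fun setT T.
  apply: measurable_to_vec => i.
  rewrite (_ : (fun t => _) = (fun t => eps i t.1 + (t.2 : R) * u i 0)); last first.
    by apply/funext => t; rewrite !mxE.
  apply: measurable_funD.
    by apply: (measurableT_comp (@measurable_funPT _ _ _ _ (eps i))); exact: measurable_fst.
  by apply: measurable_funM => //; exact: measurable_snd.
pose f ws := (\1_A (T ws) : R)%:E.
have mf : measurable_fun setT f.
  by apply/measurable_EFinP; apply: (measurableT_comp _ mT); exact: measurable_indic.
have f0 ws : (0 <= f ws)%E by rewrite lee_fin indicE.
have := fubini_tonelli (m1 := P) (m2 := mu) f mf f0.
have mE s : measurable [set w | A (noise eps w + s *: u)].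
  by rewrite -[X in measurable X]setTI; exact: (measurable_noiseD eps (s *: u)).
have PE s : (\int[P]_w f (w, s) = P [set w | A (noise eps w + s *: u)%R])%E.
  by rewrite -[X in P X]setIT -integral_indic.
have muE w : (\int[mu]_s f (w, s) = 0)%E.
  have mL : measurable [set s : measurableTypeR R | A (noise eps w + s *: u)].
    rewrite -[X in measurable X]setTI.
    by apply: (measurableT_comp mT (measurable_pair1 w)).
  by rewrite -[RHS](hA (noise eps w)) -[X in mu X]setIT -integral_indic.
rewrite (eq_integral (cst 0%E)) => [|w _]; last exact: muE.
rewrite integral0 => /esym.
rewrite (eq_integral (fun s : measurableTypeR R => P [set w | A (noise eps w + s *: u)%R])) => [|s _]; last exact: PE.
move=> int0.
have mG : measurable_fun setT (fun s : measurableTypeR R => P [set w | A (noise eps w + s *: u)]).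
  rewrite (_ : (fun _ => _) = fubini_G P f); last by apply/funext => s; rewrite -PE.
  exact: (measurable_fun_fubini_tonelli_G f mf f0).
(* Were all these probabilities nonzero, their integral over [s] could vanish only if the line had
   Lebesgue measure 0. *)
have [s Ps] : exists s : R, P [set w | A (noise eps w + s *: u)] = 0%E.
  apply: contrapT => /forallNP hs.
  have /ae_eq_integral_abs : (\int[mu]_(s in setT) `|P [set w | A (noise eps w + s *: u)%R]| = 0)%E.
    by rewrite -[RHS]int0; apply: eq_integral => s _; rewrite gee0_abs.
  move=> /(_ measurableT mG) [N [mN muN hN]].
  have : mu setT = 0%E.
    apply/eqP; rewrite eq_le measure_ge0 andbT -muN; apply: le_measure; rewrite ?inE//.
    by move=> s _; apply: hN => /= h; exact: (hs s (h I)).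
  by rewrite -set_itvNyy lebesgue_measure_itv.
have mA' : measurable [set x : vec n | A ((x : 'cV[R]_n) + s *: u)].
  rewrite -[X in measurable X]setTI.
  exact: (measurable_translate (s *: u)).
have := @noise_quasi_invariant _ _ _ P n sigma eps sigma0 heps (- (s *: u)) _ mA' Ps.
congr (P _ = _); apply/seteqP; split => w /=; rewrite subrK//.
Qed.

End line_null.

Section ae_regular.
Context {R : realType} {d : measure_display} {Omega : measurableType d}.
Variables (P : probability Omega R) (n p : nat) (sigma : R).
Variable eps : 'I_n -> {RV P >-> R}.
Variables (rho ddrho : R -> R -> R) (lam k m : R) (S : 'M[R]_p).
Variables (Lam : 'M[R]_(p, n)) (U : 'M[R]_(n, p)) (Z B : 'cV[R]_n -> 'cV[R]_p).
Hypothesis heps : gaussian_noise sigma eps.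
Hypothesis lam_gt0 : 0 < lam.
Hypothesis pen : penalty rho ddrho lam.
Let phi := drho rho lam.
Hypothesis hk : forall s t, 0 < s -> s <= t -> phi s - phi t <= k * (t - s).
Hypothesis k_lt_m : k < m.
Hypothesis S_coercive : forall v, m * sqnorm v <= dot v (S *m v).
Hypothesis ZD : forall x v, Z (x + v) = Z x + Lam *m v.
Hypothesis LamU : Lam *m U = 1%:M.
Hypothesis ZB : forall x, kkt S phi lam (Z x) (B x).
Notation mu := (@lebesgue_measure R).

Let phi0 := slope0_cvg pen hk.
Let c := m - k.

Lemma solution_lipschitz : exists2 L, 0 <= L & forall x y j,
  `|B x j 0 - B y j 0| <= L * l1norm (x - y).
Proof.
have [L L0 hL] := l1norm_mulmx Lam.
have c0 : 0 < c by rewrite subr_gt0.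
exists (c^-1 * L) => [|x y j]; first by rewrite mulr_ge0// invr_ge0 ltW.
have := kkt_coord_lipschitz lam_gt0 hk phi0 k_lt_m S_coercive j (ZB x) (ZB y).
move=> /le_trans; apply; rewrite -mulrA ler_pM2l ?invr_gt0//.
have -> : Z x - Z y = Lam *m (x - y).
  by rewrite -{1}(subrKC y x) ZD addrAC subrr add0r.
exact: hL.
Qed.

Lemma measurable_solution j : measurable_fun setT (fun x : vec n => B x j 0).
Proof.
have [L L0 hL] := solution_lipschitz.
by apply: (@lipschitz_measurable _ _ _ L) => x y; exact: hL.
Qed.

Let g j x := (Z x - S *m B x) j 0.

Lemma measurable_residual j : measurable_fun setT (g j : vec n -> R).
Proof.
have mZ i : measurable_fun setT (fun x : vec n => Z x i 0).
  have [L L0 hL] := l1norm_mulmx Lam.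
  apply: (@lipschitz_measurable _ _ _ L) => x y.
  have : Z x - Z y = Lam *m (x - y).
    by rewrite -{1}(subrKC y x) ZD addrAC subrr add0r.
  move/(congr1 (fun M : 'cV[R]_p => M i 0)); rewrite [LHS]mxE [X in _ + X]mxE => ->.
  by apply: le_trans (hL _); exact: coord_le_l1norm.
rewrite (_ : g j = fun x => Z x j 0 - \sum_i S j i * B x i 0); last first.
  by apply/funext => x; rewrite /g !mxE.
apply: measurable_funB => //; apply: measurable_sum => i.
by apply: measurable_funM => //; exact: measurable_solution.
Qed.

(* Since Lam U = 1, moving the noise along the j-th column of U moves z = X'y/n in
   its j-th coordinate only. *)
Let line (x : 'cV[R]_n) j s : Z (x + s *: col j U) = Z x + s *: delta_mx j 0.
Proof. by rewrite ZD -scalemxAr colE mulmxA LamU mul1mx. Qed.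

(** At both points [b_j = 0], so the coercivity pairing [(s - t) (b_j - b'_j)] vanishes and the two
    solutions coincide; the residuals then differ by exactly [s - t]. *)
Lemma boundary_line j (a : R) (x : 'cV[R]_n) (s t : R) :
  B (x + s *: col j U) j 0 = 0 -> g j (x + s *: col j U) = a ->
  B (x + t *: col j U) j 0 = 0 -> g j (x + t *: col j U) = a -> s = t.
Proof.
move=> bs gs bt gt.
have := ZB (x + s *: col j U); have := ZB (x + t *: col j U).
rewrite !line => kt ks.
have c0 : 0 < c by rewrite subr_gt0.
have := kkt_coercive lam_gt0 hk phi0 S_coercive ks kt.
set b := B _; set b' := B _.
rewrite [X in dot X _](_ : _ = (s - t) *: delta_mx j 0); last first.
  by rewrite opprD addrACA subrr add0r -scalerBl.
rewrite dotZl dot_delta !mxE bs bt subrr mulr0 pmulr_rle0 ?subr_gt0// => n0.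
have /sqnorm_eq0/eqP : sqnorm (b - b') = 0 by apply/eqP; rewrite eq_le n0 sqnorm_ge0.
rewrite subr_eq0 => /eqP bE.
move: gs gt; rewrite /g !line -/b -/b' bE !mxE !eqxx /= !mulr1; lra.
Qed.

Hypothesis sigma0 : sigma != 0.

Lemma ae_boundary j (a : R) :
  P [set w | B (noise eps w) j 0 = 0 /\ g j (noise eps w) = a] = 0%E.
Proof.
pose A : set (vec n) := [set x : 'cV[R]_n | B x j 0 = 0 /\ g j x = a].
have mA : measurable A.
  rewrite (_ : A = ((fun x : vec n => B x j 0) @^-1` [set 0]) `&` ((g j : vec n -> R) @^-1` [set a]))//.
  apply: measurableI; rewrite -[X in measurable X]setTI.
    exact: (measurable_solution j).
  exact: (measurable_residual j).
apply: (line_null sigma0 heps (u := col j U) mA) => x.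
have [[s [bs gs]]|none] := pselect (exists s : R, A (x + s *: col j U)).
  rewrite (_ : [set s : R | _] = [set s]) ?lebesgue_measure_set1//.
  apply/seteqP; split => t /=; last by move=> ->.
  by move=> [bt gt]; exact: (boundary_line bt gt bs gs).
rewrite (_ : [set s : R | _] = set0) ?measure0//.
by apply/seteqP; split => // s As; apply: none; exists s.
Qed.

Lemma solution_nondecreasing j (z : 'cV[R]_p) (b : R -> 'cV[R]_p) :
  (forall s, kkt S phi lam (z + s *: delta_mx j 0) (b s)) ->
  nondecreasing_fun (fun s => b s j 0).
Proof.
move=> hb s t; rewrite le_eqVlt => /predU1P[->//|st].
have c0 : 0 < c by rewrite subr_gt0.
have := kkt_coercive lam_gt0 hk phi0 S_coercive (hb t) (hb s).
rewrite opprD addrACA subrr add0r -scalerBl dotZl dot_delta => h.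
have : 0 <= (t - s) * (b t - b s) j 0.
  by apply: le_trans h; rewrite mulr_ge0 ?sqnorm_ge0// ltW.
by rewrite pmulr_rge0 ?subr_gt0// !mxE subr_ge0.
Qed.

Lemma level_line_null j (z : 'cV[R]_p) (b : R -> 'cV[R]_p) (N : set R) :
  (forall s, kkt S phi lam (z + s *: delta_mx j 0) (b s)) ->
  measurable N -> N `<=` `]0, +oo[ -> mu N = 0 ->
  mu [set s | N (b s j 0)] = 0.
Proof.
move=> hb mN N0 muN.
have [K K0 hK] := kkt_line lam_gt0 hk phi0 k_lt_m S_coercive j.
have nd := solution_nondecreasing hb.
apply: (preimage_null pen (beta := fun s => b s j 0) K0 nd) => // s t st bs.
apply: hK (hb s) _ bs (nd _ _ st).
by rewrite -addrA -scalerDl (addrC s) subrK; exact: hb.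
Qed.

Lemma ae_level j (N : set R) : measurable N -> N `<=` `]0, +oo[ -> mu N = 0 ->
  P [set w | N `|B (noise eps w) j 0|] = 0%E.
Proof.
move=> mN N0 muN.
pose A : set (vec n) := [set x : 'cV[R]_n | N `|B x j 0|].
have mA : measurable A.
  rewrite (_ : A = ((fun x : vec n => `|B x j 0|) @^-1` N))//.
  rewrite -[X in measurable X]setTI.
  by apply: (measurableT_comp _ (measurable_solution j)).
apply: (line_null sigma0 heps (u := col j U) mA) => x.
pose b s := B (x + s *: col j U).
have hb s : kkt S phi lam (Z x + s *: delta_mx j 0) (b s) by rewrite -line; exact: ZB.
(* Reversing both the line and the sign gives a solution path starting from [- Z x], which reduces
   negative values of [b_j] to positive ones. *)
pose b' s := - b (- s).
have hb' s : kkt S phi lam (- Z x + s *: delta_mx j 0) (b' s).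
  by rewrite -[s in s *: _]opprK scaleNr -opprD; apply: kktN; exact: hb.
have mline (v : R -> 'cV[R]_p) z : (forall s, kkt S phi lam (z + s *: delta_mx j 0) (v s)) ->
    measurable [set s : measurableTypeR R | N (v s j 0)].
  move=> hv; have nd := solution_nondecreasing hv.
  rewrite -[X in measurable X]setTI.
  exact: (nondecreasing_measurable measurableT nd).
have mb := mline _ _ hb; have mb' := mline _ _ hb'.
pose A1 : set (measurableTypeR R) := [set s | N (b s j 0)].
pose A2 : set (measurableTypeR R) := -%R @^-1` [set s | N (b' s j 0)].
have A10 : mu A1 = 0 by exact: (level_line_null hb).
have mA2 : measurable A2.
  rewrite -[X in measurable X]setTI.
  by apply: (measurable_funN (@measurable_id _ (measurableTypeR R) setT)).
have A20 : mu A2 = 0.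
  by rewrite -[LHS]/(pushforward mu (-%R : _ -> measurableTypeR R) _) lebesgue_measureN// (level_line_null hb').
have sub : [set s : R | A (x + s *: col j U)] `<=` A1 `|` A2.
  move=> s; rewrite /A /= -/(b s) => Nb.
  have [b0|b0] := leP 0 (b s j 0); first by left; move: Nb; rewrite ger0_norm.
  by right; rewrite /A2 /= /b' opprK mxE; move: Nb; rewrite ltr0_norm.
apply: (subset_measure0 (mu := mu) _ _ sub).
- rewrite -[X in measurable X]setTI.
  have : measurable_fun setT ((fun s => x + s *: col j U) : measurableTypeR R -> vec n).
    apply: measurable_to_vec => i.
    rewrite (_ : (fun t => _) = (fun t => x i 0 + t * col j U i 0)); last first.
      by apply/funext => t; rewrite !mxE.
    by apply: measurable_funD => //; exact: measurable_funM.
  by apply.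
- exact: measurableU.
- by apply: null_set_setU.
Qed.

(** By stationarity a zero coordinate fails strictness only with residual [lam] or [- lam], and a
    nonzero one is irregular only when [|b_j|] lies in the null set left by [ae_slope_derive]. These
    are finitely many null events. *)
Lemma ae_regular : {ae P, forall w,
  regular_pt S phi (ddrho ^~ lam) lam (Z (noise eps w)) (B (noise eps w))}.
Proof.
apply: filter_forall => j.
have [N0 [mN0 muN0 hN0]] := ae_slope_derive pen.
pose N : set R := N0 `&` `]0, +oo[.
have mN : measurable N by apply: measurableI => //; exact: mN0.
have muN : mu N = 0.
  by apply: (subset_measure0 (mu := mu) _ _ _ muN0) => //; exact: subIsetl.
pose E a := [set w | B (noise eps w) j 0 = 0 /\ g j (noise eps w) = a].
pose F := [set w | N `|B (noise eps w) j 0|].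
have mB : measurable_fun setT (fun w => B (noise eps w) j 0).
  exact: (measurableT_comp (measurable_solution j) (measurable_noise eps)).
have mg : measurable_fun setT (fun w => g j (noise eps w)).
  exact: (measurableT_comp (measurable_residual j) (measurable_noise eps)).
have mE a : measurable (E a).
  rewrite (_ : E a = ((fun w => B (noise eps w) j 0) @^-1` [set 0]) `&`
    ((fun w => g j (noise eps w)) @^-1` [set a]))//.
  by apply: measurableI; rewrite -[X in measurable X]setTI; [exact: mB|exact: mg].
have mF : measurable F.
  rewrite -[X in measurable X]setTI.
  by apply: (measurableT_comp (f := fun x : R => `|x|) _ mB).
exists (E lam `|` E (- lam) `|` F); split.
- by apply: measurableU => //; exact: measurableU.
- apply: null_set_setU => //; first exact: measurableU.
    by apply: null_set_setU => //; exact: ae_boundary.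
  by apply: ae_level => //; exact: subIsetr.
- move=> w /=; apply: contra_notP => /not_orP[/not_orP[h1 h2] h3].
  have := ZB (noise eps w) j; rewrite /subgrad; case: ifPn => [/eqP b0 gl|b0 _].
    rewrite lt_neqAle gl andbT; apply/negP; rewrite eqr_norml.
    by move=> /andP[/orP[/eqP gE|/eqP gE] _]; [apply: h1|apply: h2].
  apply: contrapT => nd; apply: h3; split.
    by apply: hN0 => /= /(_ _); rewrite normr_gt0 => /(_ b0).
  by rewrite /= in_itv/= andbT normr_gt0.
Qed.

End ae_regular.

(** * The inverse Hessian *)

Section inverse_hessian.
Context {R : realType}.
Variables (n p : nat) (X : 'M[R]_(n, p)) (ddrho : R -> R -> R) (lam : R).

(** [Pmx] for an arbitrary index set: its dimensions no longer depend on a vector b, as is needed to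
    speak of measurability in b. *)
Definition selector (A : {set 'I_p}) : 'M[R]_(#|A|, p) :=
  rowsub (fun i => enum_val i) 1%:M.

Definition hessian (b : 'cV[R]_p) : 'M[R]_p :=
  gram X + diag_mx (\row_j ddrho `|b j 0| lam).

Definition inv_hessian_on (A : {set 'I_p}) (b : 'cV[R]_p) : 'M[R]_p :=
  (selector A)^T *m invmx (selector A *m hessian b *m (selector A)^T) *m selector A.

(* When Qmx is singular, invmx Qmx is Qmx itself. *)
Definition inv_hessian (b : 'cV[R]_p) : 'M[R]_p :=
  (Pmx b)^T *m invmx (Qmx X ddrho b lam) *m Pmx b.

Lemma selectorE (A : {set 'I_p}) (v : 'cV[R]_p) i : (selector A *m v) i 0 = v (enum_val i) 0.
Proof.
rewrite mxE (bigD1 (enum_val i))//= !mxE eqxx mul1r big1 ?addr0// => j ji.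
by rewrite !mxE eq_sym (negPf ji) mul0r.
Qed.

Lemma selectorK (A : {set 'I_p}) : selector A *m (selector A)^T = 1%:M.
Proof.
apply/matrixP => i j; rewrite mxE (bigD1 (enum_val i))//= !mxE eqxx mul1r big1 ?addr0.
  by rewrite (inj_eq enum_val_inj) eq_sym.
by move=> l li; rewrite !mxE eq_sym (negPf li) mul0r.
Qed.

Lemma selector_trE (A : {set 'I_p}) (v : 'cV[R]_#|A|) j : j \notin A -> ((selector A)^T *m v) j 0 = 0.
Proof.
move=> jA; rewrite mxE big1// => i _; rewrite !mxE.
case: eqP => [ij|_]; last by rewrite mul0r.
by move: jA; rewrite -ij enum_valP.
Qed.

Lemma QmxE b : Qmx X ddrho b lam =
  selector (supp b) *m hessian b *m (selector (supp b))^T.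
Proof.
apply/matrixP => i j; rewrite /hessian mulmxDr mulmxDl [RHS]mxE [LHS]mxE.
have subE (C : 'M[R]_p) :
    (selector (supp b) *m C *m (selector (supp b))^T) i j = C (enum_val i) (enum_val j).
  rewrite -mulmxA mxE (bigD1 (enum_val i))//= big1 => [|l li]; last first.
    by rewrite [selector _ _ _]mxE mxE eq_sym (negPf li) mul0r.
  rewrite addr0 [selector _ _ _]mxE mxE eqxx mul1r mxE (bigD1 (enum_val j))//= big1.
    by rewrite !mxE eqxx mulr1 addr0.
  by move=> l lj; rewrite !mxE eq_sym (negPf lj) mulr0.
rewrite !subE; congr (_ + _); first by rewrite mxE.
by rewrite !mxE (inj_eq enum_val_inj).
Qed.

Lemma inv_hessianE b : inv_hessian b = inv_hessian_on (supp b) b.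
Proof. by rewrite /inv_hessian QmxE. Qed.

Lemma gram_sym : (gram X)^T = gram X.
Proof. by rewrite /gram linearZ/= trmx_mul trmxK. Qed.

Lemma hessian_sym b : (hessian b)^T = hessian b.
Proof. by rewrite /hessian linearD/= gram_sym tr_diag_mx. Qed.

Lemma inv_hessian_sym b : (inv_hessian b)^T = inv_hessian b.
Proof.
by rewrite inv_hessianE /inv_hessian_on !trmx_mul trmxK trmx_inv !trmx_mul trmxK hessian_sym !mulmxA.
Qed.

Lemma mxtrace_inv_hessian b : \tr (inv_hessian b) = \tr (invmx (Qmx X ddrho b lam)).
Proof.
rewrite /inv_hessian -mulmxA mxtrace_mulC -mulmxA.
by rewrite [Pmx b *m _](_ : _ = 1%:M) ?mulmx1//; exact: selectorK.
Qed.

Lemma quad_inv_hessian b (a : 'cV[R]_p) :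
  ((Pmx b *m a)^T *m invmx (Qmx X ddrho b lam) *m (Pmx b *m a)) 0 0 =
  dot a (inv_hessian b *m a).
Proof. by rewrite -dot_mx /inv_hessian trmx_mul !mulmxA. Qed.

Lemma inv_hessian_off (b : 'cV[R]_p) (r : 'cV[R]_p) j : b j 0 = 0 -> (inv_hessian b *m r) j 0 = 0.
Proof.
move=> bj; rewrite inv_hessianE /inv_hessian_on -!mulmxA selector_trE//.
by rewrite inE bj eqxx.
Qed.

Variables (m k : R).
Hypothesis k_lt_m : k < m.
Hypothesis gram_coercive : forall v, m * sqnorm v <= dot v (gram X *m v).

Lemma hessian_coercive (b w : 'cV[R]_p) :
  (forall j, b j 0 != 0 -> - k <= ddrho `|b j 0| lam) ->
  (forall j, b j 0 = 0 -> w j 0 = 0) ->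
  (m - k) * sqnorm w <= dot w (hessian b *m w).
Proof.
move=> hdd w0; rewrite /hessian mulmxDl dotDr mulrBl lerD//.
rewrite /sqnorm mulr_sumr -sumrN; apply: ler_sum => j _.
rewrite mul_diag_mx !mxE [leRHS]mulrCA -expr2.
have [bj|bj] := eqVneq (b j 0) 0; first by rewrite w0// expr0n !mulr0 oppr0.
by rewrite -mulNr ler_wpM2r ?sqr_ge0// hdd.
Qed.

(** A kernel vector, extended by 0 off the support, makes the quadratic form of [hessian] vanish, so
    coercivity forces it to be 0. *)
Lemma Qmx_unit (b : 'cV[R]_p) : (forall j, b j 0 != 0 -> - k <= ddrho `|b j 0| lam) ->
  Qmx X ddrho b lam \in unitmx.
Proof.
move=> hdd; rewrite -unitmx_tr -row_free_unit -kermx_eq0; apply/eqP/row_matrixP => i.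
rewrite row0; set v := row i _.
have /sub_kermxP vQ : (v <= kermx (Qmx X ddrho b lam)^T)%MS by exact: row_sub.
have {}vQ : Qmx X ddrho b lam *m v^T = 0.
  by rewrite -[LHS]trmxK trmx_mul trmxK vQ trmx0.
pose w := (selector (supp b))^T *m v^T.
have w0 j : b j 0 = 0 -> w j 0 = 0.
  by move=> bj; apply: selector_trE; rewrite inE bj eqxx.
have := hessian_coercive hdd w0.
have -> : dot w (hessian b *m w) = 0.
  rewrite /w -dot_mulmx !mulmxA -QmxE vQ.
  by apply: big1 => l _; rewrite [X in _ * X]mxE mulr0.
have -> : sqnorm w = sqnorm v^T.
  by rewrite -!dot_sqnorm /w -dot_mulmx mulmxA selectorK mul1mx.
rewrite pmulr_rle0 ?subr_gt0// => v0.
have /sqnorm_eq0 vT0 : sqnorm v^T = 0 by apply/eqP; rewrite eq_le v0 sqnorm_ge0.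
by rewrite -[v]trmxK vT0 trmx0.
Qed.

(** Together with [inv_hessian_off] this supplies the two conditions on [w] in [kkt_derivative]. *)
Lemma inv_hessian_on_supp (b r : 'cV[R]_p) j :
  Qmx X ddrho b lam \in unitmx -> b j 0 != 0 ->
  (gram X *m (inv_hessian b *m r)) j 0 +
    ddrho `|b j 0| lam * (inv_hessian b *m r) j 0 = r j 0.
Proof.
move=> Qu bj; have jA : j \in supp b by rewrite inE.
set w := inv_hessian b *m r.
have -> : (gram X *m w) j 0 + ddrho `|b j 0| lam * w j 0 = (hessian b *m w) j 0.
  by rewrite /hessian mulmxDl [RHS]mxE; congr (_ + _); rewrite mul_diag_mx [RHS]mxE [X in _ = X * _]mxE.
have := selectorE (hessian b *m w) (enum_rank_in jA j); rewrite enum_rankK_in// => <-.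
have := selectorE r (enum_rank_in jA j); rewrite enum_rankK_in// => <-.
congr (fun_of_matrix _ _ _).
rewrite /w inv_hessianE /inv_hessian_on -QmxE !mulmxA -QmxE mulmxV// mul1mx.
by [].
Qed.

End inverse_hessian.

(** * Measurability of the inverse Hessian *)

Section measurable_inv_hessian.
Context {R : realType} {d : measure_display} {T : measurableType d}.

Lemma measurable_inv (f : T -> R) : measurable_fun setT f ->
  measurable_fun setT (fun t => (f t)^-1).
Proof.
(* At a zero of [f] the product is 0, which is also the conventional inverse of 0. *)
move=> mf; rewrite (_ : (fun t => _) = fun t => f t * expR (- ln (f t ^+ 2))); last first.
  apply/funext => t; have [->|f0] := eqVneq (f t) 0; first by rewrite invr0 mul0r.
  by rewrite expRN lnK ?posrE ?exprn_even_gt0// expr2 invfM mulVKf.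
apply: measurable_funM => //; apply: measurableT_comp => //.
apply: measurableT_comp => //; apply: measurableT_comp => //.
exact: measurable_funX.
Qed.

Lemma measurable_mulmx m n p (F : T -> 'M[R]_(m, n)) (G : T -> 'M[R]_(n, p)) :
  (forall i j, measurable_fun setT (fun t => F t i j)) ->
  (forall i j, measurable_fun setT (fun t => G t i j)) ->
  forall i j, measurable_fun setT (fun t => (F t *m G t) i j).
Proof.
move=> mF mG i j.
rewrite (_ : (fun t => _) = fun t => \sum_l F t i l * G t l j).
  by apply: measurable_sum => l; exact: measurable_funM.
by apply/funext => t; rewrite mxE.
Qed.

Lemma measurable_det n (F : T -> 'M[R]_n) :
  (forall i j, measurable_fun setT (fun t => F t i j)) ->
  measurable_fun setT (fun t => \det (F t)).
Proof.
move=> mF; apply: measurable_sum => s; apply: measurable_funM => //.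
by apply: measurable_prod => i _; exact: mF.
Qed.

(** Cramer's rule where the determinant is nonzero; elsewhere [invmx] returns the matrix itself. *)
Lemma measurable_invmx n (F : T -> 'M[R]_n) :
  (forall i j, measurable_fun setT (fun t => F t i j)) ->
  forall i j, measurable_fun setT (fun t => invmx (F t) i j).
Proof.
move=> mF i j.
rewrite (_ : (fun t => _) = fun t => if \det (F t) == 0 then F t i j
    else (\det (F t))^-1 * cofactor (F t) j i); last first.
  apply/funext => t; rewrite /invmx unitmxE unitfE.
  by case: eqP => //= _; rewrite !mxE.
have mdet := measurable_det mF.
apply: measurable_fun_ifT => //; first exact: measurable_fun_eqr.
apply: measurable_funM; first exact: measurable_inv.
apply: measurable_funM => //; apply: measurable_det => k l.
by rewrite (_ : (fun t => _) = fun t => F t (lift j k) (lift i l))//; apply/funext => t; rewrite !mxE.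
Qed.

Variables (n p : nat) (X : 'M[R]_(n, p)) (rho ddrho : R -> R -> R) (lam : R).
Hypothesis pen : penalty rho ddrho lam.

Lemma measurable_ddrho : measurable_fun (`]0, +oo[%classic : set R) (ddrho ^~ lam).
Proof.
have -> : [set` `]0, +oo[] = \bigcup_k [set` `[(k.+1%:R : R)^-1, k.+1%:R]] :> set R.
  apply/seteqP; split => t /=.
    rewrite in_itv/= andbT => t0.
    pose N := maxn (Num.truncn t) (Num.truncn t^-1).
    have tn x : x = t \/ x = t^-1 -> x <= N.+1%:R.
      move=> xE; apply/ltW; apply: lt_le_trans (truncnS_gt x) _.
      by rewrite ler_nat ltnS leq_max; case: xE => ->; rewrite leqnn ?orbT.
    exists N => //=; rewrite in_itv/=; apply/andP; split; last by apply: tn; left.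
    by rewrite invf_ple ?posrE//; apply: tn; right.
  by move=> [k _]; rewrite /= !in_itv/= andbT => /andP[+ _]; apply: lt_le_trans; rewrite invr_gt0.
apply/measurable_fun_bigcup => [k|k]; first exact: measurable_itv.
have k0 : (0 : R) < k.+1%:R^-1 by rewrite invr_gt0.
have k1 : (k.+1%:R : R)^-1 <= k.+1%:R.
  by apply: (@le_trans _ _ 1); rewrite ?invf_le1 ?ler1n.
by have /measurable_int/measurable_EFinP := penalty_ddrho_integrable pen k0 k1.
Qed.

Variable b : T -> 'cV[R]_p.
Hypothesis mb : forall j, measurable_fun setT (fun t => b t j 0).

(** The case [b_j = 0] is split off because [ddrho] is known to be measurable on the positive
    half-line only. *)
Lemma measurable_ddrho_coord j : measurable_fun setT (fun t => ddrho `|b t j 0| lam).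
Proof.
rewrite (_ : (fun t => _) = fun t => if b t j 0 == 0 then ddrho 0 lam
    else ddrho `|b t j 0| lam); last first.
  by apply/funext => t; case: eqP => // ->; rewrite normr0.
apply: measurable_fun_if => //; first exact: measurable_fun_eqr.
set E := _ `&` _.
suff : measurable_fun E ((ddrho ^~ lam) \o (fun t => `|b t j 0|)) by [].
apply: (@measurable_comp _ _ _ T R R (`]0, +oo[%classic)) => //.
- by move=> _ [t [_ /= tb] <-]; rewrite /= in_itv/= andbT normr_gt0 tb.
- exact: measurable_ddrho.
- by apply: measurable_funTS; apply: measurableT_comp.
Qed.

(** The dimension of Q varies with the support; a sum over all index sets, in which only the actual
    support contributes, has terms of fixed size. *)
Lemma measurable_inv_hessian i j :
  measurable_fun setT (fun t => inv_hessian X ddrho lam (b t) i j).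
Proof.
rewrite (_ : (fun t => _) = fun t => \sum_(A : {set 'I_p})
    if supp (b t) == A then inv_hessian_on X ddrho lam A (b t) i j else 0); last first.
  apply/funext => t; rewrite (bigD1 (supp (b t)))//= eqxx big1 ?addr0.
    by rewrite inv_hessianE.
  by move=> A /negPf; rewrite eq_sym => ->.
apply: measurable_sum => A; apply: measurable_fun_ifT => //.
  apply: (measurable_fun_bool true); rewrite setTI.
  rewrite (_ : _ @^-1` _ = \bigcap_(l in [set: 'I_p]) [set t | (b t l 0 != 0) = (l \in A)]).
    apply: fin_bigcap_measurable => // l _.
    rewrite (_ : [set t | _] = (fun t => b t l 0 == 0) @^-1` [set l \notin A]).
      by rewrite -[X in measurable X]setTI; apply: measurable_fun_eqr.
    apply/seteqP; split => t /=; first by move=> <-; rewrite negbK.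
    by move=> ->; rewrite negbK.
  apply/seteqP; split => t /= h; first by move=> l _ /=; rewrite -(eqP h) inE.
  by apply/eqP/setP => l; have := h l I; rewrite /= inE.
have mH i' j' : measurable_fun setT (fun t => hessian X ddrho lam (b t) i' j').
  rewrite (_ : (fun t => _) = fun t => gram X i' j' + ddrho `|b t j' 0| lam *+ (i' == j')).
    apply: measurable_funD => //.
    by case: eqP => _ //=; exact: measurable_ddrho_coord.
  by apply/funext => t; rewrite !mxE; case: eqP => // ->.
by apply: measurable_mulmx => //; apply: measurable_mulmx => //; apply: measurable_invmx;
  apply: measurable_mulmx => //; apply: measurable_mulmx.
Qed.

End measurable_inv_hessian.

(** * Risk identities *)

Section stein_identity.
Context {R : realType} {d : measure_display} {Omega : measurableType d}.
Variables (P : probability Omega R) (n : nat) (sigma : R).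
Variable eps : 'I_n -> {RV P >-> R}.
Hypothesis heps : gaussian_noise sigma eps.

Lemma degenerate_noise : sigma = 0 -> {ae P, forall w, noise eps w = 0}.
Proof.
move=> s0; pose N := [set w | forall i, [set 0 : R] (eps i w)].
have mN : measurable N.
  rewrite (_ : N = \bigcap_(i in [set: 'I_n]) (eps i @^-1` [set 0])).
    exact: fin_bigcap_measurable.
  by apply/seteqP; split => w h; [move=> i _; exact: h|move=> i; exact: (h i)].
have PN : P N = 1%E.
  rewrite /N (heps (B := fun _ => [set 0]) (fun _ => measurable_set1 0)) big1// => i _; rewrite /centered_normal s0 eqxx.
  by rewrite diracE mem_set.
exists (~` N); split; first exact: measurableC.
  by rewrite probability_setC// PN subee.
move=> w /=; apply: contra_notP => /contrapT Nw.
by apply/matrixP => i j; rewrite !mxE; exact: (Nw i).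
Qed.

Lemma noise_ae_eq (f : vec n -> R) : sigma = 0 -> measurable_fun setT f ->
  P.-integrable setT (fun w => (f (noise eps w))%:E) /\
  (\int[P]_w f (noise eps w) = f 0).
Proof.
move=> s0 mf; have mfn : measurable_fun setT (fun w => (f (noise eps w))%:E).
  by apply/measurable_EFinP; exact: (measurableT_comp mf (measurable_noise eps)).
have feq : ae_eq P setT (fun w => (f (noise eps w))%:E) (cst (f 0)%:E).
  by apply: filterS (degenerate_noise s0) => w /= -> _.
have ic := finite_measure_integrable_cst P (f 0) measurableT.
have fi : P.-integrable setT (fun w => (f (noise eps w))%:E).
  apply/integrableP; split => //.
  rewrite (ae_eq_integral (fun=> `|(f 0)%:E|%E))//; last 2 first.
  - exact: measurableT_comp.
  - by apply: filterS feq => w h Dw; rewrite (h Dw).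
  by have /integrableP[_] := ic.
split => //; rewrite /Rintegral (ae_eq_integral (cst (f 0)%:E))//.
by rewrite integral_cst// [X in (_ * X)%E]probability_setT mule1.
Qed.

Lemma noise_growth_integrable (K C : R) (f : vec n -> R) : 0 <= C ->
  measurable_fun setT f -> (forall x, `|f x| <= K * expR (C * l1norm (x : 'cV[R]_n))) ->
  P.-integrable setT (fun w => (f (noise eps w))%:E).
Proof.
move=> C0 mf fK; have [s0|s0] := eqVneq sigma 0.
  by have [] := noise_ae_eq s0 mf.
exact: (integrable_exp_growth s0 heps C0 mf fK).
Qed.

(** For [sigma = 0] the noise is almost surely 0 and both sides vanish, since [dot v 0 = 0].
    Convergence of the quotients is asked only for [sigma != 0], because at the single point 0 it
    may fail. *)
Lemma stein_identity (v : 'cV[R]_n) (f G : vec n -> R) (K C L : R) :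
  0 <= K -> 0 <= C -> measurable_fun setT f ->
  (forall x, `|f x| <= K * expR (C * l1norm (x : 'cV[R]_n))) ->
  (forall x h, 0 < h -> `|f ((x : 'cV[R]_n) + h *: v) - f x| <= L * h) ->
  measurable_fun setT G ->
  (sigma != 0 -> {ae P, forall w,
    (f (noise eps w + m.+1%:R^-1 *: v) - f (noise eps w)) / m.+1%:R^-1
     @[m --> \oo] --> G (noise eps w)}) ->
  [/\ P.-integrable setT (fun w => (f (noise eps w) * dot v (noise eps w))%:E),
      P.-integrable setT (fun w => (G (noise eps w))%:E)
    & \int[P]_w (f (noise eps w) * dot v (noise eps w)) =
      sigma ^+ 2 * \int[P]_w G (noise eps w)].
Proof.
move=> K0 C0 mf fK fL mG fG.
have [s0|s0] := eqVneq sigma 0; last first.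
  have mGn : measurable_fun setT (fun w => G (noise eps w)).
    exact: (measurableT_comp mG (measurable_noise eps)).
  have [i1 i2 E] := stein_noise s0 heps K0 C0 mf fK fL mGn (fG s0).
  split => //; rewrite /Rintegral E fineM//.
  exact: integrable_fin_num.
have mfv : measurable_fun setT (fun x : vec n => f x * dot v x).
  by apply: measurable_funM => //; exact: measurable_dot.
have [i1 E1] := noise_ae_eq s0 mfv; have [i2 E2] := noise_ae_eq s0 mG.
split => //; rewrite E1 s0 expr0n mul0r.
by rewrite (_ : dot v 0 = 0) ?mulr0// -(scale0r v) dotZr mul0r.
Qed.

(** A class that contains the Lipschitz functions, is closed under products and consists of
    functions integrable against the noise. *)
Definition subexponential (f : vec n -> R) : Prop := measurable_fun setT f /\
  exists K C, [/\ 0 <= K, 0 <= C &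
    forall x, `|f x| <= K * expR (C * l1norm (x : 'cV[R]_n))].

Lemma subexponential_lipschitz (f : 'cV[R]_n -> R) (L : R) : 0 <= L ->
  (forall x y, `|f x - f y| <= L * l1norm (x - y)) -> subexponential f.
Proof.
move=> L0 fL; split; first exact: (lipschitz_measurable fL).
exists (`|f 0| + L), 1; split => // [|x]; first by rewrite addr_ge0.
have h1 : 1 <= expR (1 * l1norm x) by rewrite mul1r -expR0 ler_expR l1norm_ge0.
have h2 : l1norm x <= expR (1 * l1norm x) by rewrite mul1r le_expR2.
have := fL x 0; rewrite subr0 => h3.
rewrite -(subrK (f 0) (f x)); apply: le_trans (ler_normD _ _) _.
rewrite mulrDl addrC lerD//; first by rewrite ler_peMr.
by apply: le_trans h3 _; rewrite ler_wpM2l.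
Qed.

Lemma subexponential_dot (v : 'cV[R]_n) : subexponential (dot v).
Proof.
have [C C0 hC] := dot_le_l1norm v.
by apply: (subexponential_lipschitz C0) => x y; rewrite -dotBr.
Qed.

Lemma subexponentialM (f g : vec n -> R) :
  subexponential f -> subexponential g -> subexponential (fun x => f x * g x).
Proof.
move=> [mf [K [C [K0 C0 fK]]]] [mg [K' [C' [K'0 C'0 gK]]]]; split.
  exact: measurable_funM.
exists (K * K'), (C + C'); split; [exact: mulr_ge0|exact: addr_ge0|move=> x].
by rewrite normrM mulrDl expRD mulrACA ler_pM.
Qed.

Lemma subexponential_bounded (f : vec n -> R) (K : R) : measurable_fun setT f ->
  (forall x, `|f x| <= K) -> subexponential f.
Proof.
move=> mf fK; split => //; exists K, 0; split => //.
  by apply: le_trans (fK 0).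
by move=> x; rewrite mul0r expR0 mulr1.
Qed.

Lemma subexponential_integrable (f : vec n -> R) : subexponential f ->
  P.-integrable setT (fun w => (f (noise eps w))%:E).
Proof. by move=> [mf [K [C [_ C0 fK]]]]; exact: noise_growth_integrable C0 mf fK. Qed.

Lemma noise_ae_transfer (f g : vec n -> R) :
  measurable_fun setT f -> measurable_fun setT g ->
  {ae P, forall w, f (noise eps w) = g (noise eps w)} ->
  P.-integrable setT (fun w => (f (noise eps w))%:E) ->
  P.-integrable setT (fun w => (g (noise eps w))%:E) /\
  \int[P]_w f (noise eps w) = \int[P]_w g (noise eps w).
Proof.
move=> mf mg fg fi.
have mn (F : vec n -> R) : measurable_fun setT F ->
    measurable_fun setT (fun w => (F (noise eps w))%:E).
  by move=> mF; apply/measurable_EFinP; exact: (measurableT_comp mF (measurable_noise eps)).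
have feq : ae_eq P setT (fun w => (f (noise eps w))%:E) (fun w => (g (noise eps w))%:E).
  by apply: filterS fg => w -> _.
split; last first.
  by rewrite /Rintegral (ae_eq_integral (fun w => (g (noise eps w))%:E))//; exact: mn.
apply/integrableP; split; first exact: mn.
rewrite (ae_eq_integral (fun w => `|(f (noise eps w))%:E|%E))//.
- by have /integrableP[] := fi.
- by apply: measurableT_comp => //; exact: mn.
- by apply: measurableT_comp => //; exact: mn.
- by apply: filterS feq => w h Dw; rewrite (h Dw).
Qed.

Lemma mean_cst (c : R) : \int[P]_w c = c.
Proof.
rewrite [LHS](Rintegral_cst P measurableT c).
by rewrite [X in fine X]probability_setT mulr1.
Qed.

Lemma Rintegral_sum (I : Type) (s : seq I) (F : I -> Omega -> R) :
  (forall i, P.-integrable setT (fun w => (F i w)%:E)) ->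
  P.-integrable setT (fun w => (\sum_(i <- s) F i w)%:E) /\
  \int[P]_w (\sum_(i <- s) F i w) = \sum_(i <- s) \int[P]_w F i w.
Proof.
move=> hF; elim: s => [|i s [ints Es]].
  rewrite big_nil; split; last by under eq_Rintegral do rewrite big_nil; exact: mean_cst.
  by under eq_fun do rewrite big_nil; exact: integrable0.
rewrite big_cons; split.
  by under eq_fun do rewrite big_cons EFinD; exact: integrableD.
under eq_Rintegral do rewrite big_cons.
rewrite RintegralD//; last exact: hF.
by congr (_ + _); exact: Es.
Qed.

(** Stein's identity for a linear function, whose derivative along [v] is the constant [dot u v]. *)
Lemma noise_covariance (u v : 'cV[R]_n) :
  \int[P]_w (dot u (noise eps w) * dot v (noise eps w)) = sigma ^+ 2 * dot u v.
Proof.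
have [mu [K [C [K0 C0 uK]]]] := subexponential_dot u.
have incr x h : dot u (x + h *: v) - dot u x = h * dot u v.
  by rewrite dotDr dotZr addrAC subrr add0r.
have [|//||_ _ ->] := @stein_identity v (dot u) (cst (dot u v)) K C `|dot u v| K0 C0 mu uK.
- by move=> x h h0; rewrite incr normrM (gtr0_norm h0) mulrC.
- move=> _; apply: aeW => w; apply: cvg_near_cst; apply: nearW => m.
  by rewrite incr mulrC mulKf ?gt_eqF ?invr_gt0.
- by congr (_ * _); exact: mean_cst.
Qed.

(** Stein's identity for [f <v, x>]: as [f] does not change along [v], the derivative is [f |v|^2],
    which is bounded. *)
Lemma noise_square_invariant (v : 'cV[R]_n) (f : vec n -> R) (K : R) :
  measurable_fun setT f -> (forall x, `|f x| <= K) ->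
  (forall (x : 'cV[R]_n) h, f (x + h *: v) = f x) ->
  P.-integrable setT (fun w => (f (noise eps w) * dot v (noise eps w) ^+ 2)%:E) /\
  \int[P]_w (f (noise eps w) * dot v (noise eps w) ^+ 2) =
    sigma ^+ 2 * (sqnorm v * \int[P]_w f (noise eps w)).
Proof.
move=> mf fK finv.
have sf := subexponential_bounded mf fK.
pose F (x : vec n) := f x * dot v x.
have sF : subexponential F by apply: subexponentialM => //; exact: subexponential_dot.
have [mF [K' [C [K'0 C0 FK]]]] := sF.
have incr (x : 'cV[R]_n) h : F (x + h *: v) - F x = h * (f x * sqnorm v).
  by rewrite /F finv dotDr dotZr dot_sqnorm; ring.
have fi := subexponential_integrable sf.
have [|||i1 i2 E] := @stein_identity v F (fun x => f x * sqnorm v) K' C (K * sqnorm v) K'0 C0 mF FK.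
- move=> x h h0; rewrite incr normrM (gtr0_norm h0) mulrC ler_wpM2r ?(ltW h0)//.
  by rewrite normrM (ger0_norm (sqnorm_ge0 v)) ler_wpM2r ?sqnorm_ge0.
- exact: measurable_funM.
- move=> _; apply: aeW => w; apply: cvg_near_cst; apply: nearW => m.
  by rewrite incr mulrC mulKf ?gt_eqF ?invr_gt0.
split.
  by under eq_fun do rewrite expr2 mulrA.
under eq_Rintegral do rewrite expr2 mulrA.
rewrite E; congr (_ * _).
by rewrite [RHS]mulrC RintegralZr.
Qed.

End stein_identity.

(** * Unbiased estimation of the risk *)

Section risk_identity.
Context {R : realType} {d : measure_display} {Omega : measurableType d}.
Variables (P : probability Omega R) (n p : nat) (X : 'M[R]_(n, p)) (beta : 'cV[R]_p).
Variables (sigma : R) (eps : 'I_n -> {RV P >-> R}).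
Variables (rho ddrho : R -> R -> R) (lam k : R) (betahat : 'cV[R]_n -> 'cV[R]_p).
Hypothesis heps : gaussian_noise sigma eps.
Hypothesis lam_gt0 : 0 < lam.
Hypothesis pen : penalty rho ddrho lam.
Hypothesis gram_unit : gram X \in unitmx.
Let phi := drho rho lam.
Hypothesis hk : forall s t, 0 < s -> s <= t -> phi s - phi t <= k * (t - s).
Hypothesis k_lt_cmin : k < cmin (gram X).
Hypothesis hmin : forall y, is_argmin (ploss X y rho lam) (betahat y).

Let S := gram X.
(** [Lam] maps the noise to its effect on z, [W] maps it to the error of least squares, and [U] is a
    right inverse of [Lam], so that every direction of z is reached. *)
Let Lam : 'M[R]_(p, n) := n%:R^-1 *: X^T.
Let W : 'M[R]_(p, n) := invmx S *m Lam.
Let U : 'M[R]_(n, p) := X *m invmx S.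
Let Z (x : 'cV[R]_n) : 'cV[R]_p := n%:R^-1 *: (X^T *m (X *m beta + x)).
Let B (x : 'cV[R]_n) : 'cV[R]_p := betahat (X *m beta + x).
Let H (x : 'cV[R]_n) : 'M[R]_p := inv_hessian X ddrho lam (B x).

Let phi0 : phi t @[t --> 0^'+] --> lam := slope0_cvg pen hk.

Let LamX : Lam *m X = S.
Proof. by rewrite /Lam -scalemxAl. Qed.

Let S_sym : S^T = S. Proof. exact: gram_sym. Qed.

Let LamU : Lam *m U = 1%:M.
Proof. by rewrite /U mulmxA LamX mulmxV. Qed.

Let Lam_tr : Lam *m Lam^T = n%:R^-1 *: S.
Proof. by rewrite {2}/Lam linearZ/= trmxK -scalemxAr LamX. Qed.

Let LamWt : Lam *m W^T = n%:R^-1 *: 1%:M.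
Proof.
by rewrite /W trmx_mul mulmxA Lam_tr -scalemxAl trmx_inv S_sym mulmxV.
Qed.

Let WWt : W *m W^T = n%:R^-1 *: invmx S.
Proof. by rewrite {1}/W -mulmxA LamWt -scalemxAr mulmx1. Qed.

Let ZD x v : Z (x + v) = Z x + Lam *m v.
Proof. by rewrite /Z /Lam addrA [in LHS]mulmxDr scalerDr -scalemxAl. Qed.

Let gram_coercive v : cmin S * sqnorm v <= dot v (S *m v).
Proof.
apply: quad_ge_cmin => // u.
by rewrite -scalemxAl dotZr -mulmxA dot_mulmx trmxK dot_sqnorm mulr_ge0 ?invr_ge0 ?sqnorm_ge0.
Qed.

Let ZB x : kkt S phi lam (Z x) (B x).
Proof. exact: argmin_kkt pen hk (hmin _). Qed.

Let B_lip := solution_lipschitz lam_gt0 pen hk k_lt_cmin gram_coercive ZD ZB.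
Let mB := measurable_solution lam_gt0 pen hk k_lt_cmin gram_coercive ZD ZB.

Let mH i j : measurable_fun setT (fun x : vec n => H x i j).
Proof. exact: (measurable_inv_hessian X pen mB). Qed.

Let mdotH a a' : measurable_fun setT (fun x : vec n => dot a (H x *m a')).
Proof.
apply: measurable_sum => i; apply: measurable_funM => //.
rewrite (_ : (fun x => _) = fun x => \sum_j H x i j * a' j 0).
  by apply: measurable_sum => j; exact: measurable_funM.
by apply/funext => x; rewrite mxE.
Qed.

Let dotB_lip a : exists2 L, 0 <= L & forall x y,
  `|dot a (B x) - dot a (B y)| <= L * l1norm (x - y).
Proof.
have [L L0 hL] := B_lip; exists (l1norm a * L) => [|x y].
  by rewrite mulr_ge0// l1norm_ge0.
rewrite -dotBr (le_trans (ler_norm_sum _ _ _))// -mulrA mulr_suml ler_sum// => j _.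
by rewrite normrM ler_wpM2l// !mxE.
Qed.

Lemma ae_directional_derivative (a : 'cV[R]_p) (v : 'cV[R]_n) : sigma != 0 ->
  {ae P, forall w, (dot a (B (noise eps w + m.+1%:R^-1 *: v)) - dot a (B (noise eps w)))
    / m.+1%:R^-1 @[m --> \oo] --> dot a (H (noise eps w) *m (Lam *m v))}.
Proof.
move=> s0.
apply: filterS (ae_regular heps lam_gt0 pen hk k_lt_cmin gram_coercive ZD LamU ZB s0).
move=> w reg; set x := noise eps w in reg *.
have hdd j : B x j 0 != 0 -> - k <= ddrho `|B x j 0| lam.
  move=> bj; have := reg j; rewrite (negPf bj) => dj.
  by apply: (slope_derive_ge hk _ dj); rewrite normr_gt0.
have Qu := Qmx_unit k_lt_cmin gram_coercive hdd.
have der := kkt_derivative lam_gt0 hk phi0 k_lt_cmin gram_coercive (ZB x) reg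
  (inv_hessian_off X ddrho lam (Lam *m v)) (fun j => inv_hessian_on_supp (Lam *m v) Qu).
have A0 : 0 < 1 + l1norm a by rewrite ltr_pwDl// l1norm_ge0.
apply/cvgrPdist_le => e e0.
have [r r0 hr] := der (e / (1 + l1norm a)) ltac:(exact: divr_gt0).
near=> m.
have hr' : `|m.+1%:R^-1 : R| < r.
  rewrite gtr0_norm ?invr_gt0//; near: m; exact: near_infty_natSinv_lt (PosNum r0).
set h : R := m.+1%:R^-1 in hr' *.
have h0 : 0 < h by rewrite invr_gt0.
have hB : kkt S phi lam (Z x + h *: (Lam *m v)) (B (x + h *: v)).
  by rewrite scalemxAr -ZD; exact: ZB.
have {}hr := hr h hr' _ (lt0r_neq0 h0) hB.
rewrite -dotBr distrC mulrC -dotZr -dotBr.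
apply: le_trans (ler_norm_sum _ _ _) _.
apply: (@le_trans _ _ (\sum_j `|a j 0| * (e / (1 + l1norm a)))).
  apply: ler_sum => j _; rewrite normrM ler_wpM2l//.
  by have := hr j; rewrite [X in _ -> `|X| <= _]mxE [in X in _ -> `|_ + X| <= _]mxE !mxE.
by rewrite -mulr_suml mulrCA ger_pMr// ler_pdivrMr// mul1r -/(l1norm a) lerDr.
Unshelve. all: by end_near. Qed.

Let sub_dotB a : subexponential (fun x : vec n => dot a (B x - beta)).
Proof.
have [L L0 hL] := dotB_lip a; apply: (subexponential_lipschitz L0) => x y.
by rewrite -dotBr opprB addrA subrK dotBr.
Qed.

(** Used along [W^T a'] for the cross term of the risk, and along [U a'] for the integrability of
    the Hessian form. *)
Lemma solution_stein (a : 'cV[R]_p) (v : 'cV[R]_n) :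
  [/\ P.-integrable setT
        (fun w => (dot a (B (noise eps w) - beta) * dot v (noise eps w))%:E),
      P.-integrable setT (fun w => (dot a (H (noise eps w) *m (Lam *m v)))%:E)
    & \int[P]_w (dot a (B (noise eps w) - beta) * dot v (noise eps w)) =
      sigma ^+ 2 * \int[P]_w dot a (H (noise eps w) *m (Lam *m v))].
Proof.
have [mf [K [C [K0 C0 fK]]]] := sub_dotB a.
have [L L0 hL] := dotB_lip a.
apply: (stein_identity heps (G := fun x => dot a (H x *m (Lam *m v)))
  (L := L * l1norm v) K0 C0 mf fK).
- move=> x h h0; rewrite -dotBr opprB addrA subrK dotBr (le_trans (hL _ _))//.
  by rewrite addrAC subrr add0r l1normZ (gtr0_norm h0) mulrCA mulrC.
- exact: mdotH.
- move=> s0; apply: filterS (ae_directional_derivative a v s0) => w hc.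
  apply: cvg_trans hc; apply: near_eq_cvg; apply: nearW => m.
  by rewrite !dotBr; congr (_ / _); ring.
Qed.

Lemma integrable_inv_hessian (a a' : 'cV[R]_p) :
  P.-integrable setT (fun w => (dot a (H (noise eps w) *m a'))%:E).
Proof.
have [_ + _] := solution_stein a (U *m a').
by rewrite (mulmxA Lam) LamU mul1mx.
Qed.

(** The form is almost surely a limit of difference quotients of a Lipschitz function; one quotient
    within distance 1 of the limit accounts for the [+ 1] in the bound. *)
Lemma ae_bounded_inv_hessian (a a' : 'cV[R]_p) : sigma != 0 ->
  exists K, {ae P, forall w, `|dot a (H (noise eps w) *m a')| <= K}.
Proof.
move=> s0; have [L L0 hL] := dotB_lip a.
exists (L * l1norm (U *m a') + 1).
apply: filterS (ae_directional_derivative a (U *m a') s0) => w.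
rewrite (mulmxA Lam) LamU mul1mx; set q := dot a (H _ *m _).
move=> /cvgrPdist_le/(_ 1 ltr01)[N _ /(_ N (leqnn N))] /=.
set h : R := N.+1%:R^-1; have h0 : 0 < h by rewrite invr_gt0.
set t := _ / h => ht.
have : `|t| <= L * l1norm (U *m a').
  rewrite /t normrM normfV (gtr0_norm h0) ler_pdivrMr// (le_trans (hL _ _))//.
  by rewrite addrAC subrr add0r l1normZ (gtr0_norm h0) mulrCA mulrC.
move=> tL; rewrite -(subrK t q); apply: le_trans (ler_normD _ _) _.
by rewrite addrC lerD.
Qed.

(** The orthogonal projection onto the residual space of least squares. Its rows [h i] are
    annihilated by [Lam], and their squared norms add up to its trace [n - p]. *)
Let resid : 'M[R]_n := 1%:M - X *m W.

Let resid_Lam : resid *m Lam^T = 0.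
Proof.
rewrite /resid mulmxBl mul1mx -mulmxA /W -mulmxA Lam_tr -scalemxAr mulVmx//.
by rewrite -scalemxAr mulmx1 /Lam linearZ/= trmxK subrr.
Qed.

Let resid_sq : resid *m resid^T = resid.
Proof.
rewrite {2}/resid linearB/= trmx1 mulmxBr mulmx1 trmx_mul /W trmx_mul !mulmxA.
by rewrite resid_Lam !mul0mx subr0.
Qed.

Let resid_trace : \tr resid = n%:R - p%:R.
Proof.
rewrite /resid linearB/= mxtrace1 mxtrace_mulC /W -mulmxA LamX mulVmx//.
by rewrite mxtrace1.
Qed.

Let h i : 'cV[R]_n := (row i resid)^T.

Let Lam_h i : Lam *m h i = 0.
Proof.
by rewrite /h -[LHS]trmxK trmx_mul trmxK -row_mul resid_Lam row0 trmx0.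
Qed.

Let sqnorm_resid x : sqnorm (resid *m x) = \sum_i dot (h i) x ^+ 2.
Proof.
apply: eq_bigr => i _; congr (_ ^+ 2); rewrite mxE.
by apply: eq_bigr => j _; rewrite !mxE.
Qed.

Let sum_sqnorm_h : \sum_i sqnorm (h i) = n%:R - p%:R.
Proof.
rewrite -resid_trace -resid_sq; apply: eq_bigr => i _.
by rewrite [RHS]mxE; apply: eq_bigr => j _; rewrite !mxE expr2.
Qed.

(** [betahat] is given as a function of y; uniqueness of the stationary point shows that it depends
    on y only through z. *)
Let B_invariant x v c : Lam *m v = 0 -> B (x + c *: v) = B x.
Proof.
move=> Lv; apply: (kkt_unique lam_gt0 hk phi0 k_lt_cmin gram_coercive (ZB _)).
by have := ZB x; rewrite ZD -scalemxAr Lv scaler0 addr0.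
Qed.

Let measurable_resid : measurable_fun setT (fun x : vec n => sqnorm (resid *m x)).
Proof.
rewrite (_ : (fun x => _) = fun x : vec n => \sum_i dot (h i) x ^+ 2); last first.
  by apply/funext => x; rewrite sqnorm_resid.
apply: measurable_sum => i; apply: measurable_funX; exact: measurable_dot.
Qed.

Lemma residual_invariant (f : vec n -> R) (K : R) :
  measurable_fun setT f -> (forall x, `|f x| <= K) ->
  (forall (x v : 'cV[R]_n) c, Lam *m v = 0 -> f (x + c *: v) = f x) ->
  P.-integrable setT (fun w => (f (noise eps w) * sqnorm (resid *m noise eps w))%:E) /\
  \int[P]_w (f (noise eps w) * sqnorm (resid *m noise eps w)) =
    sigma ^+ 2 * ((n%:R - p%:R) * \int[P]_w f (noise eps w)).
Proof.
move=> mf fK finv.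
have hi i := noise_square_invariant heps mf fK (fun x c => finv x _ c (Lam_h i)).
have fE w : f (noise eps w) * sqnorm (resid *m noise eps w) =
    \sum_i f (noise eps w) * dot (h i) (noise eps w) ^+ 2.
  by rewrite sqnorm_resid mulr_sumr.
have [ints E] := Rintegral_sum (index_enum 'I_n) (fun i => (hi i).1).
split; first by under eq_fun do rewrite fE.
under eq_Rintegral do rewrite fE.
rewrite E (eq_bigr (fun i => sigma ^+ 2 * (sqnorm (h i) * \int[P]_w f (noise eps w)))).
  by rewrite -mulr_sumr -mulr_suml sum_sqnorm_h.
by move=> i _; have [_ ->] := hi i.
Qed.

(* H is bounded only almost surely, hence the truncation. *)
Lemma residual_inv_hessian (a a' : 'cV[R]_p) :
  P.-integrable setT
    (fun w => (dot a (H (noise eps w) *m a') * sqnorm (resid *m noise eps w))%:E) /\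
  \int[P]_w (dot a (H (noise eps w) *m a') * sqnorm (resid *m noise eps w)) =
    sigma ^+ 2 * ((n%:R - p%:R) * \int[P]_w dot a (H (noise eps w) *m a')).
Proof.
pose f (x : vec n) := dot a (H x *m a').
have mfr : measurable_fun setT (fun x : vec n => f x * sqnorm (resid *m x)).
  by apply: measurable_funM => //; exact: mdotH.
have [s0|s0] := eqVneq sigma 0.
  have [intf E] := noise_ae_eq heps s0 mfr; split; first exact: intf.
  by rewrite E s0 expr0n mul0r mulmx0 sqnorm0 mulr0.
have [K fK] := ae_bounded_inv_hessian a a' s0.
pose g (x : vec n) := Num.min `|K| (Num.max (- `|K|) (f x)).
have gf : {ae P, forall w, g (noise eps w) = f (noise eps w)}.
  apply: filterS fK => w; rewrite -/(f _) => /(fun H => le_trans H (ler_norm K)).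
  by rewrite ler_norml /g => /andP[h1 h2]; rewrite max_r// min_r.
have mg : measurable_fun setT g.
  by apply: measurable_minr => //; apply: measurable_maxr => //; exact: mdotH.
have gK x : `|g x| <= `|K|.
  by rewrite ler_norml /g le_min ge_min lexx !(le_max, lexx)/= andbT ge0_cp.
have ginv (x v : 'cV[R]_n) c : Lam *m v = 0 -> g (x + c *: v) = g x.
  by move=> Lv; rewrite /g /f /H B_invariant.
have [intg E] := residual_invariant mg gK ginv.
have mgr : measurable_fun setT (fun x : vec n => g x * sqnorm (resid *m x)).
  exact: measurable_funM.
have [|intfr <-] := noise_ae_transfer mgr mfr _ intg.
  by apply: filterS gf => w ->.
split; first exact: intfr.
rewrite E; do 2 congr (_ * _).
have gint := subexponential_integrable heps (subexponential_bounded mg gK).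
by have [] := noise_ae_transfer mg (mdotH a a') gf gint.
Qed.

Let xi w : 'cV[R]_p := W *m noise eps w.
Let err w : 'cV[R]_p := B (noise eps w) - beta.
Let Minv := invmx S.

Let scal (f : Omega -> R) r : P.-integrable setT (fun w => (f w)%:E) ->
  P.-integrable setT (fun w => (r * f w)%:E) /\
  \int[P]_w (r * f w) = r * \int[P]_w f w.
Proof.
move=> fi; split; last by rewrite RintegralZl.
by under eq_fun do rewrite EFinM; exact: integrableZl.
Qed.

(** In the product of the [err - xi], each cross term equals [sigma^2 / n] times the mean Hessian
    form, by Stein's identity and the symmetry of [H]; the [xi] term equals [sigma^2 / n] times the
    form of [Minv]. The correction terms in [s] cancel these, given the mean of [s] and its lack of
    correlation with the Hessian form. Two vectors are kept so that matrix entries, quadratic forms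
    and traces are all covered. *)
Lemma bilinear_risk (s : Omega -> R) (a a' : 'cV[R]_p) :
  P.-integrable setT (fun w => (s w)%:E) ->
  \int[P]_w s w = sigma ^+ 2 ->
  P.-integrable setT (fun w => (dot a (H (noise eps w) *m a') * s w)%:E) ->
  \int[P]_w (dot a (H (noise eps w) *m a') * s w) =
    sigma ^+ 2 * \int[P]_w dot a (H (noise eps w) *m a') ->
  [/\ P.-integrable setT (fun w => (dot a (err w) * dot a' (err w))%:E),
    P.-integrable setT (fun w => (dot a (err w - xi w) * dot a' (err w - xi w) +
       2 * s w / n%:R * dot a (H (noise eps w) *m a') -
       s w / n%:R * dot a (Minv *m a'))%:E)
   & \int[P]_w (dot a (err w - xi w) * dot a' (err w - xi w) +
       2 * s w / n%:R * dot a (H (noise eps w) *m a') -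
       s w / n%:R * dot a (Minv *m a')) =
     \int[P]_w (dot a (err w) * dot a' (err w))].
Proof.
move=> si sE sHi sHE.
have dxi u w : dot u (xi w) = dot (W^T *m u) (noise eps w) by rewrite /xi dot_mulmx.
have i1 : P.-integrable setT (fun w => (dot a (err w) * dot a' (err w))%:E).
  have := subexponential_integrable heps (subexponentialM (sub_dotB a) (sub_dotB a')).
  exact.
have i2 u u' : P.-integrable setT (fun w => (dot u (err w) * dot u' (xi w))%:E) /\
    \int[P]_w (dot u (err w) * dot u' (xi w)) =
    sigma ^+ 2 * (n%:R^-1 * \int[P]_w dot u (H (noise eps w) *m u')).
  have [j1 j2 jE] := solution_stein u (W^T *m u').
  split; first by under eq_fun do rewrite dxi.
  under eq_Rintegral do rewrite dxi.
  rewrite jE; congr (_ * _).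
  rewrite -RintegralZl//; last exact: integrable_inv_hessian.
  apply: eq_Rintegral => w _.
  by rewrite (mulmxA Lam) LamWt -scalemxAl mul1mx -scalemxAr dotZr.
have [i3 E3] : P.-integrable setT (fun w => (dot a (xi w) * dot a' (xi w))%:E) /\
    \int[P]_w (dot a (xi w) * dot a' (xi w)) = sigma ^+ 2 * (n%:R^-1 * dot a (Minv *m a')).
  split.
    under eq_fun do rewrite !dxi.
    have := subexponential_integrable heps
      (subexponentialM (subexponential_dot (W^T *m a)) (subexponential_dot (W^T *m a'))).
    exact.
  under eq_Rintegral do rewrite !dxi.
  rewrite (noise_covariance heps); congr (_ * _).
  by rewrite dotC dot_mulmx trmxK mulmxA WWt -scalemxAl dotZl dotC.
have i4 := integrable_inv_hessian a a'.
pose c := dot a (Minv *m a').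
have [i5 E5] := i2 a a'; have [i6 E6] := i2 a' a.
have HC w : dot a' (H (noise eps w) *m a) = dot a (H (noise eps w) *m a').
  by rewrite dot_mulmx /H inv_hessian_sym dotC.
pose F (i : 'I_6) w : R := tnth [tuple dot a (err w) * dot a' (err w);
  - (dot a (err w) * dot a' (xi w)); - (dot a' (err w) * dot a (xi w));
  dot a (xi w) * dot a' (xi w);
  2 / n%:R * (dot a (H (noise eps w) *m a') * s w); - (c / n%:R) * s w] i.
have TE w : dot a (err w - xi w) * dot a' (err w - xi w) +
    2 * s w / n%:R * dot a (H (noise eps w) *m a') - s w / n%:R * dot a (Minv *m a') =
    \sum_i F i w.
  rewrite !big_ord_recl big_ord0 /F !(tnth_nth 0)/= !dotBr -/c; ring.
have opp (f : Omega -> R) : P.-integrable setT (fun w => (f w)%:E) ->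
    P.-integrable setT (fun w => (- f w)%:E) /\
    \int[P]_w (- f w) = - \int[P]_w f w.
  move=> /(@scal _ (-1)) [fi fE]; split.
    by under eq_fun do rewrite -mulN1r.
  by under eq_Rintegral do rewrite -mulN1r; rewrite fE mulN1r.
have Fi i : P.-integrable setT (fun w => (F i w)%:E).
  rewrite /F; case: i => [[|[|[|[|[|[|//]]]]]] lti];
    under eq_fun do rewrite (tnth_nth 0)/=.
  - exact: i1.
  - by have [] := opp _ i5.
  - by have [] := opp _ i6.
  - exact: i3.
  - by have [] := @scal _ (2 / n%:R) sHi.
  - by have [] := @scal _ (- (c / n%:R)) si.
have [Ti Esum] := Rintegral_sum (index_enum 'I_6) Fi.
split => //; first by under eq_fun do rewrite TE.
under eq_Rintegral do rewrite TE.
set I1 := \int[P]_w (dot a (err w) * dot a' (err w)).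
pose J := \int[P]_w dot a (H (noise eps w) *m a').
have J' : \int[P]_w dot a' (H (noise eps w) *m a) = J.
  by apply: eq_Rintegral => w _; exact: HC.
rewrite Esum (eq_bigr (fun i => tnth [tuple I1;
  - (sigma ^+ 2 * (n%:R^-1 * J)); - (sigma ^+ 2 * (n%:R^-1 * J));
  sigma ^+ 2 * (n%:R^-1 * c); 2 / n%:R * (sigma ^+ 2 * J);
  - (c / n%:R) * sigma ^+ 2] i)); last first.
  rewrite /F => -[[|[|[|[|[|[|//]]]]]] lti] _; rewrite [RHS](tnth_nth 0)/=;
    under eq_Rintegral do rewrite (tnth_nth 0)/=.
  - by [].
  - by have [_ ->] := opp _ i5; rewrite E5.
  - by have [_ ->] := opp _ i6; rewrite E6 J'.
  - exact: E3.
  - by have [_ ->] := @scal _ (2 / n%:R) sHi; rewrite sHE.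
  - by have [_ ->] := @scal _ (- (c / n%:R)) si; rewrite sE.
rewrite !big_ord_recl big_ord0 !(tnth_nth 0)/=; ring.
Qed.

(** For the residual variance, the mean is the case [f = 1] of [residual_invariant] and the product
    formula is [residual_inv_hessian], both divided by [n - p]. *)
Lemma variance_estimator (s : Omega -> R) :
  (forall w, s w = sigma ^+ 2) \/
  ((p < n)%N /\ forall w, s w = sqnorm (resid *m noise eps w) / (n - p)%N%:R) ->
  [/\ P.-integrable setT (fun w => (s w)%:E), \int[P]_w s w = sigma ^+ 2
   & forall a a',
      P.-integrable setT (fun w => (dot a (H (noise eps w) *m a') * s w)%:E) /\
      \int[P]_w (dot a (H (noise eps w) *m a') * s w) =
        sigma ^+ 2 * \int[P]_w dot a (H (noise eps w) *m a')].
Proof.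
case=> [sE|[pn sE]].
  have -> : s = cst (sigma ^+ 2) by apply/funext.
  split; [exact: finite_measure_integrable_cst|exact: mean_cst|move=> a a'].
  have i := integrable_inv_hessian a a'.
  split; last by rewrite RintegralZr// mulrC.
  by under eq_fun do rewrite EFinM; exact: integrableZr.
have np : n%:R - p%:R != 0 :> R by rewrite subr_eq0 eqr_nat gtn_eqF.
have {}sE w : s w = (n%:R - p%:R)^-1 * sqnorm (resid *m noise eps w).
  by rewrite sE natrB ?(ltnW pn)// mulrC.
have m1 : @measurable_fun _ _ (@vec R n) R setT (cst 1) by exact: measurable_cst.
have [||i1 E1] := @residual_invariant _ 1 m1; [by move=> x; rewrite normr1|by []|].
have sE1 w : s w = (n%:R - p%:R)^-1 * (cst 1 (noise eps w) * sqnorm (resid *m noise eps w)).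
  by rewrite sE mul1r.
split.
- by under eq_fun do rewrite sE1; have [] := @scal _ (n%:R - p%:R)^-1 i1.
- under eq_Rintegral do rewrite sE1.
  have [_ ->] := @scal _ (n%:R - p%:R)^-1 i1; rewrite E1 [X in _ * (_ * (_ * X))]mean_cst.
  by rewrite mulr1 mulrCA mulVf ?mulr1.
- move=> a a'; have [i2 E2] := residual_inv_hessian a a'.
  have [i3 E3] := @scal _ (n%:R - p%:R)^-1 i2.
  split; first by under eq_fun do rewrite sE mulrCA.
  under eq_Rintegral do rewrite sE mulrCA.
  by rewrite E3 E2 mulrCA mulKf.
Qed.

End risk_identity.

Lemma ols_add (R : realType) (n p : nat) (X : 'M[R]_(n, p)) (beta : 'cV[R]_p)
    (x : 'cV[R]_n) : gram X \in unitmx ->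
  ols X (X *m beta + x) = beta + invmx (gram X) *m (n%:R^-1 *: X^T) *m x.
Proof.
move=> u; rewrite /ols [in LHS]mulmxDr scalerDr -mulmxA (mulmxA X^T) scalemxAr.
rewrite (scalemxAl _ (X^T *m X)) -/(gram X) mulmxA mulVmx// mul1mx.
by rewrite -!mulmxA -scalemxAl -scalemxAr.
Qed.

Lemma expectation_fine {R : realType} {d : measure_display} {Omega : measurableType d}
    (P : probability Omega R) (f : Omega -> R) :
  P.-integrable setT (fun w => (f w)%:E) -> ('E_P[f])%E = (\int[P]_w f w)%:E.
Proof.
by move=> fi; rewrite unlock /Rintegral fineK//; exact: integrable_fin_num.
Qed.

Theorem theorem7 (R : realType) (d : measure_display)
    (Omega : measurableType d) (P : probability Omega R)
    (n p : nat) (X : 'M[R]_(n, p)) (beta : 'cV[R]_p)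
    (sigma : R) (eps : 'I_n -> {RV P >-> R})
    (rho ddrho : R -> R -> R) (lam : R)
    (betahat : 'cV[R]_n -> 'cV[R]_p) :
  0 <= sigma ->
  gaussian_noise sigma eps ->
  0 < lam ->
  penalty rho ddrho lam ->
  gram X \in unitmx ->
  (max_concavity rho lam < (cmin (gram X))%:E)%E ->
  (forall y : 'cV[R]_n, is_argmin (ploss X y rho lam) (betahat y)) ->
  let y : Omega -> 'cV[R]_n := fun w => X *m beta + \col_i eps i w in
  let bhat := fun w : Omega => betahat (y w) in
  let btil := fun w : Omega => ols X (y w) in
  let Qinv := fun w : Omega => invmx (Qmx X ddrho (bhat w) lam) in
  let Phat := fun w : Omega => Pmx (bhat w) in
  let mse := fun w : Omega => (bhat w - beta) *m (bhat w - beta)^T in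
  let est := fun w : Omega =>
    (bhat w - btil w) *m (bhat w - btil w)^T +
    (2 * sigma ^+ 2 / n%:R) *: ((Phat w)^T *m Qinv w *m Phat w) in
  [/\ mx_integrable P mse,
      mx_integrable P est,
      mx_expectation P mse =
        mx_expectation P est - (sigma ^+ 2 / n%:R) *: invmx (gram X)
    & forall s2hat : Omega -> R,
        (forall w, s2hat w = sigma ^+ 2) \/
        ((p < n)%N /\
         forall w, s2hat w = sqnorm (y w - X *m btil w) / (n - p)%N%:R) ->
        (forall a : 'cV[R]_p,
           unbiased P
             (fun w => `|(a^T *m (bhat w - btil w)) 0 0| ^+ 2 +
                2 * s2hat w / n%:R *
                  ((Phat w *m a)^T *m Qinv w *m (Phat w *m a)) 0 0 -
                s2hat w / n%:R * (a^T *m invmx (gram X) *m a) 0 0)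
             ('E_P[(fun w => `|(a^T *m (bhat w - beta)) 0 0| ^+ 2)%R])%E) /\
        unbiased P
          (fun w => sqnorm (bhat w - btil w) +
             2 * s2hat w / n%:R * \tr (Qinv w) -
             s2hat w / n%:R * \tr (invmx (gram X)))
          ('E_P[(fun w => sqnorm (bhat w - beta))%R])%E].
Proof.
move=> _ heps lam0 pen Su kc hmin y bhat btil Qinv Phat mse est.
have [k kS hk] := max_concavity_bound kc.
pose H w := inv_hessian X ddrho lam (bhat w).
pose xi w := invmx (gram X) *m (n%:R^-1 *: X^T) *m noise eps w.
have btE w : btil w = beta + xi w by rewrite /btil ols_add.
have rE w : y w - X *m btil w =
    (1%:M - X *m (invmx (gram X) *m (n%:R^-1 *: X^T))) *m noise eps w.
  by rewrite btE mulmxDr mulmxBl mul1mx opprD addrA [y w]addrC addrK /xi !mulmxA.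
(* Every conclusion is an instance of this identity: basis vectors with [s = sigma^2] for the matrix
   equation, [a' = a] for the quadratic form, a sum over basis vectors for the trace. *)
have risk (s : Omega -> R) : (forall w, s w = sigma ^+ 2) \/
    ((p < n)%N /\ forall w, s w = sqnorm (y w - X *m btil w) / (n - p)%N%:R) ->
  forall a a' : 'cV[R]_p,
  [/\ P.-integrable setT (fun w => (dot a (bhat w - beta) * dot a' (bhat w - beta))%:E),
    P.-integrable setT (fun w => (dot a (bhat w - btil w) * dot a' (bhat w - btil w) +
       2 * s w / n%:R * dot a (H w *m a') - s w / n%:R * dot a (invmx (gram X) *m a'))%:E)
   & \int[P]_w (dot a (bhat w - btil w) * dot a' (bhat w - btil w) +
       2 * s w / n%:R * dot a (H w *m a') - s w / n%:R * dot a (invmx (gram X) *m a')) =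
     \int[P]_w (dot a (bhat w - beta) * dot a' (bhat w - beta))].
  move=> hs a a'.
  have [|si sE sH] := @variance_estimator _ _ _ _ _ _ _ beta _ _ _ _ _ _ _
    heps lam0 pen Su hk kS hmin s.
    case: hs => [sE|[pn sE]]; first by left.
    by right; split => // w; rewrite sE rE.
  have [sHi sHE] := sH a a'.
  have dE w : bhat w - btil w = bhat w - beta - xi w by rewrite btE opprD addrA.
  have [r1 r2 r3] := bilinear_risk heps lam0 pen Su hk kS hmin si sE sHi sHE.
  split; [exact: r1|by under eq_fun do rewrite dE; exact: r2|].
  by under eq_Rintegral do rewrite dE; exact: r3.
have trE M (a v : 'cV[R]_p) : (a^T *m M *m v) 0 0 = dot a (M *m v).
  by rewrite -mulmxA dot_mx.
have outer (u v : 'cV[R]_p) i j :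
    (u *m v^T) i j = dot (delta_mx i 0) u * dot (delta_mx j 0) v.
  by rewrite mxE big_ord1 mxE !dot_delta.
have entry (M : 'M[R]_p) i j : M i j = dot (delta_mx i 0) (M *m delta_mx j 0).
  by rewrite dot_delta -colE mxE.
pose c := sigma ^+ 2 / n%:R.
have risk0 i j := risk (cst (sigma ^+ 2)) (or_introl (fun=> erefl)) (delta_mx i 0) (delta_mx j 0).
pose T i j w := est w i j - c * invmx (gram X) i j.
have TE i j w : T i j w =
    dot (delta_mx i 0) (bhat w - btil w) * dot (delta_mx j 0) (bhat w - btil w) +
    2 * sigma ^+ 2 / n%:R * dot (delta_mx i 0) (H w *m delta_mx j 0) -
    c * dot (delta_mx i 0) (invmx (gram X) *m delta_mx j 0).
  by rewrite /T /est [in LHS]mxE [X in _ + X - _]mxE outer -!entry.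
have mseE i j w :
    mse w i j = dot (delta_mx i 0) (bhat w - beta) * dot (delta_mx j 0) (bhat w - beta).
  exact: outer.
have mse_int i j : P.-integrable setT (fun w => (mse w i j)%:E).
  by under eq_fun do rewrite mseE; have [] := risk0 i j.
have T_int i j : P.-integrable setT (fun w => (T i j w)%:E).
  by under eq_fun do rewrite TE; have [] := risk0 i j.
have c_int i j := finite_measure_integrable_cst P (c * invmx (gram X) i j) measurableT.
have estE i j w : est w i j = T i j w + cst (c * invmx (gram X) i j) w.
  by rewrite subrK.
have est_int i j : P.-integrable setT (fun w => (est w i j)%:E).
  by under eq_fun do rewrite estE EFinD; exact: (integrableD measurableT (T_int i j) (c_int i j)).
split => //.
  apply/matrixP => i j; rewrite mxE !expectation_fine//= 4!mxE expectation_fine//=.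
  under [X in _ = X + _]eq_Rintegral do rewrite estE.
  rewrite (RintegralD measurableT (T_int i j) (c_int i j)) [X in _ + X - _]mean_cst addrK.
  under eq_Rintegral do rewrite mseE; under [RHS]eq_Rintegral do rewrite TE.
  by have [_ _ ->] := risk0 i j.
move=> s hs; split => [a|].
  have [i1 i2 E] := risk s hs a a.
  have dot2 v : `|(a^T *m v) 0 0| ^+ 2 = dot a v * dot a v.
    by rewrite real_normK ?num_real// dot_mx expr2.
  under [X in unbiased _ X _]eq_fun do rewrite dot2 quad_inv_hessian trE.
  under [X in unbiased _ _ ('E__[X])%E]eq_fun do rewrite dot2.
  by split => //; rewrite !expectation_fine// E.
pose dl i : 'cV[R]_p := delta_mx i 0.
have ri i := risk s hs (dl i) (dl i).
pose G i w := dot (dl i) (bhat w - beta) * dot (dl i) (bhat w - beta).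
pose F i w := dot (dl i) (bhat w - btil w) * dot (dl i) (bhat w - btil w) +
  2 * s w / n%:R * dot (dl i) (H w *m dl i) - s w / n%:R * dot (dl i) (invmx (gram X) *m dl i).
have GE w : sqnorm (bhat w - beta) = \sum_i G i w.
  by apply: eq_bigr => i _; rewrite /G !dot_delta expr2.
have FE w : sqnorm (bhat w - btil w) + 2 * s w / n%:R * \tr (Qinv w) -
    s w / n%:R * \tr (invmx (gram X)) = \sum_i F i w.
  (* Q^-1 has the same trace as the p by p matrix P' Q^-1 P, because P P' = 1. *)
  rewrite big_split/= big_split/= sumrN -!mulr_sumr -mxtrace_inv_hessian.
  congr (_ + _ * _ - _ * _).
  - by apply: eq_bigr => i _; rewrite !dot_delta expr2.
  - by apply: eq_bigr => i _; rewrite -entry.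
  - by apply: eq_bigr => i _; rewrite -entry.
have [Gi EG] := Rintegral_sum (P := P) (index_enum 'I_p) (fun i => let: And3 h _ _ := ri i in h).
have [Fi EF] := Rintegral_sum (P := P) (index_enum 'I_p) (fun i => let: And3 _ h _ := ri i in h).
under [X in unbiased _ X _]eq_fun do rewrite FE.
under [X in unbiased _ _ ('E__[X])%E]eq_fun do rewrite GE.
split; first exact: Fi.
rewrite !expectation_fine//; congr EFin; rewrite [LHS]EF [RHS]EG.
by apply: eq_bigr => i _; have [_ _ ->] := ri i.
Qed.
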